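(* Let $\nu_0\in(-1/2,\infty)$, and let $f\in L^1_{2\nu_0+1,\,0}$ be such that $r\mapsto f(r^{1/2})$ is completely monotone on $(0,\infty)$ and not identically zero. Then the following hold: (1) For every $\nu\in[\nu_0,\infty)$, the function $s\mapsto s^{-\nu-1/2}\,T_\nu f(s^{1/2})$ is completely monotone on $(0,\infty)$. (2) For each fixed $\nu\in[1/2,\infty)\cap[\nu_0,\infty)$, the function $s\mapsto T_\nu f(s)$ is strictly increasing on $(0,\infty)$. (3) For each fixed $\nu\in(-1/2,\infty)\cap[\nu_0,\infty)$, the function $s\mapsto T_\nu f(s)+T_{\nu+1}f(s)$ is strictly increasing on $(0,\infty)$. (4) For each fixed $s\in(0,\infty)$, the function $\nu\mapsto T_\nu f(s)$ is strictly decreasing on $[0,\infty)\cap[\nu_0,\infty)$. (5) For each fixed $\nu\in(-1/2,0)\cap[\nu_0,\infty)$ and $s\in(0,\infty)$, $T_{-\nu}f(s)<T_\nu f(s)$ holds.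
   Context: $L^1_{\nu_1,\nu_2}$ is the space of measurable $f\colon(0,\infty)\to\mathbb{C}$ with $\int_0^1|f(r)|r^{\nu_1}\,dr+\int_1^\infty|f(r)|r^{\nu_2}\,dr<\infty$. For $\nu\in[-1/2,\infty)$, $T_\nu f(s):=\pi\int_0^\infty rs\,J_\nu(rs)^2f(r)\,dr$ for $s\in(0,\infty)$, where $J_\nu$ is the Bessel function of the first kind of order $\nu$ (a Lebesgue integral for $f\in L^1_{2\nu+1,0}$). A function $g\colon(0,\infty)\to\mathbb{R}$ is completely monotone if it is infinitely differentiable and $(-1)^ng^{(n)}(r)\ge0$ for every integer $n\ge0$ and every $r\in(0,\infty)$. *)

(* Defs.v *)
From HB Require Import structures.
From mathcomp Require Import all_boot all_order all_algebra.
From mathcomp Require Import all_classical all_reals all_analysis.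
Set Implicit Arguments.
Unset Strict Implicit.
Unset Printing Implicit Defensive.
Import Order.TTheory GRing.Theory Num.Theory.
Import numFieldNormedType.Exports.
Local Open Scope classical_set_scope.
Local Open Scope ring_scope.

(* Functions on the half-line (0, oo) are total functions R -> R whose values
   outside (0, oo) are never used. *)

(* Euler's integral, which converges (and so gives Gamma) only for x > 0. *)
Definition Gamma (R : realType) (x : R) : R :=
  \int[@lebesgue_measure R]_(t in `]0, +oo[) (t `^ (x - 1) * expR (- t)).

(* The defining series of J_nu(x) for x > 0. As Gamma is evaluated at
   nu + k + 1, this is meaningful only for nu > -1. *)
Definition besselJ (R : realType) (nu x : R) : R :=
  limn (series (fun k : nat =>
    (-1) ^+ k / (k`!%:R * Gamma (nu + k%:R + 1))
    * (x / 2) `^ (2 * k%:R + nu))).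

Definition in_L1 (R : realType) (nu1 nu2 : R) (f : R -> R) : Prop :=
  measurable_fun (`]0, +oo[ : set R) f /\
  (\int[@lebesgue_measure R]_(r in `]0%R, 1%R]) (`|f r| * r `^ nu1)%:E
   + \int[@lebesgue_measure R]_(r in `]1%R, +oo[) (`|f r| * r `^ nu2)%:E
   < +oo)%E.

Definition T (R : realType) (nu : R) (f : R -> R) (s : R) : R :=
  pi * \int[@lebesgue_measure R]_(r in `]0, +oo[)
         (r * s * besselJ nu (r * s) ^+ 2 * f r).

(* [derive1n] is total, so the existence of every derivative has to be
   required explicitly. For r > 0 both clauses depend only on the values of
   g on (0, oo). *)
Definition completely_monotone (R : realType) (g : R -> R) : Prop :=
  forall (n : nat) (r : R), 0 < r ->
    derivable (derive1n n g) r 1 /\ 0 <= (-1) ^+ n * derive1n n g r.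

(* Main.v *)
Require Import Defs.
From HB Require Import structures.
From mathcomp Require Import all_boot all_order all_algebra.
From mathcomp Require Import ring lra.
From mathcomp Require Import all_classical all_reals all_analysis.
From mathcomp Require Import measurable_realfun.
Set Implicit Arguments.
Unset Strict Implicit.
Unset Printing Implicit Defensive.
Import Order.TTheory GRing.Theory Num.Theory.
Import numFieldNormedType.Exports.
Local Open Scope classical_set_scope.
Local Open Scope ring_scope.

(* Write e_t (r) = exp (- t r^2).  Weber's second exponential integral says that
   the transform of e_t is Q_nu (s^2 / t) / (2 sqrt t), where, with a = nu + 1/2,
   Q_nu (x) is a constant times x^a e^(-x) sum_k (a)_k / (2a)_k x^k / k!.  It is
   obtained by integrating the power series of J_nu^2 termwise and applying
   Kummer's transformation to the result.  For f = e_t all claims become claims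
   about Q_nu: monotonicity in x and complete monotonicity are read off the
   coefficients of the power series, and monotonicity in nu comes from the
   Wronskian of I_mu, I_nu, which shows that I_nu / I_mu is increasing, together
   with a bound from Wendel's inequality that makes its limit superior at
   infinity at most 1.

   A completely monotone g is, by Taylor's formula at a point tending to
   infinity, a pointwise limit of nonnegative combinations of exponentials; so
   all nonstrict claims pass from e_t to f (r) = g (r^2), the interchange of
   limits being dominated.  Strictness is preserved because the pointwise
   inequality between the transforms of the e_t leaves room for a combination
   of point evaluations that is positive at f. *)

(** The termwise integral of the series of J_nu^2 alternates and shows no sign; Kummer's
    transformation puts the alternation into e^(-x) and leaves the positive coefficients [rho], from
    which signs can be read. Three signs then explain the ranges of the order. The derivative of
    Q_nu has coefficients with the sign of a - 1 beyond the first, hence nu >= 1/2 for the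
    monotonicity of T_nu f. Adding the next order replaces a (a - 1) by a^2, hence every nu > -1/2
    for the sum. The Wronskian has a derivative with the sign of nu^2 - mu^2, so for mu < nu the
    comparison of orders asks for mu + nu >= 0, which just admits the pair nu, -nu. No asymptotics
    of J_nu at infinity enters. That T_nu f is finite comes again from comparing transforms of
    Gaussians: the kernel r s J_nu(r s)^2 against the weight min(r^(2 nu0 + 1), 1) of the space. *)

Section derivative_facts.
Context {R : realType}.
Implicit Types (f df g : R -> R).

Lemma is_derive_mvt f df (a b : R) : a <= b ->
  (forall x, a <= x <= b -> is_derive x 1 f (df x)) ->
  exists2 c, a <= c <= b & f b - f a = df c * (b - a).
Proof.
move=> ab fd.
have dI x : x \in `]a, b[ -> is_derive x 1 f (df x).
  by rewrite in_itv/= => /andP[/ltW ax /ltW xb]; apply: fd; rewrite ax.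
have cI : {within `[a, b], continuous f}.
  apply: derivable_within_continuous => x; rewrite in_itv/= => xab.
  by have [] := fd x xab.
have [c] := MVT_segment ab dI cI.
by rewrite in_itv/= => cab ->; exists c.
Qed.

Lemma is_derive_ndecr f df (a b : R) : a <= b ->
  (forall x, a <= x <= b -> is_derive x 1 f (df x)) ->
  (forall x, a <= x <= b -> 0 <= df x) -> f a <= f b.
Proof.
move=> ab /(is_derive_mvt ab)[c cab e] /(_ c cab) dc.
by rewrite -subr_ge0 e mulr_ge0// subr_ge0.
Qed.

Lemma is_derive_nincr f df (a b : R) : a <= b ->
  (forall x, a <= x <= b -> is_derive x 1 f (df x)) ->
  (forall x, a <= x <= b -> df x <= 0) -> f b <= f a.
Proof.
move=> ab /(is_derive_mvt ab)[c cab e] /(_ c cab) dc.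
by rewrite -subr_le0 e mulr_le0_ge0// subr_ge0.
Qed.

Lemma is_derive_incr f df (a b : R) : a < b ->
  (forall x, a <= x <= b -> is_derive x 1 f (df x)) ->
  (forall x, a <= x <= b -> 0 < df x) -> f a < f b.
Proof.
move=> ab /(is_derive_mvt (ltW ab))[c cab e] /(_ c cab) dc.
by rewrite -subr_gt0 e mulr_gt0// subr_gt0.
Qed.

Lemma is_derive_continuous f (x l : R) :
  is_derive x 1 f l -> {for x, continuous f}.
Proof.
by move=> fd; apply: differentiable_continuous; apply/derivable1_diffP; case: fd.
Qed.

(** A bound with an explicit constant, unlike a limit in h, survives pointwise convergence of the
    functions; derivatives of limits are found in this way. *)
Lemma is_derive_lipschitz_quotient f (x l M d : R) : 0 < d ->
  (forall h, h != 0 -> `|h| < d -> `|(f (x + h) - f x) / h - l| <= M * `|h|) ->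
  is_derive x 1 f l.
Proof.
move=> d0 H.
have cv : (fun h => h^-1 *: ((f \o shift x) (h *: (1 : R)) - f x)) @ 0^' --> l.
  apply/cvgrPdist_le => e e0.
  have M1 : 0 < `|M| + 1 by rewrite ltr_wpDl.
  near=> h.
  have h0 : h != 0 by near: h; exact: nbhs_dnbhs_neq.
  have hd : `|h| < d.
    by near: h; apply: dnbhs0_lt.
  have he : `|h| < e / (`|M| + 1).
    by near: h; apply: dnbhs0_lt; rewrite divr_gt0.
  rewrite /= distrC /GRing.scale/= mulr1 (addrC h) mulrC.
  apply: (le_trans (H h h0 hd)).
  rewrite (le_trans (ler_norm _))// normrM normr_id.
  move: he; rewrite ltr_pdivlMr// => /ltW; apply: le_trans.
  by rewrite mulrC ler_wpM2l// lerDl.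
have df : derivable f x 1 by apply/cvg_ex; exists l.
apply: DeriveDef => //.
by apply/cvg_lim.
Unshelve. all: by end_near. Qed.

Lemma is_derive_addf f g (x a b : R) : is_derive x 1 f a -> is_derive x 1 g b ->
  is_derive x 1 (fun y => f y + g y) (a + b).
Proof. exact: is_deriveD. Qed.

Lemma is_derive_subf f g (x a b : R) : is_derive x 1 f a -> is_derive x 1 g b ->
  is_derive x 1 (fun y => f y - g y) (a - b).
Proof. exact: is_deriveB. Qed.

Lemma is_derive_mulf f g (x a b : R) : is_derive x 1 f a -> is_derive x 1 g b ->
  is_derive x 1 (fun y => f y * g y) (a * g x + f x * b).
Proof.
move=> fa gb; have := is_deriveM fa gb.
by rewrite /GRing.scale/= addrC (mulrC (g x)).
Qed.

Lemma is_derive_scalef f (c x a : R) : is_derive x 1 f a ->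
  is_derive x 1 (fun y => c * f y) (c * a).
Proof.
move=> fa; have := is_derive_mulf (is_derive_cst c x 1) fa.
by rewrite mul0r add0r.
Qed.

Lemma is_derive_expf (n : nat) f (x a : R) : is_derive x 1 f a ->
  is_derive x 1 (fun y => f y ^+ n) (n%:R * f x ^+ n.-1 * a).
Proof. by move=> fa; have := is_deriveX n fa; rewrite exprfctE. Qed.

Lemma is_derive_sumf (n : nat) (F : nat -> R -> R) (D : nat -> R) (x : R) :
  (forall i, is_derive x 1 (F i) (D i)) ->
  is_derive x 1 (fun y => \sum_(i < n) F i y) (\sum_(i < n) D i).
Proof.
move=> FD; elim: n => [|n IH].
  rewrite big_ord0; under eq_fun do rewrite big_ord0.
  exact: is_derive_cst.
rewrite big_ord_recr/=; under eq_fun do rewrite big_ord_recr/=.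
exact: is_derive_addf.
Qed.

Lemma is_derive_subpow (n : nat) (c x : R) :
  is_derive x 1 (fun y => (c - y) ^+ n) (- (n%:R * (c - x) ^+ n.-1)).
Proof.
elim: n => [|n IH].
  under eq_fun do rewrite expr0.
  by rewrite mul0r oppr0; exact: is_derive_cst.
under eq_fun do rewrite exprS.
have h : is_derive x 1 (fun y => c - y) (0 - 1).
  exact: is_derive_subf.
have := is_derive_mulf h IH; set d := (X in is_derive _ _ _ X) => H.
suff -> : - (n.+1%:R * (c - x) ^+ n.+1.-1) = d by [].
rewrite /d /= -natr1; case: n {IH H d} => [|n] /=; first by rewrite !expr0; ring.
by rewrite exprS; ring.
Qed.

End derivative_facts.

(** * Completely monotone functions and their Taylor series *)

Section cm_tower.
Context {R : realType}.
Implicit Types (G : nat -> R -> R) (g : R -> R).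

(** [G n] stands for (-1)^n g^(n). With the signs absorbed, all levels satisfy the same two
    conditions, so every tail of a tower is a tower and inductions can shift the level. *)
Definition cm_tower G := forall n (x : R), 0 < x ->
  is_derive x 1 (G n) (- G n.+1 x) /\ 0 <= G n x.

Lemma cm_tower_shift G : cm_tower G -> cm_tower (fun n => G n.+1).
Proof. by move=> GG n x x0; exact: GG. Qed.

Lemma cm_tower_nincr G n (x y : R) : cm_tower G -> 0 < x -> x <= y ->
  G n y <= G n x.
Proof.
move=> GG x0 xy.
apply: (@is_derive_nincr _ (G n) (fun x => - G n.+1 x) _ _ xy) => z /andP[xz _].
  by have [] := GG n z (lt_le_trans x0 xz).
by rewrite oppr_le0; have [] := GG n.+1 z (lt_le_trans x0 xz).
Qed.

Lemma completely_monotone_tower g : completely_monotone g ->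
  cm_tower (fun n x => (-1) ^+ n * derive1n n g x).
Proof.
move=> gcm n x x0; split; last by have [] := gcm n x x0.
have [gd _] := gcm n x x0.
have : is_derive x 1 (derive1n n g) (derive1n n.+1 g x).
  by rewrite derive1nS derive1E; apply/derivableP.
by move=> /(is_derive_scalef ((-1) ^+ n)); rewrite exprS mulN1r mulNr opprK.
Qed.

Lemma tower_completely_monotone G g : cm_tower G ->
  (forall x : R, 0 < x -> G 0 x = g x) -> completely_monotone g.
Proof.
move=> GG Gg.
(* [derive1n] differentiates total functions, while h is known only on (0, oo); agreement near x is
   enough. *)
have step n (h : R -> R) : (forall x : R, 0 < x -> h x = (-1) ^+ n * G n x) ->
    forall x : R, 0 < x -> is_derive x 1 h ((-1) ^+ n.+1 * G n.+1 x).
  move=> hE x x0; apply: (@near_eq_is_derive _ _ _ (fun x : R => (-1) ^+ n * G n x)).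
    near=> y.
    have y0 : 0 < y by near: y; exact: lt_nbhsr.
    by rewrite hE.
  have [Gd _] := GG n x x0.
  by have := is_derive_scalef ((-1) ^+ n) Gd; rewrite exprS mulN1r mulNr mulrN.
have E n : forall x : R, 0 < x -> derive1n n g x = (-1) ^+ n * G n x.
  elim: n => [|n IH] x x0; first by rewrite expr0 mul1r Gg.
  rewrite derive1nS derive1E.
  by have st := step n _ IH x x0; rewrite derive_val.
move=> n x x0; split; first by have [] := step n _ (E n) x x0.
by rewrite E// mulrA -expr2 sqrr_sign mul1r; have [] := GG n x x0.
Unshelve. all: by end_near. Qed.

(** Expansion about a point c to the right of x: there the signs of (x - c)^i and of the derivatives
    cancel, and all Taylor terms are nonnegative. *)
Definition taylor_rem (n : nat) G (c x : R) :=
  G 0 x - \sum_(i < n) G i c * (c - x) ^+ i / i`!%:R.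

(** [n.-1] is right also for n = 0: the sum is then empty and the remainder is level 0 itself. *)
Lemma is_derive_taylor_rem (n : nat) G (c x : R) : cm_tower G -> 0 < x ->
  is_derive x 1 (taylor_rem n G c) (- taylor_rem n.-1 (fun n => G n.+1) c x).
Proof.
move=> GG x0; have [G0d _] := GG 0 x x0.
rewrite /taylor_rem.
have D i : is_derive x 1 (fun x => G i c * (c - x) ^+ i / i`!%:R)
    (- (G i c * (i%:R * (c - x) ^+ i.-1) / i`!%:R)).
  have := is_derive_scalef (G i c / i`!%:R) (is_derive_subpow i c x).
  congr is_derive; [by apply/funext => y; ring|by ring].
have := is_derive_subf G0d (is_derive_sumf n D); rewrite sumrN opprK.
congr is_derive; rewrite opprD opprK; congr (- _ + _).
case: n => [|n]/=; first by rewrite !big_ord0.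
rewrite big_ord_recl/= !(mul0r, mulr0) add0r.
apply: eq_bigr => i _.
rewrite /bump/= add1n factS natrM invfM; field.
by rewrite pnatr_eq0 -lt0n fact_gt0/= nat1r pnatr_eq0.
Qed.

Lemma taylor_rem_id (n : nat) G (c : R) : taylor_rem n.+1 G c c = 0.
Proof.
rewrite /taylor_rem big_ord_recl/= subrr expr0 mulr1 divr1 big1 ?addr0 ?subrr//.
by move=> i _; rewrite /bump/= add1n expr0n/= mulr0 mul0r.
Qed.

Lemma taylor_rem_ge0 (n : nat) G (c x : R) : cm_tower G -> 0 < x -> x <= c ->
  0 <= taylor_rem n G c x.
Proof.
elim: n G x => [|n IH] G x GG x0 xc.
  by rewrite /taylor_rem big_ord0 subr0; have [] := GG 0%N x x0.
rewrite -(taylor_rem_id n G c).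
apply: (@is_derive_nincr _ (taylor_rem n.+1 G c)
  (fun x => - taylor_rem n (fun n => G n.+1) c x) _ _ xc) => y /andP[xy yc].
  exact: is_derive_taylor_rem GG (lt_le_trans x0 xy).
by rewrite oppr_le0 IH//; [exact: cm_tower_shift|exact: lt_le_trans xy].
Qed.

(* The inequality says that the remainder divided by (c - x)^n is monotone in
   x; this is what gives convergence on all of (0, c] and not just near c. *)
Lemma taylor_rem_le (n : nat) G (c x : R) : cm_tower G -> 0 < x -> x <= c ->
  n%:R * taylor_rem n G c x <= (c - x) * taylor_rem n.-1 (fun n => G n.+1) c x.
Proof.
elim: n G x => [|n IH] G x GG x0 xc.
  rewrite mul0r; apply: mulr_ge0; first by rewrite subr_ge0.
  by apply: taylor_rem_ge0 => //; exact: cm_tower_shift.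
pose S (G : nat -> R -> R) := fun n => G n.+1.
pose D y := (c - y) * taylor_rem n (S G) c y - n.+1%:R * taylor_rem n.+1 G c y.
rewrite -subr_ge0 -/(D x).
have -> : 0 = D c by rewrite /D taylor_rem_id subrr mul0r mulr0 subrr.
pose dD y := (0 - 1) * taylor_rem n (S G) c y
  + (c - y) * (- taylor_rem n.-1 (S (S G)) c y)
  - n.+1%:R * (- taylor_rem n (S G) c y).
have SG : cm_tower (S G) by exact: cm_tower_shift.
apply: (@is_derive_nincr _ D dD _ _ xc) => y /andP[xy yc];
  have y0 := lt_le_trans x0 xy.
  apply: is_derive_subf.
    by apply: is_derive_mulf; exact: is_derive_taylor_rem.
  by apply: is_derive_scalef; exact: is_derive_taylor_rem.
have := IH _ _ SG y0 yc; rewrite -subr_ge0 -oppr_le0; apply: le_trans.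
by rewrite /dD -natr1 le_eqVlt; apply/orP; left; apply/eqP; rewrite /S; ring.
Qed.

Lemma taylor_rem_bound (n : nat) G (c x y : R) : cm_tower G ->
  0 < y -> y <= x -> x < c ->
  taylor_rem n G c x <= ((c - x) / (c - y)) ^+ n * taylor_rem n G c y.
Proof.
move=> GG y0 yx xc.
have cz z : z <= x -> 0 < c - z by move=> zx; rewrite subr_gt0 (le_lt_trans zx).
pose u z := (c - z)^-1 ^+ n.
have du z : z <= x -> is_derive z 1 u (n%:R * (c - z)^-1 ^+ n.+1).
  move=> zx.
  have h1 : is_derive z 1 (fun z : R => (c - z)) (0 - 1) by exact: is_derive_subf.
  have := is_derive_expf n (@is_deriveV _ _ z _ 1 (lt0r_neq0 (cz z zx)) h1).
  rewrite /u; congr is_derive.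
  rewrite /GRing.scale/= sub0r mulrN1 opprK; case: {u} n => [|n]/=.
    by rewrite !mul0r.
  by rewrite -exprVn !exprS; ring.
have := @is_derive_nincr _ (fun z => taylor_rem n G c z * u z)
  (fun z => - taylor_rem n.-1 (fun n => G n.+1) c z * u z
     + taylor_rem n G c z * (n%:R * (c - z)^-1 ^+ n.+1)) _ _ yx.
have H1 z : y <= z <= x -> is_derive z 1 (fun z => taylor_rem n G c z * u z)
  (- taylor_rem n.-1 (fun n => G n.+1) c z * u z
     + taylor_rem n G c z * (n%:R * (c - z)^-1 ^+ n.+1)).
  move=> /andP[yz zx].
  apply: is_derive_mulf; last exact: du.
  exact: is_derive_taylor_rem GG (lt_le_trans y0 yz).
move=> /(_ H1) H.
have : taylor_rem n G c x * u x <= taylor_rem n G c y * u y.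
  apply: H => z /andP[yz zx].
  have := taylor_rem_le n GG (lt_le_trans y0 yz) (ltW (le_lt_trans zx xc)).
  rewrite -subr_le0 => h.
  rewrite [leLHS](_ : _ = (n%:R * taylor_rem n G c z - (c - z) *
    taylor_rem n.-1 (fun n => G n.+1) c z) * (c - z)^-1 ^+ n.+1).
    by rewrite mulr_le0_ge0// exprn_ge0// invr_ge0 ltW// cz.
  rewrite /u exprS; field; rewrite gt_eqF ?cz//.
rewrite /u -ler_pdivlMr; last by rewrite exprn_gt0// invr_gt0 cz.
move=> /le_trans; apply; rewrite le_eqVlt; apply/orP; left; apply/eqP.
rewrite expr_div_n !exprVn; field.
by rewrite !expf_neq0// gt_eqF// cz.
Qed.

(** Comparison with y = x / 2: by [taylor_rem_bound] the remainder at x is at most q^n times the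
    value of level 0 at y, where q = (c - x) / (c - y) < 1. *)
Lemma cm_tower_taylor G (c x : R) : cm_tower G -> 0 < x -> x < c ->
  (fun n => \sum_(i < n) G i c * (c - x) ^+ i / i`!%:R) @ \oo --> G 0%N x.
Proof.
move=> GG x0 xc.
set y := x / 2.
have y0 : 0 < y by rewrite divr_gt0.
have yx : y < x by rewrite /y; lra.
have q1 : `|(c - x) / (c - y)| < 1.
  rewrite ger0_norm; last by rewrite divr_ge0//; lra.
  by rewrite ltr_pdivrMr; lra.
suff : (fun n => taylor_rem n G c x) @ \oo --> 0.
  move=> h; have {}h := cvgB (cvg_cst (G 0%N x)) h; rewrite subr0 in h.
  apply: cvg_trans; last exact: h.
  by apply: near_eq_cvg; near=> n; rewrite /= /taylor_rem opprB addrC subrK.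
have h0 := cvg_expr q1.
have h1 := cvgM h0 (cvg_cst (G 0%N y)); rewrite mul0r in h1.
apply: (@squeeze_cvgr _ _ _ _ (fun=> 0) (fun n => ((c - x) / (c - y)) ^+ n * G 0%N y)
  (fun n => taylor_rem n G c x)); [|exact: cvg_cst|exact: h1].
near=> n; rewrite taylor_rem_ge0 ?(ltW xc)//=.
apply: (le_trans (taylor_rem_bound n GG y0 (ltW yx) xc)).
rewrite ler_wpM2l ?exprn_ge0//; first by rewrite divr_ge0//; lra.
rewrite /taylor_rem gerBl sumr_ge0// => i _.
have [_ g] := GG i c (lt_trans x0 xc).
by rewrite mulr_ge0 ?invr_ge0// mulr_ge0// exprn_ge0//; lra.
Unshelve. all: by end_near. Qed.

(** Taylor terms of order 0 and 1 are dropped. A second derivative is thereby bounded by a value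
    further left, hence uniformly along a pointwise convergent sequence of towers. *)
Lemma cm_tower_second (G : nat -> R -> R) (c x : R) : cm_tower G -> 0 < x -> x <= c ->
  G 2 c * (c - x) ^+ 2 / 2 <= G 0%N x.
Proof.
move=> GG x0 xc.
have := taylor_rem_ge0 3 GG x0 xc; rewrite /taylor_rem subr_ge0; apply: le_trans.
have c0 := lt_le_trans x0 xc.
rewrite !big_ord_recl big_ord0/= addr0 addrA lerDr.
have [_ g0] := GG 0%N c c0; have [_ g1] := GG 1%N c c0.
rewrite addr_ge0// /bump/= ?divr1 ?expr0 ?expr1 ?mulr1//.
by rewrite !mulr_ge0 ?subr_ge0 ?invr_ge0.
Qed.

End cm_tower.

(** * Pointwise limits of completely monotone functions *)

Section cm_limit.
Context {R : realType}.
Variables (G : nat -> nat -> R -> R) (g : R -> R).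
Hypothesis GG : forall m, cm_tower (G m).
Hypothesis Gg : forall x : R, 0 < x -> (fun m => G m 0%N x) @ \oo --> g x.

Let quot m (x h : R) := (G m 0%N (x + h) - G m 0%N x) / h.

Let quot_bound (x : R) : 0 < x -> exists M : R, forall m (h : R), h != 0 ->
  `|h| < x / 2 -> `|quot m x h - - G m 1%N x| <= M * `|h|.
Proof.
move=> x0.
have /cvg_seq_bounded[B [_ /(_ (B + 1))]] : cvgn (fun m => G m 0%N (x / 4)).
  by apply/cvg_ex; exists (g (x / 4)); apply: Gg; rewrite divr_gt0.
rewrite ltrDl ltr01 => /(_ erefl) Bm.
(* [cm_tower_second] at x / 4 <= x / 2 bounds level 2 at x / 2 by 2 (B + 1) / (x / 4)^2, whence the
   32; level 2 is nonincreasing, so the bound holds on all of [x / 2, oo). *)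
exists ((B + 1) * 32 / x ^+ 2) => m h h0 hx.
have G2 z : x / 2 <= z -> G m 2 z <= (B + 1) * 32 / x ^+ 2.
  move=> xz.
  have x2 : 0 < x / 2 by lra.
  apply: (le_trans (cm_tower_nincr 2 (GG m) x2 xz)).
  have x4 : 0 < x / 4 by lra.
  have x42 : x / 4 <= x / 2 by lra.
  have := cm_tower_second (GG m) x4 x42.
  have := Bm m I => /(le_trans (ler_norm _)) b1 b2.
  have := le_trans b2 b1.
  rewrite [leLHS](_ : _ = G m 2 (x / 2) * x ^+ 2 / 32); last by field.
  rewrite ler_pdivrMr// => b3.
  by rewrite ler_pdivlMr// exprn_gt0.
have dG n z : x / 2 <= z -> is_derive z 1 (G m n) (- G m n.+1 z).
  by move=> xz; have [] := GG m n (lt_le_trans _ xz); [rewrite divr_gt0|].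
have lip z : `|z - x| <= `|h| -> `|G m 1%N z - G m 1%N x| <= (B + 1) * 32 / x ^+ 2 * `|h|.
  move=> zx.
  have [a [b [ab xa [e1 e2]]]] : exists a b : R, [/\ a <= b, x / 2 <= a &
      `|G m 1%N z - G m 1%N x| = `|G m 1%N b - G m 1%N a| /\ `|b - a| = `|z - x|].
    have [zx'|xz'] := leP z x.
      exists z, x; split=> //; first by move: zx hx; rewrite distrC ger0_norm; lra.
      by rewrite distrC (distrC z).
    by exists x, z; split=> //; [exact: ltW|lra].
  have [c /andP[ac cb] ec] := is_derive_mvt ab (fun z (zab : a <= z <= b) =>
    dG 1%N z (le_trans xa (proj1 (andP zab)))).
  rewrite e1 ec normrM normrN e2 ler_pM//.
  rewrite ger0_norm; first by apply: G2; exact: le_trans ac.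
  by have [] := GG m 2 (lt_le_trans _ (le_trans xa ac)); first rewrite divr_gt0.
have [c cx ec] : exists2 c : R, `|c - x| <= `|h| & quot m x h = - G m 1%N c.
  have [h0'|h0'] := leP 0 h.
    have hp : 0 < h by rewrite lt_def h0.
    have xh : x <= x + h by lra.
    have [c /andP[xc ch] ec] := is_derive_mvt xh (fun z (zab : x <= z <= x + h) =>
      dG 0%N z ltac:(move: zab => /andP[]; lra)).
    exists c; last by rewrite /quot ec addrC addKr mulfK.
    by rewrite !ger0_norm; lra.
  have xh : x + h <= x by lra.
  have [c /andP[xc ch] ec] := is_derive_mvt xh (fun z (zab : x + h <= z <= x) =>
    dG 0%N z ltac:(move: zab hx => /andP[]; rewrite ltr0_norm//; lra)).
  exists c; last first.
    by rewrite /quot -opprB ec opprD addrA subrr sub0r mulrN opprK mulfK.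
  by rewrite !ler0_norm; lra.
by rewrite ec -opprD normrN; exact: lip.
Qed.

(** The error M |h| of the difference quotients does not depend on m. A fixed small h therefore
    shows that the derivatives are Cauchy in m, and then m can tend to infinity in the error
    bound. *)
Lemma cm_limit_step (x : R) : 0 < x ->
  cvgn (fun m => G m 1%N x) /\ is_derive x 1 g (- limn (fun m => G m 1%N x)).
Proof.
move=> x0; have [M HM] := quot_bound x0.
have quot_cvg h : `|h| < x / 2 -> quot m x h @[m --> \oo] --> (g (x + h) - g x) / h.
  move=> hx; apply: cvgMl; apply: cvgB; last exact: Gg.
  by apply: Gg; move: hx; rewrite ltr_norml; lra.
have cv : cvgn (fun m => G m 1%N x).
  apply: cauchy_cvg; apply: cauchy_exP => e e0.
  have Mp : 0 < `|M| + 1 by rewrite ltr_wpDl.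
  pose h := Num.min (x / 4) (e / (4 * (`|M| + 1))).
  have h0 : 0 < h by rewrite lt_min !divr_gt0// mulr_gt0.
  have hx : `|h| < x / 2.
    rewrite gtr0_norm//; apply: (@le_lt_trans _ _ (x / 4)); last by lra.
    by rewrite ge_min lexx.
  have hM : M * `|h| <= e / 4.
    rewrite gtr0_norm// (@le_trans _ _ ((`|M| + 1) * h))//.
      by rewrite ler_wpM2r ?ltW// (le_lt_trans (ler_norm M))// ltrDl.
    rewrite (@le_trans _ _ ((`|M| + 1) * (e / (4 * (`|M| + 1)))))//.
      by rewrite ler_wpM2l ?(ltW Mp)// ge_min lexx orbT.
    by rewrite le_eqVlt; apply/orP; left; apply/eqP; field; rewrite gt_eqF.
  exists (- ((g (x + h) - g x) / h)).
  have e4 : 0 < e / 4 by rewrite divr_gt0.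
  have /cvgrPdist_le/(_ _ e4) qn := quot_cvg h hx.
  suff : \forall m \near \oo, `|- ((g (x + h) - g x) / h) - G m 1%N x| < e by [].
  near=> m; have qm : `|(g (x + h) - g x) / h - quot m x h| <= e / 4 by near: m.
  have := HM m h (lt0r_neq0 h0) hx; rewrite opprK => b2.
  rewrite -normrN opprB opprK -(subrK (quot m x h) ((g (x + h) - g x) / h)).
  rewrite addrC -addrA (le_lt_trans (ler_normD _ _))//.
  lra.
split=> //; apply: (@is_derive_lipschitz_quotient _ _ _ _ M (x / 2)).
  by rewrite divr_gt0.
move=> h h0 hx.
have c1 : `|quot m x h - - G m 1%N x| @[m --> \oo] -->
    `|(g (x + h) - g x) / h - - limn (fun m => G m 1%N x)|.
  by apply: cvg_norm; apply: cvgB; [exact: quot_cvg|exact: cvgN].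
apply: (ler_cvg_to c1 (cvg_cst (M * `|h|))).
by near=> m; exact: HM.
Unshelve. all: by end_near. Qed.

End cm_limit.

(** Only level 0 is assumed to converge; [cm_limit_step], applied to the towers from level n on,
    gives the limit of level n + 1 as minus the derivative of the limit of level n. *)
Lemma cm_tower_lim (R : realType) (G : nat -> nat -> R -> R) (g : R -> R) :
  (forall m, cm_tower (G m)) ->
  (forall x : R, 0 < x -> (fun m => G m 0%N x) @ \oo --> g x) ->
  completely_monotone g.
Proof.
move=> GG Gg.
pose H n (x : R) := limn (fun m => G m n x).
have GH n (x : R) : 0 < x -> (fun m => G m n x) @ \oo --> H n x.
  elim: n x => [|n IH] x x0; first by apply/cvg_ex; exists (g x); exact: Gg.
  have Gs m : cm_tower (fun k => G m (n + k)%N).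
    by move=> k y y0; rewrite addnS; exact: GG.
  have IH' y : 0 < y -> (fun m => G m (n + 0)%N y) @ \oo --> H n y.
    by rewrite addn0; exact: IH.
  by have [] := cm_limit_step Gs IH' x0; rewrite addn1.
apply: (@tower_completely_monotone _ H); last first.
  by move=> x x0; apply/cvg_lim => //; exact: Gg.
move=> n x x0; split; last first.
  apply: (limr_ge (GH n x x0)); near=> m.
  by have [] := GG m n x x0.
have Gs m : cm_tower (fun k => G m (n + k)%N).
  by move=> k y y0; rewrite addnS; exact: GG.
have IH' y : 0 < y -> (fun m => G m (n + 0)%N y) @ \oo --> H n y.
  by rewrite addn0; exact: GH.
by have [_] := cm_limit_step Gs IH' x0; rewrite addn1.
Unshelve. all: by end_near. Qed.

Lemma cvg_ext (R : realType) (u v : nat -> R) (l : R) :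
  (forall n, v n = u n) -> u @ \oo --> l -> v @ \oo --> l.
Proof. by move=> uv ul; have -> : v = u by apply/funext. Qed.

(** * Exponential generating functions *)

Section egf.
Context {R : realType}.
Implicit Types (a b g h : nat -> R) (x y : R).

(** Growth condition under which the series of h k x^k / k! converges for every x; it is stable
    under shifts, products and binomial convolution. *)
Definition geom_bounded h := exists C M : R,
  [/\ 0 <= C, 0 <= M & forall k, `|h k| <= C * M ^+ k].

Lemma geom_bounded_le g h (C : R) : geom_bounded h ->
  (forall k, `|g k| <= C * `|h k|) -> geom_bounded g.
Proof.
move=> [A [M [A0 M0 hA]]] gh.
exists (`|C| * A), M; split=> // [|k]; first by rewrite mulr_ge0.
apply: (le_trans (gh k)); rewrite -mulrA.
apply: (@le_trans _ _ (`|C| * `|h k|)); first by rewrite ler_wpM2r// ler_norm.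
by rewrite ler_wpM2l.
Qed.

Lemma geom_bounded_shift h : geom_bounded h -> geom_bounded (fun k => h k.+1).
Proof.
move=> [A [M [A0 M0 hA]]]; exists (A * M), M; split=> // [|k].
  by rewrite mulr_ge0.
by rewrite -mulrA -exprS.
Qed.

Lemma geom_boundedD g h : geom_bounded g -> geom_bounded h ->
  geom_bounded (fun k => g k + h k).
Proof.
move=> [A [M [A0 M0 gA]]] [B [N [B0 N0 hB]]].
exists (A + B), (Num.max M N); split=> // [||k]; first by rewrite addr_ge0.
  by rewrite le_max M0.
apply: (le_trans (ler_normD _ _)); rewrite mulrDl lerD//.
  by apply: (le_trans (gA k)); rewrite ler_wpM2l// lerXn2r ?nnegrE ?le_max ?lexx ?M0.
by apply: (le_trans (hB k)); rewrite ler_wpM2l// lerXn2r ?nnegrE ?le_max ?lexx ?M0 ?orbT.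
Qed.

Lemma geom_boundedM g h : geom_bounded g -> geom_bounded h ->
  geom_bounded (fun k => g k * h k).
Proof.
move=> [A [M [A0 M0 gA]]] [B [N [B0 N0 hB]]].
exists (A * B), (M * N); split=> // [||k]; rewrite ?mulr_ge0//.
rewrite normrM exprMn mulrACA ler_pM//.
Qed.

Lemma geom_bounded_pow (c : R) : geom_bounded (fun k => c ^+ k).
Proof. by exists 1, `|c|; split=> // k; rewrite normrX mul1r. Qed.

Lemma geom_bounded_cst (c : R) : geom_bounded (fun k => c).
Proof. by exists `|c|, 1; split=> // k; rewrite expr1n mulr1. Qed.

Lemma geom_bounded_nat : geom_bounded (fun k => k%:R).
Proof.
exists 1, 2; split=> // k; rewrite mul1r ger0_norm// -natrX ler_nat.
exact: ltnW (ltn_expl _ _).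
Qed.

Lemma geom_bounded_pred h : geom_bounded h ->
  geom_bounded (fun k => k%:R * h k.-1).
Proof.
move=> [A [M [A0 M0 hA]]]; apply: geom_boundedM; first exact: geom_bounded_nat.
(* The base 1 + M is at least 1, so passing from exponent k - 1 to k only increases the bound. *)
exists A, (1 + M); split=> // [|k]; first by rewrite addr_ge0.
apply: (le_trans (hA _)); rewrite ler_wpM2l//.
have M1 : 1 <= 1 + M by rewrite lerDl.
apply: (@le_trans _ _ ((1 + M) ^+ k.-1)).
  by rewrite lerXn2r ?nnegrE ?lerDr ?addr_ge0.
by apply: ler_weXn2l => //; exact: leq_pred.
Qed.

Definition egf_term h x (k : nat) := h k * x ^+ k / k`!%:R.
(** With k! divided out, differentiation is a shift of h, multiplication by x sends h to
    [k%:R * h k.-1], and products are binomial convolutions. Identities between functions become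
    identities between coefficients. *)
Definition egf h x : R := limn (series (egf_term h x)).

Lemma egf_termE h x : egf_term h x = (fun k => h k / k`!%:R * x ^+ k).
Proof. by apply/funext => k; rewrite /egf_term mulrAC. Qed.

Lemma egf_term_exp x : egf_term (fun=> 1) x = exp_coeff x.
Proof. by apply/funext => k; rewrite /egf_term mul1r. Qed.

Lemma egf_exp x : egf (fun=> 1) x = expR x.
Proof. by rewrite /egf egf_term_exp. Qed.

Lemma is_cvg_egf_norm h x : geom_bounded h -> cvgn [normed series (egf_term h x)].
Proof.
move=> [A [M [A0 M0 hA]]].
apply: (@series_le_cvg _ _ (fun k => A * exp_coeff (M * `|x|) k)) => [k|k|k|].
- exact: normr_ge0.
- by rewrite mulr_ge0// divr_ge0// exprn_ge0// mulr_ge0.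
- rewrite /egf_term /exp_coeff/= !normrM normfV normrX [`|k`!%:R|]ger0_norm//.
  by rewrite exprMn mulrA ler_wpM2r// mulrA ler_wpM2r.
- exact: is_cvg_seriesZ (is_cvg_series_exp_coeff _).
Qed.

Lemma egf_cvg h x : geom_bounded h -> series (egf_term h x) @ \oo --> egf h x.
Proof. by move=> /(@is_cvg_egf_norm _ x)/normed_cvg. Qed.

Lemma is_derive_egf h x : geom_bounded h ->
  is_derive x 1 (egf h) (egf (fun k => h k.+1) x).
Proof.
move=> hb.
have E g y : egf g y = limn (pseries (fun k => g k / k`!%:R) y).
  by rewrite /egf egf_termE.
have D g : pseries_diffs (fun k => g k / k`!%:R) = (fun k => g k.+1 / k`!%:R).
  apply/funext => k; rewrite /pseries_diffs factS natrM; field.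
  by rewrite nat1r !pnatr_eq0 -lt0n fact_gt0.
have cv g y : geom_bounded g -> cvgn (pseries (fun k => g k / k`!%:R) y).
  by move=> gb; have /cvgP := @egf_cvg g y gb; rewrite egf_termE.
have -> : egf h = fun y => limn (pseries (fun k => h k / k`!%:R) y).
  by apply/funext => y; rewrite E.
rewrite E -D.
apply: (@pseries_snd_diffs _ _ (`|x| + 1)).
- exact: cv.
- by rewrite D; apply: cv; exact: geom_bounded_shift.
- by rewrite 2!D; apply: cv; exact: (geom_bounded_shift (geom_bounded_shift hb)).
- by rewrite [ltRHS]ger0_norm ?addr_ge0// ltrDl.
Qed.

Lemma egf_continuous h x : geom_bounded h -> {for x, continuous (egf h)}.
Proof. by move=> hb; apply: is_derive_continuous; exact: is_derive_egf. Qed.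

Lemma egfD g h x : geom_bounded g -> geom_bounded h ->
  egf (fun k => g k + h k) x = egf g x + egf h x.
Proof.
move=> gb hb; apply/cvg_lim => //.
have lim : series (egf_term g x) n + series (egf_term h x) n @[n --> \oo] --> egf g x + egf h x.
  by apply: cvgD; exact: egf_cvg.
 apply: (@cvg_ext _ _ _ _ _ lim) => n.
rewrite /series/= -big_split; apply: eq_bigr => i _ /=.
by rewrite /egf_term; ring.
Qed.

Lemma egfZ (c : R) h x : geom_bounded h ->
  egf (fun k => c * h k) x = c * egf h x.
Proof.
move=> hb; apply/cvg_lim => //.
have lim : c * series (egf_term h x) n @[n --> \oo] --> c * egf h x.
  by apply: cvgM; [exact: cvg_cst|exact: egf_cvg].
 apply: (@cvg_ext _ _ _ _ _ lim) => n.
rewrite /series/= mulr_sumr; apply: eq_bigr => i _ /=.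
by rewrite /egf_term; ring.
Qed.

Lemma egfB g h x : geom_bounded g -> geom_bounded h ->
  egf (fun k => g k - h k) x = egf g x - egf h x.
Proof.
move=> gb hb; have hb' : geom_bounded (fun k => -1 * h k).
  exact: geom_boundedM (geom_bounded_cst _) hb.
rewrite -[RHS]addr0 -[in RHS](mulN1r (egf h x)) -egfZ// addr0 -egfD//.
by congr (egf _ x); apply/funext => k; rewrite mulN1r.
Qed.

Lemma egf_scale (c : R) h x : egf h (c * x) = egf (fun k => c ^+ k * h k) x.
Proof.
rewrite /egf; congr (limn (series _)); apply/funext => k.
by rewrite /egf_term exprMn; ring.
Qed.

Lemma egf_mulX h x : geom_bounded h ->
  egf (fun k => k%:R * h k.-1) x = x * egf h x.
Proof.
move=> hb; apply/cvg_lim => //.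
rewrite -cvg_shiftS.
have lim : x * series (egf_term h x) n @[n --> \oo] --> x * egf h x.
  by apply: cvgM; [exact: cvg_cst|exact: egf_cvg].
 apply: (@cvg_ext _ _ _ _ _ lim) => n.
rewrite /series/= big_nat_recl//= /egf_term mul0r !mul0r add0r mulr_sumr.
apply: eq_bigr => i _; rewrite factS natrM exprS; field.
by rewrite nat1r !pnatr_eq0 -lt0n fact_gt0.
Qed.

Lemma egf_ge_first h x (n : nat) : geom_bounded h -> 0 <= x -> (forall k, 0 <= h k) ->
  series (egf_term h x) n <= egf h x.
Proof.
move=> hb x0 h0; apply: nondecreasing_cvgn_le; last first.
  by apply/cvg_ex; exists (egf h x); exact: egf_cvg.
by apply/nondecreasing_seqP => m; rewrite seriesSr lerDl /egf_term
  divr_ge0// mulr_ge0// exprn_ge0.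
Qed.

Lemma egf_ge0 h x : geom_bounded h -> 0 <= x -> (forall k, 0 <= h k) ->
  0 <= egf h x.
Proof.
by move=> hb x0 h0; have := egf_ge_first 0 hb x0 h0; rewrite /series/= big_geq.
Qed.

Lemma egf_gt0 h x : geom_bounded h -> 0 <= x -> (forall k, 0 <= h k) ->
  0 < h 0%N -> 0 < egf h x.
Proof.
move=> hb x0 h0 h00; apply: lt_le_trans (egf_ge_first 1 hb x0 h0).
by rewrite /series/= big_nat1 /egf_term expr0 mulr1 divr1.
Qed.

Lemma egf_le g h x : geom_bounded g -> geom_bounded h -> 0 <= x ->
  (forall k, g k <= h k) -> egf g x <= egf h x.
Proof.
move=> gb hb x0 gh; rewrite -subr_ge0 -egfB// egf_ge0//.
  apply: geom_boundedD => //.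
  by apply: (geom_bounded_le (C := 1) gb) => k; rewrite normrN mul1r.
by move=> k; rewrite subr_ge0.
Qed.

Lemma egf0 h : egf h 0 = h 0%N.
Proof.
apply/cvg_lim => //; rewrite -cvg_shiftS.
apply: cvg_near_cst; near=> n.
rewrite /series/= big_nat_recl//= big1 ?addr0.
  by rewrite /egf_term expr0 mulr1 divr1.
by move=> i _; rewrite /egf_term expr0n/= mulr0 mul0r.
Unshelve. all: by end_near. Qed.

Definition binomial_conv a b (k : nat) :=
  \sum_(i < k.+1) 'C(k, i)%:R * (a i * b (k - i)%N).

Lemma triangle_sum (f : nat -> nat -> R) n :
  \sum_(k < n) \sum_(i < k.+1) f i (k - i)%N = \sum_(i < n) \sum_(j < n - i) f i j.
Proof.
elim: n => [|n IH]; first by rewrite !big_ord0.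
rewrite big_ord_recr/= IH [RHS]big_ord_recr/= subSnn big_ord1.
rewrite big_ord_recr/= subnn addrA -big_split/=; congr (_ + _).
apply: eq_bigr => i _; rewrite subSn ?big_ord_recr//=.
exact: ltnW.
Qed.

(** The difference is the sum over the pairs in the square with i + j >= n, so termwise bounds pass
    to it. *)
Lemma square_minus_triangle (f F : nat -> nat -> R) n :
  (forall i j, `|f i j| <= F i j) ->
  `|\sum_(i < n) \sum_(j < n) f i j - \sum_(i < n) \sum_(j < n - i) f i j| <=
  \sum_(i < n) \sum_(j < n) F i j - \sum_(i < n) \sum_(j < n - i) F i j.
Proof.
move=> fF.
have E (u : nat -> nat -> R) : \sum_(i < n) \sum_(j < n) u i j -
    \sum_(i < n) \sum_(j < n - i) u i j = \sum_(i < n) \sum_(n - i <= j < n) u i j.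
  rewrite -sumrB; apply: eq_bigr => i _.
  rewrite -(big_mkord xpredT (u i)) -(big_mkord xpredT (u i)).
  by rewrite (@big_cat_nat _ _ _ (n - i) 0 n)//= ?leq_subr// addrAC subrr add0r.
rewrite !E; apply: (le_trans (ler_norm_sum _ _ _)); apply: ler_sum => i _.
by apply: (le_trans (ler_norm_sum _ _ _)); apply: ler_sum.
Qed.

Lemma series_binomial_conv a b x n : series (egf_term (binomial_conv a b) x) n =
  \sum_(i < n) \sum_(j < n - i) egf_term a x i * egf_term b x j.
Proof.
rewrite -(triangle_sum (fun i j => egf_term a x i * egf_term b x j)).
rewrite /series/= big_mkord; apply: eq_bigr => k _.
rewrite /egf_term /binomial_conv !mulr_suml; apply: eq_bigr => i _.
have ik : (i <= k)%N by rewrite -ltnS.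
have -> : x ^+ k = x ^+ i * x ^+ (k - i) by rewrite -exprD subnKC.
rewrite -(bin_fact ik) !natrM; field.
by rewrite !pnatr_eq0 -!lt0n !fact_gt0 bin_gt0.
Qed.

Lemma geom_bounded_conv a b : geom_bounded a -> geom_bounded b ->
  geom_bounded (binomial_conv a b).
Proof.
move=> [A [M [A0 M0 aA]]] [B [N [B0 N0 bB]]].
exists (A * B), (N + M); split=> //; rewrite ?mulr_ge0 ?addr_ge0// => k.
rewrite exprDn mulr_sumr (le_trans (ler_norm_sum _ _ _))//.
apply: ler_sum => i _; rewrite normrM [`|'C(_, _)%:R|]ger0_norm// mulrnAr -[leRHS]mulr_natl.
rewrite ler_wpM2l// normrM.
rewrite [leRHS](_ : _ = (A * M ^+ i) * (B * N ^+ (k - i)))//; last by ring.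
exact: ler_pM.
Qed.

(* The error is dominated by the same error for two exponential series, where
   it tends to 0 by the addition formula of exp. *)
Lemma egf_mul a b x : geom_bounded a -> geom_bounded b ->
  egf a x * egf b x = egf (binomial_conv a b) x.
Proof.
move=> ab bb.
have [A [M [A0 M0 aA]]] := ab; have [B [N [B0 N0 bB]]] := bb.
pose L := Num.max M N; pose y := L * `|x|.
have L0 : 0 <= L by rewrite le_max M0.
pose e := series (exp_coeff y).
pose e2 := series (exp_coeff (y + y)).
have tE n : e2 n = \sum_(i < n) \sum_(j < n - i) exp_coeff y i * exp_coeff y j.
  rewrite -egf_term_exp -series_binomial_conv /e2; congr (series _ n).
  apply/funext => k; rewrite /exp_coeff /egf_term /binomial_conv/= exprDn.
  rewrite !mulr_suml; apply: eq_bigr => i _.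
  by rewrite -exprD subnK ?mulr1 ?mulr_natl// -ltnS.
have aL k : `|egf_term a x k| <= A * exp_coeff y k.
  rewrite /egf_term /exp_coeff/= !normrM normfV normrX [`|k`!%:R|]ger0_norm//.
  rewrite mulrA ler_wpM2r// /y exprMn mulrA ler_wpM2r ?exprn_ge0//.
  apply: (le_trans (aA k)); rewrite ler_wpM2l// lerXn2r ?nnegrE//.
  by rewrite le_max lexx.
have bL k : `|egf_term b x k| <= B * exp_coeff y k.
  rewrite /egf_term /exp_coeff/= !normrM normfV normrX [`|k`!%:R|]ger0_norm//.
  rewrite mulrA ler_wpM2r// /y exprMn mulrA ler_wpM2r ?exprn_ge0//.
  apply: (le_trans (bB k)); rewrite ler_wpM2l// lerXn2r ?nnegrE//.
  by rewrite le_max lexx orbT.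
have sqE (u v : nat -> R) n : series u n * series v n =
    \sum_(i < n) \sum_(j < n) u i * v j.
  rewrite /series/= !big_mkord mulr_suml; apply: eq_bigr => i _.
  by rewrite mulr_sumr.
have bound n : `|series (egf_term a x) n * series (egf_term b x) n -
    series (egf_term (binomial_conv a b) x) n| <= A * B * (e n * e n - e2 n).
  rewrite sqE series_binomial_conv.
  apply: (le_trans (@square_minus_triangle
    (fun i j => egf_term a x i * egf_term b x j)
     (fun i j => A * B * (exp_coeff y i * exp_coeff y j)) n _)).
    by move=> i j; rewrite normrM mulrACA ler_pM.
  rewrite mulrBr /e sqE tE !mulr_sumr le_eqVlt; apply/orP; left; apply/eqP.
  by congr (_ - _); apply: eq_bigr => i _; rewrite mulr_sumr.
have c0 : A * B * (e n * e n - e2 n) @[n --> \oo] --> 0.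
  have ce : e @ \oo --> expR y by exact: is_cvg_series_exp_coeff.
  have ce2 : e2 @ \oo --> expR (y + y) by exact: is_cvg_series_exp_coeff.
  have lim := cvgM (cvg_cst (A * B)) (cvgB (cvgM ce ce) ce2).
  by rewrite expRD subrr mulr0 in lim; exact: lim.
have c1 : series (egf_term a x) n * series (egf_term b x) n -
    series (egf_term (binomial_conv a b) x) n @[n --> \oo] --> 0.
  apply/norm_cvg0P.
  apply: (@squeeze_cvgr _ _ _ _ (fun=> 0) (fun n => A * B * (e n * e n - e2 n)));
    [|exact: cvg_cst|exact: c0].
  by near=> n; rewrite bound normr_ge0.
have c2 : series (egf_term a x) n * series (egf_term b x) n -
    series (egf_term (binomial_conv a b) x) n @[n --> \oo] -->
    egf a x * egf b x - egf (binomial_conv a b) x.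
  apply: cvgB; last by apply: egf_cvg; exact: geom_bounded_conv.
  by apply: cvgM; exact: egf_cvg.
have le := cvg_lim (@Rhausdorff R) c2; rewrite (cvg_lim (@Rhausdorff R) c1) in le.
by apply/eqP; rewrite -subr_eq0 -le.
Unshelve. all: by end_near. Qed.

End egf.

(** * Integrals of nonnegative functions over the half-line *)

Section posint.
Context {R : realType}.
Notation mu := (@lebesgue_measure R).
Notation pos := (`]0%R, +oo[%classic : set R).
Implicit Types (f g F : R -> R).

(** Extended-real values make additivity and monotonicity available before finiteness is known; the
    real integrals in [Gamma] and [T] are its [fine] part. *)
Definition posint f : \bar R := (\int[mu]_(t in pos) (f t)%:E)%E.

Lemma measurable_pos : measurable pos.
Proof. exact: measurable_itv. Qed.

Lemma posP (t : R) : pos t = (0 < t) :> Prop.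
Proof. by rewrite /= in_itv/= andbT. Qed.

Lemma continuous_pos_measurable f :
  (forall x : R, 0 < x -> {for x, continuous f}) -> measurable_fun pos f.
Proof.
move=> fc; apply: open_continuous_measurable_fun; first exact: interval_open.
by move=> x; rewrite inE posP; exact: fc.
Qed.

Lemma posint_ge0 f : (forall t : R, 0 < t -> 0 <= f t) -> (0 <= posint f)%E.
Proof.
by move=> f0; apply: integral_ge0 => t; rewrite posP lee_fin; exact: f0.
Qed.

Lemma eq_posint f g : (forall t : R, 0 < t -> f t = g t) -> posint f = posint g.
Proof.
move=> fg; apply: eq_integral => t; rewrite inE posP => t0.
by rewrite fg.
Qed.

Lemma posintD f g : measurable_fun pos f -> measurable_fun pos g ->
  (forall t : R, 0 < t -> 0 <= f t) -> (forall t : R, 0 < t -> 0 <= g t) ->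
  posint (fun t => f t + g t) = (posint f + posint g)%E.
Proof.
move=> mf mg f0 g0; rewrite /posint; under eq_integral do rewrite EFinD.
apply: ge0_integralD; first exact: measurable_pos.
- by move=> t; rewrite posP lee_fin; exact: f0.
- exact/measurable_EFinP.
- by move=> t; rewrite posP lee_fin; exact: g0.
- exact/measurable_EFinP.
Qed.

Lemma posintZ (c : R) f : measurable_fun pos f ->
  (forall t : R, 0 < t -> 0 <= f t) -> 0 <= c ->
  posint (fun t => c * f t) = (c%:E * posint f)%E.
Proof.
move=> mf f0 c0; rewrite /posint; under eq_integral do rewrite EFinM.
apply: ge0_integralZl_EFin => //.
- by move=> t; rewrite posP lee_fin; exact: f0.
- exact/measurable_EFinP.
Qed.

Lemma le_posint f g : measurable_fun pos f -> measurable_fun pos g ->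
  (forall t : R, 0 < t -> 0 <= f t) -> (forall t : R, 0 < t -> f t <= g t) ->
  (posint f <= posint g)%E.
Proof.
move=> mf mg f0 fg; apply: ge0_le_integral => //.
- by move=> t; rewrite posP lee_fin; exact: f0.
- exact/measurable_EFinP.
- exact/measurable_EFinP.
- by move=> t; rewrite posP lee_fin; exact: fg.
Qed.

Let seg n : set R := `[n.+1%:R^-1, n.+1%:R].

Lemma bigcup_segments : \bigcup_n seg n = pos.
Proof.
apply/seteqP; split=> [x [n _]|x]; rewrite posP.
  by rewrite /seg/= in_itv/= => /andP[+ _]; apply: lt_le_trans; rewrite invr_gt0.
move=> x0.
have [n xn] : exists n : nat, x <= n%:R /\ x^-1 <= n%:R.
  exists (maxn (Num.bound x) (Num.bound x^-1)); split.
    apply: (le_trans (ltW (archi_boundP (ltW x0)))).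
    by rewrite ler_nat leq_maxl.
  apply: (@le_trans _ _ (Num.bound x^-1)%:R).
    by apply/ltW/archi_boundP; rewrite invr_ge0 ltW.
  by rewrite ler_nat leq_maxr.
exists n => //; rewrite /seg/= in_itv/=; apply/andP; split.
  rewrite -[leRHS]invrK lef_pV2 ?posrE ?invr_gt0//.
  by apply: (le_trans xn.2); rewrite ler_nat.
by apply: (le_trans xn.1); rewrite ler_nat.
Qed.

Lemma nondecreasing_segments : {homo seg : n m / (n <= m)%N >-> (n <= m)%O}.
Proof.
move=> n m nm; apply/subsetPset => x; rewrite /seg/= !in_itv/= => /andP[a b].
apply/andP; split.
  by apply: le_trans a; rewrite lef_pV2 ?posrE// ler_nat ltnS.
by apply: (le_trans b); rewrite ler_nat ltnS.
Qed.

(** The endpoints are arbitrary because the change of variables needs the images of the standard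
    segments as well. *)
Lemma posint_exhaust (a b : nat -> R) f :
  let S n := `[a n, b n]%classic in
  {homo S : n m / (n <= m)%N >-> (n <= m)%O} -> \bigcup_n S n = pos ->
  measurable_fun pos f -> (forall t : R, 0 < t -> 0 <= f t) ->
  (\int[mu]_(t in S n) (f t)%:E)%E @[n --> \oo] --> posint f.
Proof.
move=> S Snd SU mf f0; rewrite /posint -SU.
have Spos n : S n `<=` pos by rewrite -SU; exact: bigcup_sup.
apply: ge0_nondecreasing_set_cvg_integral => //.
- by move=> i; exact: measurable_itv.
- move=> i; apply/measurable_EFinP.
  by apply: measurable_funS mf => //; exact: Spos.
- by move=> i t /Spos; rewrite posP lee_fin; exact: f0.
Qed.

Lemma posint_FTC F f (A B : R) :
  (forall x : R, 0 < x -> is_derive x 1 F (f x)) ->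
  (forall x : R, 0 < x -> {for x, continuous f}) ->
  (forall x : R, 0 < x -> 0 <= f x) ->
  (fun n : nat => F n.+1%:R^-1) @ \oo --> A ->
  (fun n : nat => F n.+1%:R) @ \oo --> B ->
  posint f = (B - A)%:E.
Proof.
move=> dF cf f0 FA FB.
have := posint_exhaust nondecreasing_segments bigcup_segments
  (continuous_pos_measurable cf) f0.
(* The index is shifted because the segment for n = 0 is the single point 1, while the fundamental
   theorem is applied on a nondegenerate one. *)
rewrite -cvg_shiftS => h.
apply: cvg_unique h _ => //.
have lim : (F n.+2%:R - F n.+2%:R^-1)%:E @[n --> \oo] --> (B - A)%:E.
  apply: cvg_EFin; first by near=> n.
  by apply: cvgB; [have := FB|have := FA]; rewrite -cvg_shiftS.
apply: cvg_trans lim; apply: near_eq_cvg; near=> n.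
rewrite EFinB; apply: esym.
have n2 : n.+2%:R^-1 < n.+2%:R :> R.
  apply: (@lt_trans _ _ 1); last by rewrite ltr1n.
  by rewrite invf_lt1// ltr1n.
have n0 (x : R) : n.+2%:R^-1 <= x -> 0 < x by apply: lt_le_trans; rewrite invr_gt0.
have Fc (x : R) : n.+2%:R^-1 <= x -> {for x, continuous F}.
  by move=> nx; apply: is_derive_continuous; apply: dF; exact: n0.
apply: continuous_FTC2 => //.
- apply: continuous_in_subspaceT => x; rewrite inE/= in_itv/= => /andP[nx _].
  by apply: cf; exact: n0.
- split.
  + move=> x; rewrite in_itv/= => /andP[nx _].
    by have [] := dF x (n0 x (ltW nx)).
  + by apply: cvg_at_right_filter; exact: Fc.
  + by apply: cvg_at_left_filter; apply: Fc; exact: ltW.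
- move=> x; rewrite in_itv/= => /andP[nx _]; rewrite derive1E.
  by have Fd := dF x (n0 x (ltW nx)); rewrite derive_val.
Unshelve. all: by end_near. Qed.

Lemma cvg_invS : (n.+1%:R^-1 : R) @[n --> \oo] --> 0.
Proof. exact: cvg_harmonic. Qed.

Lemma posint_square (t : R) f : 0 < t ->
  (forall x : R, 0 < x -> {for x, continuous f}) ->
  (forall x : R, 0 < x -> 0 <= f x) ->
  posint (fun r => f (t * r ^+ 2) * (2 * t * r)) = posint f.
Proof.
move=> t0 cf f0.
pose P (r : R) := t * r ^+ 2.
have dP (r : R) : is_derive r 1 P (2 * t * r).
  have := is_derive_scalef t (is_derive_expf 2 (is_derive_id r 1)).
  by rewrite /= expr1 mulr1 mulrCA mulrA.
have cP (r : R) : {for r, continuous P} by apply: is_derive_continuous; exact: dP.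
have Pgt0 (r : R) : 0 < r -> 0 < P r by move=> r0; rewrite mulr_gt0// exprn_gt0.
have Plt (x y : R) : 0 < x -> x < y -> P x < P y.
  by move=> x0 xy; rewrite /P ltr_pM2l// ltrXn2r// ?nnegrE ltW// (lt_trans x0).
have Ple (x y : R) : 0 < x -> x <= y -> P x <= P y.
  by move=> x0; rewrite le_eqVlt => /predU1P[->//|xy]; exact/ltW/Plt.
have cg : forall x : R, 0 < x -> {for x, continuous (fun r => f (P r) * (2 * t * r))}.
  move=> x x0; apply: cvgM.
    by apply: (@continuous_comp _ _ _ P f); [exact: cP|exact/cf/Pgt0].
  by apply: cvgM; [exact: cvg_cst|exact: cvg_id].
have g0 : forall x : R, 0 < x -> 0 <= f (P x) * (2 * t * x).
  by move=> x x0; rewrite mulr_ge0 ?f0 ?Pgt0// !mulr_ge0// ltW.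
have l1 := posint_exhaust nondecreasing_segments bigcup_segments
  (continuous_pos_measurable cg) g0.
(* Images of the standard segments under the increasing bijection P; they exhaust (0, oo) too, and
   the substitution is exact on each of them. *)
pose S2 (n : nat) := `[P n.+1%:R^-1, P n.+1%:R]%classic.
have S2nd : {homo S2 : n m / (n <= m)%N >-> (n <= m)%O}.
  move=> n m nm; apply/subsetPset => x; rewrite /S2/= !in_itv/= => /andP[a b].
  apply/andP; split.
    by apply: le_trans a; apply: Ple; rewrite ?invr_gt0// lef_pV2 ?posrE// ler_nat ltnS.
  by apply: (le_trans b); apply: Ple => //; rewrite ler_nat ltnS.
have S2U : \bigcup_n S2 n = pos.
  apply/seteqP; split=> [x [n _]|x]; rewrite posP.
    rewrite /S2/= in_itv/= => /andP[+ _]; apply: lt_le_trans.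
    by apply: Pgt0; rewrite invr_gt0.
  move=> x0.
  have : pos (Num.sqrt (x / t)) by rewrite posP sqrtr_gt0 divr_gt0.
  rewrite -bigcup_segments => -[n _]; rewrite /seg/= in_itv/= => /andP[a b].
  have e : x = P (Num.sqrt (x / t)).
    by rewrite /P sqr_sqrtr ?divr_ge0 ?ltW// mulrC divfK// gt_eqF.
  exists n => //; rewrite /S2/= in_itv/= e; apply/andP; split.
    by apply: Ple => //; rewrite invr_gt0.
  by apply: Ple => //; rewrite sqrtr_gt0 divr_gt0.
have l2 := posint_exhaust S2nd S2U (continuous_pos_measurable cf) f0.
apply: cvg_unique l1 _ => //.
apply: cvg_trans l2; apply: near_eq_cvg; near=> n.
have n0 (x : R) : n.+1%:R^-1 <= x -> 0 < x by apply: lt_le_trans; rewrite invr_gt0.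
have n1 : n.+1%:R^-1 <= n.+1%:R :> R.
  apply: (@le_trans _ _ 1); last by rewrite ler1n.
  by rewrite invf_le1// ler1n.
have P' : P^`()%classic = (fun r => 2 * t * r).
  by apply/funext => x; rewrite derive1E; have := dP x => h; rewrite derive_val.
have cP' (x : R) : {for x, continuous P^`()%classic}.
  by rewrite P'; apply: cvgM; [exact: cvg_cst|exact: cvg_id].
rewrite (@integration_by_substitution_increasing _ P f) //.
- by apply: eq_integral => x _; rewrite /= P'.
- move=> x y; rewrite !in_itv/= => /andP[a _] _.
  by apply: Plt; exact: n0.
- by move=> x _; exact: cP'.
- exact: (cvgP _ (cvg_at_right_filter (cP' _))).
- exact: (cvgP _ (cvg_at_left_filter (cP' _))).
- split.
  + by move=> x _; have [] := dP x.
  + by apply: cvg_at_right_filter; exact: cP.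
  + by apply: cvg_at_left_filter; exact: cP.
- apply: continuous_in_subspaceT => x; rewrite inE/= in_itv/= => /andP[nx _].
  by apply: cf; apply: lt_le_trans nx; apply: Pgt0; rewrite invr_gt0.
Unshelve. all: by end_near. Qed.

End posint.

(** * Euler's integral, the functional equation and Wendel's inequality *)

Section gamma_function.
Context {R : realType}.
Notation pos := (`]0%R, +oo[%classic : set R).

Lemma powR_is_derive (a x : R) : 0 < x ->
  is_derive x 1 (fun t => t `^ a) (a * x `^ (a - 1)).
Proof. exact: is_derive1_powR. Qed.

Lemma powR_continuous (a x : R) : 0 < x -> {for x, continuous (fun t : R => t `^ a)}.
Proof. by move=> x0; apply: is_derive_continuous; exact: powR_is_derive. Qed.

Lemma is_derive_expRN (x : R) : is_derive x 1 (fun t : R => expR (- t)) (- expR (- x)).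
Proof.
have hN : is_derive x 1 (fun t : R => - t) (- 1) by exact: is_deriveN.
have := is_derive1_comp (is_derive_expR (- x)) hN.
by rewrite mulrN1.
Qed.

Lemma expRN_continuous (x : R) : {for x, continuous (fun t : R => expR (- t))}.
Proof. by apply: is_derive_continuous; exact: is_derive_expRN. Qed.

Lemma powR_invS_cvg0 (x : R) : 0 < x -> (n.+1%:R^-1 : R) `^ x @[n --> \oo] --> 0.
Proof.
move=> x0.
have c0 : (n.+1%:R^-1 : R) @[n --> \oo] --> 0^'+.
  move=> A hA.
  have hA' : \forall r \near (0 : R), 0 < r -> A r := hA.
  have h : \forall n \near \oo, 0 < (n.+1%:R^-1 : R) -> A n.+1%:R^-1 := cvg_invS hA'.
  suff : \forall n \near \oo, A (n.+1%:R^-1 : R) by [].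
  near=> n; have : 0 < (n.+1%:R^-1 : R) by rewrite invr_gt0.
  by near: n.
exact: (cvg_comp _ _ c0 (powR_cvg0 x0)).
Unshelve. all: by end_near. Qed.

Lemma expRN_invS_cvg1 : expR (- (n.+1%:R^-1 : R)) @[n --> \oo] --> (1 : R).
Proof.
have lim : expR (- (n.+1%:R^-1 : R)) @[n --> \oo] --> expR (- 0 : R).
  exact: (cvg_comp _ _ cvg_invS (@expRN_continuous 0)).
by rewrite oppr0 expR0 in lim.
Qed.

Lemma powR_expR_bound (p : R) : 0 <= p ->
  exists2 C : R, 0 <= C & forall t : R, 0 < t -> (1 + t `^ p) ^+ 2 * expR (- t) <= C.
Proof.
move=> p0; pose n := Num.bound p.
have pn : p <= n%:R by apply/ltW/archi_boundP.
(* From 1 + t^p <= 2 (1 + t)^(n+1) and (1 + t)^(2n+2) <= (2n+2)! e^(1+t). *)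
exists (4 * ((n + n).+2`!%:R * expR 1)); first by rewrite !mulr_ge0// expR_ge0.
move=> t t0; rewrite expRN ler_pdivrMr ?expR_gt0// -!mulrA -expRD.
have t1 : 1 <= 1 + t by rewrite lerDl ltW.
have tp : t `^ p <= (1 + t) ^+ n.+1.
  apply: (@le_trans _ _ ((1 + t) `^ p)).
    by apply: ge0_ler_powR => //; rewrite ?nnegrE ?(ltW t0) ?(le_trans ler01 t1)// lerDr.
  apply: (@le_trans _ _ ((1 + t) `^ n%:R)); first by rewrite ler_powR.
  by rewrite powR_mulrn ?(le_trans ler01)// ler_weXn2l.
have : (1 + t `^ p) ^+ 2 <= (2 * (1 + t) ^+ n.+1) ^+ 2.
  rewrite lerXn2r ?nnegrE ?addr_ge0 ?powR_ge0//.
    by rewrite mulr_ge0// exprn_ge0// (le_trans ler01).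
  by rewrite mulrDl mul1r lerD// exprn_ege1.
move=> /le_trans; apply.
rewrite exprMn -exprM -natrX ler_wpM2l// -ler_pdivrMl ?ltr0n ?fact_gt0//.
have -> : (n.+1 * 2 = (n + n).+2)%N by rewrite muln2 -addnn addSn addnS.
rewrite mulrC; apply: le_trans (expR_ge1Dxn (n + n).+1 (le_trans ler01 t1)).
by rewrite lerDr.
Qed.

(* The derivative of - 1 / (1 + t^p), used as an integrable majorant. *)
Let W (p t : R) := p * t `^ (p - 1) / (1 + t `^ p) ^+ 2.

Let W_ge0 p t : 0 <= p -> 0 <= W p t.
Proof.
move=> p0; apply: divr_ge0; first by rewrite mulr_ge0 ?powR_ge0.
by rewrite exprn_ge0// addr_ge0 ?powR_ge0.
Qed.

Let W_prim p : 0 < p -> let F := fun t : R => - (1 + t `^ p)^-1 in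
  [/\ (forall x : R, 0 < x -> is_derive x 1 F (W p x)),
      (fun n : nat => F n.+1%:R^-1) @ \oo --> (-1 : R) &
      (fun n : nat => F n.+1%:R) @ \oo --> (0 : R)].
Proof.
move=> p0 F; have d0 (x : R) : 1 + x `^ p != 0.
  by rewrite gt_eqF// ltr_pwDl ?powR_ge0.
have v0 := powR_invS_cvg0 p0.
have v1 : (1 + (n.+1%:R^-1 : R) `^ p)^-1 @[n --> \oo] --> (1 + 0 : R)^-1.
  by apply: cvgV; [rewrite addr0 oner_neq0|apply: cvgD => //; exact: cvg_cst].
split.
- move=> x x0.
  have h1 : is_derive x 1 (fun t : R => 1 + t `^ p) (0 + p * x `^ (p - 1)).
    by apply: is_derive_addf; exact: powR_is_derive.
  have := is_deriveN (@is_deriveV _ _ x _ 1 (d0 x) h1).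
  by rewrite add0r scaleNr opprK /GRing.scale/= /W mulrC.
- rewrite addr0 invr1 in v1; exact: cvgN.
- have v2 : - ((n.+1%:R^-1 : R) `^ p * (1 + (n.+1%:R^-1 : R) `^ p)^-1) @[n --> \oo]
     --> - (0 * (1 + 0 : R)^-1) by apply: cvgN; exact: cvgM.
  rewrite mul0r oppr0 in v2; apply: cvg_ext v2 => n; rewrite /F; congr (- _).
  have -> : (n.+1%:R^-1 : R) `^ p = (n.+1%:R `^ p)^-1.
    by rewrite -powRN -[in LHS](powR_inv1 (ltW _)) ?ltr0n// -powRrM mulN1r.
  by field; rewrite gt_eqF ?powR_gt0//= addrC d0.
Qed.

Let W_cont p x : 0 < x -> {for x, continuous (W p)}.
Proof.
move=> x0; apply: cvgM; first by apply: cvgM; [exact: cvg_cst|exact: powR_continuous].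
have d0 : 1 + x `^ p != 0 by rewrite gt_eqF// ltr_pwDl ?powR_ge0.
apply: cvgV; first by rewrite expf_neq0.
have h : {for x, continuous (fun t : R => 1 + t `^ p)}.
  by apply: cvgD; [exact: cvg_cst|exact: powR_continuous].
by rewrite expr2; apply: cvgM.
Qed.

Let posint_W p : 0 < p -> posint (W p) = 1%:E.
Proof.
move=> p0; have [dF F0 Foo] := W_prim p0.
rewrite (posint_FTC dF _ _ F0 Foo) ?opprK ?add0r//.
  by move=> x; exact: W_cont.
by move=> x _; rewrite W_ge0// ltW.
Qed.

Definition gamma_integrand (x t : R) := t `^ (x - 1) * expR (- t).

Lemma gamma_integrand_ge0 x t : 0 <= gamma_integrand x t.
Proof. by rewrite mulr_ge0 ?powR_ge0 ?expR_ge0. Qed.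

Lemma gamma_integrand_continuous (x t : R) : 0 < t ->
  {for t, continuous (gamma_integrand x)}.
Proof.
by move=> t0; apply: cvgM; [exact: powR_continuous|exact: expRN_continuous].
Qed.

Lemma gamma_integrand_measurable x : measurable_fun pos (gamma_integrand x).
Proof.
by apply: continuous_pos_measurable => t; exact: gamma_integrand_continuous.
Qed.

Let gamma_le_W x : 0 < x -> exists2 C : R, 0 <= C &
  forall t : R, 0 < t -> gamma_integrand x t <= C * W x t.
Proof.
move=> x0; have [C C0 HC] := powR_expR_bound (ltW x0).
exists (C / x); first by rewrite divr_ge0// ltW.
move=> t t0; rewrite /gamma_integrand /W.
have p0 : 0 < (1 + t `^ x) ^+ 2 by rewrite exprn_gt0// ltr_pwDl// powR_ge0.
rewrite [leRHS](_ : _ = t `^ (x - 1) * (C / (1 + t `^ x) ^+ 2)); last first.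
  have d0 : 1 + t `^ x != 0 by rewrite gt_eqF// ltr_pwDl ?powR_ge0.
  by field; rewrite ?d0 ?(gt_eqF x0).
by rewrite ler_wpM2l ?powR_ge0// ler_pdivlMr// mulrC HC.
Qed.

(** The content is finiteness, since [fine] would send +oo to 0: the integrand is at most a multiple
    of [W x], whose integral is 1. *)
Lemma posint_gamma (x : R) : 0 < x -> posint (gamma_integrand x) = (Gamma x)%:E.
Proof.
move=> x0; have [C C0 HC] := gamma_le_W x0.
rewrite /Gamma /Rintegral fineK// ge0_fin_numE; last first.
  by apply: posint_ge0 => t _; exact: gamma_integrand_ge0.
have mW : measurable_fun pos (W x) by apply: continuous_pos_measurable => t; exact: W_cont.
apply: (@le_lt_trans _ _ (posint (fun t => C * W x t))).
  apply: le_posint => //; first exact: gamma_integrand_measurable.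
    exact: measurable_funM.
  by move=> t _; exact: gamma_integrand_ge0.
rewrite posintZ//; last by move=> t _; rewrite W_ge0// ltW.
by rewrite posint_W// mule1 ltry.
Qed.

Lemma Gamma_ge0 (x : R) : 0 < x -> 0 <= Gamma x.
Proof.
move=> x0; rewrite -lee_fin -posint_gamma//.
by apply: posint_ge0 => t _; exact: gamma_integrand_ge0.
Qed.

Lemma Gamma1 : Gamma (1 : R) = 1.
Proof.
apply: EFin_inj; rewrite -posint_gamma//.
have e : forall t : R, 0 < t -> gamma_integrand 1 t = expR (- t).
  by move=> t t0; rewrite /gamma_integrand subrr powRr0 mul1r.
have dF (x : R) : 0 < x -> is_derive x 1 (fun t : R => - expR (- t)) (expR (- x)).
  by move=> _; have := is_deriveN (is_derive_expRN x); rewrite opprK.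
have F0 : - expR (- (n.+1%:R^-1 : R)) @[n --> \oo] --> (-1 : R).
  by apply: cvgN; exact: expRN_invS_cvg1.
have Foo : - expR (- (n.+1%:R : R)) @[n --> \oo] --> (0 : R).
  have := @cvgn_expR R; rewrite -cvg_shiftS => h.
  by rewrite -[0]oppr0; apply: cvgN; apply: cvg_ext h.
rewrite (eq_posint e) (posint_FTC dF _ _ F0 Foo) ?sub0r ?opprK//.
by move=> x _; exact: expRN_continuous.
Qed.

Lemma powR_mulr1 (x p : R) : 0 < x -> x `^ p * x = x `^ (p + 1).
Proof.
by move=> x0; rewrite -[X in _ * X](powRr1 (ltW x0)) -powRD// (gt_eqF x0) implybT.
Qed.

(** Integration by parts, except that the derivative of t^x e^(-t) changes sign and [posint_FTC]
    wants a nonnegative integrand. Adding C [W (x + 1)], which dominates the negative part and has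
    the known integral C, repairs this; the two C cancel at the end. *)
Lemma GammaS (x : R) : 0 < x -> Gamma (x + 1) = x * Gamma x.
Proof.
move=> x0; have x1 : 0 < x + 1 by rewrite addr_gt0.
have [C C0 HC] := gamma_le_W x1.
have [A A0 HA] := powR_expR_bound (ltW x1).
have [dF F0 Foo] := W_prim x1.
pose f t := (x * gamma_integrand x t - gamma_integrand (x + 1) t) + C * W (x + 1) t.
pose F (t : R) := t `^ x * expR (- t) + C * (- (1 + t `^ (x + 1))^-1).
have If : posint f = C%:E.
  have f0 : forall t : R, 0 < t -> 0 <= f t.
    move=> t t0; rewrite /f -addrA addr_ge0//.
      by rewrite mulr_ge0 ?gamma_integrand_ge0// ltW.
    by rewrite addrC subr_ge0 HC.
  have dF' (t : R) : 0 < t -> is_derive t 1 F (f t).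
    move=> t0; apply: is_derive_addf; last by apply: is_derive_scalef; exact: dF.
    have := is_derive_mulf (powR_is_derive x t0) (is_derive_expRN t).
    by rewrite /gamma_integrand addrK mulrN mulrA.
  have cf (t : R) : 0 < t -> {for t, continuous f}.
    move=> t0; apply: cvgD; last by apply: cvgM; [exact: cvg_cst|exact: W_cont].
    apply: cvgB; last exact: gamma_integrand_continuous.
    by apply: cvgM; [exact: cvg_cst|exact: gamma_integrand_continuous].
  have F0' : F n.+1%:R^-1 @[n --> \oo] --> 0 + C * (-1).
    apply: cvgD; last by apply: cvgM; [exact: cvg_cst|exact: F0].
    have lim : (n.+1%:R^-1 : R) `^ x * expR (- (n.+1%:R^-1 : R)) @[n --> \oo] --> 0 * (1 : R).
      by apply: cvgM; [exact: powR_invS_cvg0|exact: expRN_invS_cvg1].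
    by rewrite mul0r in lim.
  have Foo' : F n.+1%:R @[n --> \oo] --> 0 + C * 0.
    apply: cvgD; last by apply: cvgM; [exact: cvg_cst|exact: Foo].
    have lim : A * (n.+1%:R^-1 : R) @[n --> \oo] --> A * 0.
      by apply: cvgM; [exact: cvg_cst|exact: cvg_invS].
    rewrite mulr0 in lim.
    apply: (@squeeze_cvgr _ _ _ _ (fun=> 0) (fun n : nat => A * (n.+1%:R^-1 : R)));
      [|exact: cvg_cst|exact: lim].
    near=> n; rewrite mulr_ge0 ?powR_ge0 ?expR_ge0//= ler_pdivlMr//.
    have n0 : 0 < n.+1%:R :> R by [].
    apply: le_trans (HA _ n0); rewrite mulrAC ler_wpM2r ?expR_ge0//.
    rewrite powR_mulr1// (@le_trans _ _ (1 + n.+1%:R `^ (x + 1)))// ?lerDr//.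
    by rewrite -[leLHS]expr1 ler_weXn2l// lerDl powR_ge0.
  by rewrite (posint_FTC dF' cf f0 F0' Foo'); congr EFin; ring.
have mg y := gamma_integrand_measurable y.
have mW : measurable_fun pos (W (x + 1)).
  by apply: continuous_pos_measurable => t; exact: W_cont.
have mf : measurable_fun pos f.
  apply: measurable_funD; last exact: measurable_funM.
  by apply: measurable_funB => //; exact: measurable_funM.
have f0 : forall t : R, 0 < t -> 0 <= f t.
  move=> t t0; rewrite /f -addrA addr_ge0//.
    by rewrite mulr_ge0 ?gamma_integrand_ge0// ltW.
  by rewrite addrC subr_ge0 HC.
have W0 : forall t : R, 0 < t -> 0 <= W (x + 1) t by move=> t _; rewrite W_ge0// ltW.
have g0 y : forall t : R, 0 < t -> 0 <= gamma_integrand y t.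
  by move=> t _; exact: gamma_integrand_ge0.
have sum1 := posintD mf (mg (x + 1)) f0 (g0 (x + 1)).
have mxg : measurable_fun pos (fun t => x * gamma_integrand x t) by exact: measurable_funM.
have mCW : measurable_fun pos (fun t => C * W (x + 1) t) by exact: measurable_funM.
have xg0 (t : R) : 0 < t -> 0 <= x * gamma_integrand x t.
  by move=> t0; rewrite mulr_ge0 ?g0// ltW.
have CW0 (t : R) : 0 < t -> 0 <= C * W (x + 1) t.
  by move=> t0; rewrite mulr_ge0 ?W0.
have sum2 := posintD mxg mCW xg0 CW0.
have e (t : R) : 0 < t -> f t + gamma_integrand (x + 1) t =
    x * gamma_integrand x t + C * W (x + 1) t by move=> _; rewrite /f; ring.
have := eq_posint e; rewrite sum1 sum2 If posint_gamma//.
rewrite (posintZ (mg x) (g0 x) (ltW x0)) (posintZ mW W0 C0) posint_W// posint_gamma//.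
rewrite mule1 -!EFinM -!EFinD => -[].
by rewrite addrC => /addIr.
Unshelve. all: by end_near. Qed.

(** Young's inequality for u^d and 1 with the exponents 1 / d and 1 / (1 - d). *)
Lemma powR_young (u d : R) : 0 <= u -> 0 < d < 1 -> u `^ d <= (1 - d) + d * u.
Proof.
move=> u0 /andP[d0 d1].
have := @conjugate_powR R (u `^ d) 1 d^-1 (1 - d)^-1.
rewrite powR_ge0 ler01 !invr_gt0 subr_gt0 !invrK mulr1 -powRrM divff ?gt_eqF//.
rewrite powRr1// powR1 mul1r => H; rewrite addrC mulrC; apply: H => //.
by rewrite addrC subrK.
Qed.

(** [powR_young] at u = t / y gives t^d <= y^d ((1 - d) + d t / y); integrated against t^(y-1)
    e^(-t), the bracket contributes (1 - d) + d = 1 because Gamma (y + 1) = y Gamma y. *)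
Lemma Gamma_wendel (y d : R) : 0 < y -> 0 < d < 1 -> Gamma (y + d) <= y `^ d * Gamma y.
Proof.
move=> y0 d01; have /andP[d0 d1] := d01.
have yd : 0 < y + d by rewrite addr_gt0.
have y1 : 0 < y + 1 by rewrite addr_gt0.
have mg z := gamma_integrand_measurable z.
have g0 z : forall t : R, 0 < t -> 0 <= gamma_integrand z t.
  by move=> t _; exact: gamma_integrand_ge0.
pose A := y `^ d * (1 - d); pose B := y `^ d * (d / y).
have A0 : 0 <= A by rewrite mulr_ge0 ?powR_ge0// subr_ge0 ltW.
have B0 : 0 <= B by rewrite mulr_ge0 ?powR_ge0// divr_ge0// ltW.
have key : (posint (gamma_integrand (y + d)) <=
    posint (fun t => A * gamma_integrand y t + B * gamma_integrand (y + 1) t)%R)%E.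
  apply: le_posint; [exact: mg| |exact: g0|].
    by apply: measurable_funD; apply: measurable_funM.
  move=> t t0; rewrite /gamma_integrand addrK.
  have -> : y + d - 1 = (y - 1) + d by ring.
  have e1 : t `^ y = t `^ (y - 1) * t.
    by rewrite powR_mulr1// subrK.
  rewrite e1 powRD ?(gt_eqF t0) ?implybT//.
  have := powR_young (divr_ge0 (ltW t0) (ltW y0)) d01.
  rewrite powRM ?(ltW t0) ?invr_ge0 ?(ltW y0)//.
  have -> : y^-1 `^ d = (y `^ d)^-1 by rewrite -powRN -(powR_inv1 (ltW y0)) -powRrM mulN1r.
  rewrite ler_pdivrMr ?powR_gt0// => h.
  rewrite [leRHS](_ : _ = (t `^ (y - 1) * expR (- t)) *
     ((1 - d + d * (t / y)) * y `^ d)); last by rewrite /A /B; field; rewrite gt_eqF.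
  rewrite mulrAC; apply: ler_wpM2l h.
  by rewrite mulr_ge0 ?powR_ge0 ?expR_ge0.
have mA : measurable_fun pos (fun t => A * gamma_integrand y t) by exact: measurable_funM.
have mB : measurable_fun pos (fun t => B * gamma_integrand (y + 1) t).
  exact: measurable_funM.
have Ag0 (t : R) : 0 < t -> 0 <= A * gamma_integrand y t.
  by move=> t0; exact: mulr_ge0 A0 (g0 y t t0).
have Bg0 (t : R) : 0 < t -> 0 <= B * gamma_integrand (y + 1) t.
  by move=> t0; exact: mulr_ge0 B0 (g0 _ t t0).
move: key; rewrite (posintD mA mB Ag0 Bg0) (posintZ (mg y) (g0 y) A0).
rewrite (posintZ (mg (y + 1)) (g0 (y + 1)) B0) (posint_gamma yd) (posint_gamma y0).
rewrite (posint_gamma y1) -!EFinM -EFinD lee_fin GammaS// => /le_trans; apply.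
by rewrite le_eqVlt; apply/orP; left; apply/eqP; rewrite /A /B; field; rewrite gt_eqF.
Qed.

(** If Gamma vanished at x, Wendel's inequality would make it at most 0 at the next integer, where
    the functional equation makes it positive. *)
Lemma Gamma_gt0 (x : R) : 0 < x -> 0 < Gamma x.
Proof.
have Gn (n : nat) : 0 < Gamma (n.+1%:R : R).
  elim: n => [|n IH]; first by rewrite Gamma1.
  by rewrite -natr1 GammaS// mulr_gt0.
move=> x0; rewrite lt_def Gamma_ge0// andbT; apply/eqP => G0.
pose n := Num.truncn x.
have /andP[nx xn] : n%:R <= x < n.+1%:R by apply: truncn_itv; exact: ltW.
have [e|ne] := eqVneq x n%:R.
  move: x0 G0; rewrite e; case: n {nx xn e} => [|n]; first by rewrite ltxx.
  by move=> _ G0; have := Gn n; rewrite G0 ltxx.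
have d01 : 0 < n.+1%:R - x < 1.
  rewrite subr_gt0 xn/= -natr1 -subr_gt0 [ltRHS](_ : _ = x - n%:R); last by ring.
  by rewrite subr_gt0 lt_def ne.
have := Gamma_wendel x0 d01; rewrite G0 mulr0 addrC subrK.
by rewrite leNgt Gn.
Qed.

Lemma gaussian_moment (c t : R) : 0 < c -> 0 < t ->
  posint (fun r => r `^ (2 * c - 1) * expR (- (t * r ^+ 2))) =
  (Gamma c / (2 * t `^ c))%:E.
Proof.
move=> c0 t0.
have e : forall r : R, 0 < r ->
    gamma_integrand c (t * r ^+ 2) * (2 * t * r) =
    2 * t `^ c * (r `^ (2 * c - 1) * expR (- (t * r ^+ 2))).
  move=> r r0; rewrite /gamma_integrand powRM ?sqr_ge0 ?(ltW t0)//.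
  have -> : t `^ c = t `^ (c - 1) * t.
    by rewrite powR_mulr1// subrK.
  have -> : r `^ (2 * c - 1) = (r ^+ 2) `^ (c - 1) * r.
    rewrite -powR_mulrn ?(ltW r0)// -powRrM powR_mulr1//.
    by congr (_ `^ _); ring.
  ring.
have := posint_square t0 (@gamma_integrand_continuous c)
  (fun t _ => gamma_integrand_ge0 c t).
have mm : measurable_fun pos (fun r : R => r `^ (2 * c - 1) * expR (- (t * r ^+ 2))).
  apply: continuous_pos_measurable => r r0; apply: cvgM; first exact: powR_continuous.
  apply: (@continuous_comp _ _ _ (fun r : R => t * r ^+ 2) (fun t : R => expR (- t))).
    apply: cvgM; first exact: cvg_cst.
    exact: exprn_continuous.
  exact: expRN_continuous.
have m0 (r : R) : 0 < r -> 0 <= r `^ (2 * c - 1) * expR (- (t * r ^+ 2)).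
  by move=> _; rewrite mulr_ge0 ?powR_ge0 ?expR_ge0.
have p0 : 0 < 2 * t `^ c by rewrite mulr_gt0 ?powR_gt0.
rewrite (eq_posint e) (posintZ mm m0 (ltW p0)) (posint_gamma c0) => h.
have /= := congr1 (fun z => ((2 * t `^ c)^-1%:E * z)%E) h.
rewrite muleA -EFinM mulVf ?gt_eqF// mul1e => ->.
by rewrite -EFinM mulrC.
Qed.

End gamma_function.

Ltac pos_neq0 := do ?[apply/andP; split]; apply: lt0r_neq0; lra.

(** * Rising and falling factorials and their binomial sums *)

Section pochhammer.
Context {R : realType}.
Implicit Types (a b c x : R).

Definition poch a k : R := \prod_(i < k) (a + i%:R).

Lemma poch0 a : poch a 0 = 1. Proof. by rewrite /poch big_ord0. Qed.

Lemma pochS a k : poch a k.+1 = poch a k * (a + k%:R).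
Proof. by rewrite /poch big_ord_recr. Qed.

Lemma poch_recl a k : poch a k.+1 = a * poch (a + 1) k.
Proof.
rewrite /poch big_ord_recl/= addr0; congr (_ * _); apply: eq_bigr => i _.
by rewrite /bump/= add1n -natr1; ring.
Qed.

Lemma poch_gt0 a k : 0 < a -> 0 < poch a k.
Proof. by move=> a0; apply: prodr_gt0 => i _; rewrite ltr_wpDr. Qed.

Lemma poch_shift a k : a * poch (a + 1) k = poch a k * (a + k%:R).
Proof. by rewrite -poch_recl pochS. Qed.

Lemma pochD a k m : poch a (k + m) = poch a k * poch (a + k%:R) m.
Proof.
elim: m => [|m IH]; first by rewrite addn0 poch0 mulr1.
by rewrite addnS !pochS IH natrD -!mulrA addrA.
Qed.

Lemma poch_duplication a k :
  poch (2 * a) (k + k) = 4 ^+ k * poch a k * poch (a + 1 / 2) k.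
Proof.
elim: k => [|k IH]; first by rewrite addn0 !poch0 expr0 !mulr1.
by rewrite addSn addnS !pochS IH exprS -natr1 natrD; field.
Qed.

(** The coefficients of Kummer's function: [egf (pratio a c)] is 1F1(a; c; x). *)
Definition pratio a c k := poch a k / poch c k.

Lemma pratio0 a c : pratio a c 0 = 1.
Proof. by rewrite /pratio !poch0 divr1. Qed.

Lemma pratioS a c k : pratio a c k.+1 = pratio a c k * ((a + k%:R) / (c + k%:R)).
Proof. by rewrite /pratio !pochS invfM mulrACA. Qed.

Lemma pratio_recl a c k : pratio a c k.+1 = a / c * pratio (a + 1) (c + 1) k.
Proof. by rewrite /pratio !poch_recl invfM mulrACA. Qed.

Lemma pratio_gt0 a c k : 0 < a -> 0 < c -> 0 < pratio a c k.
Proof. by move=> a0 c0; rewrite divr_gt0 ?poch_gt0. Qed.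

Lemma pratio_shift a c k : 0 < c ->
  pratio a (c + 1) k = pratio a c k * (c / (c + k%:R)).
Proof.
move=> c0; rewrite /pratio.
have p0 : poch (c + 1) k != 0 by rewrite gt_eqF// poch_gt0// addr_gt0.
have p1 : poch c k != 0 by rewrite gt_eqF// poch_gt0.
have ck : c + k%:R != 0 by rewrite gt_eqF// ltr_wpDr.
have -> : poch (c + 1) k = poch c k * (c + k%:R) / c.
  by rewrite -poch_shift mulrC mulKf// gt_eqF.
by field; rewrite p1 ck gt_eqF.
Qed.

Lemma geom_bounded_pratio a c : 0 < a -> 0 < c -> geom_bounded (pratio a c).
Proof.
move=> a0 c0; exists 1, (1 + a / c); split=> //; first by rewrite addr_ge0 ?divr_ge0 ?ltW.
move=> k; rewrite mul1r gtr0_norm ?pratio_gt0//.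
elim: k => [|k IH]; first by rewrite pratio0 expr0.
rewrite pratioS exprSr ler_pM ?(ltW (pratio_gt0 _ _ _))//.
  by rewrite divr_ge0// addr_ge0// ltW.
rewrite ler_pdivrMr ?ltr_wpDr// -subr_ge0.
rewrite [leRHS](_ : _ = c + a / c * k%:R); last by field; rewrite gt_eqF.
by rewrite addr_ge0 ?mulr_ge0 ?invr_ge0 ?(ltW a0) ?(ltW c0).
Qed.

Definition ffall a k : R := \prod_(i < k) (a - i%:R).

Lemma ffall_recl a k : ffall a k.+1 = a * ffall (a - 1) k.
Proof.
rewrite /ffall big_ord_recl/= subr0; congr (_ * _); apply: eq_bigr => i _.
by rewrite /bump/= add1n -natr1; ring.
Qed.

Lemma ffall_poch a k : ffall (a + k%:R) k = poch (a + 1) k.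
Proof.
elim: k a => [|k IH] a; first by rewrite /ffall /poch !big_ord0.
rewrite ffall_recl pochS -IH -natr1 mulrC; congr (ffall _ _ * _); ring.
Qed.

Lemma pascal_sum (F : nat -> R) k : \sum_(i < k.+2) 'C(k.+1, i)%:R * F i =
  \sum_(i < k.+1) 'C(k, i)%:R * F i.+1 + \sum_(i < k.+1) 'C(k, i)%:R * F i.
Proof.
rewrite big_ord_recl/= [X in _ = _ + X]big_ord_recl/= !bin0 addrCA; congr (_ + _).
have -> : \sum_(i < k) 'C(k, bump 0 i)%:R * F (bump 0 i) =
    \sum_(i < k.+1) 'C(k, i.+1)%:R * F i.+1.
  by rewrite [RHS]big_ord_recr/= bin_small// mul0r addr0.
rewrite -big_split/=; apply: eq_bigr => i _.
by rewrite /bump/= add1n binS natrD mulrDl addrC.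
Qed.

Lemma binomial_convS (a b : nat -> R) k : binomial_conv a b k.+1 =
  binomial_conv (fun i => a i.+1) b k + binomial_conv a (fun i => b i.+1) k.
Proof.
rewrite /binomial_conv (pascal_sum (fun i => a i * b (k.+1 - i)%N)).
by congr (_ + _); apply: eq_bigr => i _; rewrite ?subSS// subSn// -ltnS.
Qed.

Lemma binomial_conv_mulX (a b : nat -> R) k :
  binomial_conv (fun i => i%:R * a i.-1) b k = k%:R * binomial_conv a b k.-1.
Proof.
rewrite /binomial_conv; case: k => [|k].
  by rewrite big_ord1 !mul0r mulr0.
rewrite big_ord_recl/= !mul0r mulr0 add0r mulr_sumr; apply: eq_bigr => i _.
rewrite /bump/= add1n subSS; have := mul_bin_diag k.+1 i.
move=> /(congr1 (fun n : nat => n%:R : R)); rewrite !natrM => e.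
by rewrite add0n [RHS]mulrA e; ring.
Qed.

(** By Pascal's rule the sum for k + 1 is a times the sum for (a - 1, b) plus b times the sum for
    (a, b - 1), and both of these are the falling factorial of a + b - 1. *)
Lemma vandermonde_ffall a b k : binomial_conv (ffall a) (ffall b) k = ffall (a + b) k.
Proof.
elim: k a b => [|k IH] a b.
  by rewrite /binomial_conv big_ord1 /ffall !big_ord0 bin0 !mulr1.
rewrite binomial_convS ffall_recl.
have E u v (c : R) : binomial_conv (fun i => c * u i) v k = c * binomial_conv u v k.
  by rewrite /binomial_conv mulr_sumr; apply: eq_bigr => i _; ring.
have E' u v (c : R) : binomial_conv u (fun i => c * v i) k = c * binomial_conv u v k.
  by rewrite /binomial_conv mulr_sumr; apply: eq_bigr => i _; ring.
under [X in binomial_conv X _]eq_fun do rewrite ffall_recl.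
under [X in _ + binomial_conv _ X _]eq_fun do rewrite ffall_recl.
rewrite E E' !IH mulrDl; congr (_ * ffall _ _ + _ * ffall _ _); ring.
Qed.

(** A forward difference of [pratio b c] is -(c - b) / c times [pratio b (c + 1)]; by Pascal's rule
    the sum for k + 1 is therefore a multiple of the sum for k with c + 1. *)
Lemma binomial_transform_pratio b c k : 0 < c ->
  binomial_conv (pratio b c) (fun i => (-1) ^+ i) k = (-1) ^+ k * pratio (c - b) c k.
Proof.
elim: k c => [|k IH] c c0.
  by rewrite /binomial_conv big_ord1/= bin0 !pratio0 subnn expr0 !mulr1.
rewrite binomial_convS.
have -> : binomial_conv (fun i => pratio b c i.+1) (fun i => (-1) ^+ i) k +
    binomial_conv (pratio b c) (fun i => (-1) ^+ i.+1) k =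
    - ((c - b) / c) * binomial_conv (pratio b (c + 1)) (fun i => (-1) ^+ i) k.
  rewrite /binomial_conv -big_split/= mulr_sumr; apply: eq_bigr => i _.
  rewrite pratioS pratio_shift// exprS; field.
  by have i0 : 0 <= i%:R :> R by []; pos_neq0.
rewrite IH ?addr_gt0// pratio_recl exprS.
have -> : c - b + 1 = c + 1 - b by ring.
ring.
Qed.

End pochhammer.

(** * Kummer's function and the profile of the transform of a Gaussian *)

Section kummer_function.
Context {R : realType}.
Implicit Types (a b c x : R).

Lemma kummer_transformation a c x : 0 < a -> a < c ->
  egf (fun k => (-1) ^+ k * pratio a c k) x = expR (- x) * egf (pratio (c - a) c) x.
Proof.
move=> a0 ac; have c0 : 0 < c by rewrite (lt_trans a0).
have ca : 0 < c - a by rewrite subr_gt0.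
have e : egf (fun i : nat => (-1) ^+ i) x = expR (- x).
  have := egf_scale (-1) (fun=> 1) x; rewrite mulN1r egf_exp => ->.
  by congr (egf _ x); apply/funext => k; rewrite mulr1.
rewrite -e mulrC egf_mul; [|exact: geom_bounded_pratio|exact: geom_bounded_pow].
congr (egf _ x); apply/funext => k.
by rewrite binomial_transform_pratio// subKr.
Qed.

(** Coefficients of 1F1(a; 2 a; x), the case that Weber's integral produces with a = nu + 1/2. *)
Definition rho a := pratio a (2 * a).

Lemma rho_gt0 a k : 0 < a -> 0 < rho a k.
Proof. by move=> a0; rewrite pratio_gt0// mulr_gt0. Qed.

Lemma geom_bounded_rho a : 0 < a -> geom_bounded (rho a).
Proof. by move=> a0; apply: geom_bounded_pratio => //; rewrite mulr_gt0. Qed.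

(** The left side lists the coefficients of x [egf (rho (a + 1)) x] / (4 a + 2). It lets
    [kummerQ (a + 1)], which carries x^(a+1), be written with the factor x^a of [kummerQ a]; the
    divisor 4 a + 2 is the ratio of the normalizing constants in [weberQ_next]. *)
Lemma rho_next a k : 0 < a ->
  k%:R * rho (a + 1) k.-1 / (4 * a + 2) = rho a k * (k%:R / (2 * a + k%:R)).
Proof.
move=> a0; case: k => [|m]; first by rewrite !mul0r mulr0.
rewrite /rho pratio_recl (_ : 2 * (a + 1) = (2 * a + 1) + 1); last by ring.
rewrite (@pratio_shift _ _ (2 * a + 1)) ?addr_gt0 ?mulr_gt0//= -[m.+1%:R]natr1.
have : 0 <= m%:R :> R by [].
set n := m%:R => n0.
by field; pos_neq0.
Qed.

Lemma geom_boundedZ (c : R) h : geom_bounded h -> geom_bounded (fun k => c * h k).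
Proof.
move=> hb; apply: (geom_bounded_le (C := `|c|) hb) => k.
by rewrite normrM.
Qed.

Lemma is_derive_expN_egf h x : geom_bounded h ->
  is_derive x 1 (fun x => expR (- x) * egf h x)
    (expR (- x) * egf (fun k => h k.+1 - h k) x).
Proof.
move=> hb; have := is_derive_mulf (is_derive_expRN x) (is_derive_egf x hb).
congr is_derive; rewrite egfB//; last exact: geom_bounded_shift.
ring.
Qed.

(** The new coefficients are those of the operator a + x d/dx - x applied to [egf h]. Monotonicity
    of x^a e^(-x) [egf h x] thus follows from their signs. *)
Lemma is_derive_powR_expN_egf a h x : geom_bounded h -> 0 < x ->
  is_derive x 1 (fun x => x `^ a * (expR (- x) * egf h x))
    (x `^ (a - 1) * (expR (- x) *
      egf (fun k => (a + k%:R) * h k - k%:R * h k.-1) x)).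
Proof.
move=> hb x0.
have := is_derive_mulf (powR_is_derive a x0) (is_derive_expN_egf x hb).
congr is_derive.
have hS := geom_bounded_shift hb.
have -> : (fun k => (a + k%:R) * h k - k%:R * h k.-1) =
    (fun k => a * h k + k%:R * (h k.-1.+1 - h k.-1)).
  by apply/funext => -[|k]/=; ring.
have hD : geom_bounded (fun k => h k.+1 - h k).
  apply: geom_boundedD => //; apply: (geom_bounded_le (C := 1) hb) => k.
  by rewrite normrN mul1r.
rewrite (@egfD _ (fun k => a * h k) (fun k => k%:R * (h k.-1.+1 - h k.-1)));
  [|exact: geom_boundedZ|exact: (geom_bounded_pred hD)].
rewrite egfZ// (egf_mulX _ hD) -[in LHS](subrK 1 a) -powR_mulr1 ?addrK//.
by rewrite subrK; ring.
Qed.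

(* With a = nu + 1/2 and x = s^2 / t, this is, up to a constant factor, the
   transform of exp (- t r^2). *)
Definition kummerQ a x := x `^ a * (expR (- x) * egf (rho a) x).

Lemma kummerQ_continuous a x : 0 < a -> 0 < x -> {for x, continuous (kummerQ a)}.
Proof.
move=> a0 x0; apply: is_derive_continuous.
exact: (is_derive_powR_expN_egf _ (geom_bounded_rho a0) x0).
Qed.

Lemma geom_bounded_euler a h : geom_bounded h ->
  geom_bounded (fun k => (a + k%:R) * h k - k%:R * h k.-1).
Proof.
move=> hb; apply: geom_boundedD.
  apply: geom_boundedM => //; apply: geom_boundedD; first exact: geom_bounded_cst.
  exact: geom_bounded_nat.
apply: (geom_bounded_le (C := 1) (geom_bounded_pred hb)) => k.
by rewrite normrN mul1r.
Qed.

Lemma powR_expN_egf_incr a h x y : 0 < a -> geom_bounded h ->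
  (forall k, 0 <= (a + k%:R) * h k - k%:R * h k.-1) -> 0 < h 0%N ->
  0 < x -> x < y ->
  x `^ a * (expR (- x) * egf h x) < y `^ a * (expR (- y) * egf h y).
Proof.
move=> a0 hb hE h0 x0 xy.
apply: (@is_derive_incr _ (fun x => x `^ a * (expR (- x) * egf h x)) _ _ _ xy
   (fun z (zxy : x <= z <= y) =>
     is_derive_powR_expN_egf a hb (lt_le_trans x0 (proj1 (andP zxy))))).
move=> z /andP[xz _]; have z0 := lt_le_trans x0 xz.
rewrite mulr_gt0 ?powR_gt0// mulr_gt0 ?expR_gt0//.
apply: egf_gt0; [exact: geom_bounded_euler|exact: ltW|exact: hE|].
by rewrite mul0r subr0 addr0 mulr_gt0.
Qed.

(** Beyond the first, the coefficients of the derivative of [kummerQ a] have the sign of a - 1: this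
    gives growth for a >= 1 and the upper bound on the derivative for a <= 1. *)
Lemma rho_euler a m : 0 < a ->
  (a + m.+1%:R) * rho a m.+1 - m.+1%:R * rho a m =
  rho a m * ((a * (a - 1)) / (2 * a + m%:R)).
Proof.
move=> a0; rewrite /rho pratioS -natr1; field.
by rewrite gt_eqF// ltr_wpDr// mulr_gt0.
Qed.

Lemma kummerQ_incr a x y : 1 <= a -> 0 < x -> x < y -> kummerQ a x < kummerQ a y.
Proof.
move=> a1; have a0 : 0 < a by rewrite (lt_le_trans ltr01).
apply: powR_expN_egf_incr => //; first exact: geom_bounded_rho.
  case=> [|m]; first by rewrite mul0r subr0 mulr_ge0 ?addr_ge0 ?(ltW a0)// ltW// rho_gt0.
  rewrite rho_euler// mulr_ge0 ?(ltW (rho_gt0 _ _))// divr_ge0//.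
    by rewrite mulr_ge0 ?subr_ge0// ltW.
  by rewrite addr_ge0// mulr_ge0// ltW.
exact: rho_gt0.
Qed.

Lemma kummerQ_next a x : 0 < a -> 0 < x -> kummerQ (a + 1) x / (4 * a + 2) =
  x `^ a * (expR (- x) * egf (fun k => rho a k * (k%:R / (2 * a + k%:R))) x).
Proof.
move=> a0 x0; rewrite /kummerQ -powR_mulr1//.
have a1 : 0 < a + 1 by rewrite addr_gt0.
have -> : (fun k => rho a k * (k%:R / (2 * a + k%:R))) =
    (fun k => (4 * a + 2)^-1 * (k%:R * rho (a + 1) k.-1)).
  by apply/funext => k; rewrite -rho_next// mulrC.
rewrite egfZ ?egf_mulX; [ring|exact: geom_bounded_rho|].
exact/geom_bounded_pred/geom_bounded_rho.
Qed.

Lemma geom_bounded_rho_frac a (A B : R) : 0 < a -> 0 <= A -> 0 <= B ->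
  geom_bounded (fun k => rho a k * ((A + B * k%:R) / (2 * a + k%:R))).
Proof.
move=> a0 A0 B0; apply: (geom_bounded_le (C := A / (2 * a) + B) (geom_bounded_rho a0)) => k.
have a2 : 0 < 2 * a by rewrite mulr_gt0.
have ak : 0 < 2 * a + k%:R by rewrite ltr_wpDr.
rewrite normrM mulrC ler_wpM2r// ger0_norm; last first.
  by rewrite divr_ge0 ?(ltW ak)// addr_ge0 ?mulr_ge0.
rewrite ler_pdivrMr// -subr_ge0.
rewrite [leRHS](_ : _ = A / (2 * a) * k%:R + B * (2 * a)); last by field; rewrite gt_eqF.
by rewrite addr_ge0 ?mulr_ge0 ?divr_ge0 ?invr_ge0 ?(ltW a2) ?(ltW a0).
Qed.

(** The coefficients of the sum are rho_k (1 + k / (2 a + k)) = 2 rho_(k+1). In the derivative, the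
    identity (a + n)^2 - n (2 a + n) = a^2 leaves nonnegative coefficients for every a > 0, not only
    for a >= 1. *)
Lemma kummerQ_add_next_incr a x y : 0 < a -> 0 < x -> x < y ->
  kummerQ a x + kummerQ (a + 1) x / (4 * a + 2) <
  kummerQ a y + kummerQ (a + 1) y / (4 * a + 2).
Proof.
move=> a0 x0 xy; have y0 := lt_trans x0 xy.
have b1 : geom_bounded (fun k => rho a k * (k%:R / (2 * a + k%:R))).
  have := geom_bounded_rho_frac a0 (lexx 0) ler01.
  by under eq_fun do rewrite add0r mul1r.
have E z : 0 < z -> kummerQ a z + kummerQ (a + 1) z / (4 * a + 2) =
    z `^ a * (expR (- z) * egf (fun k => 2 * rho a k.+1) z).
  move=> z0; rewrite kummerQ_next// /kummerQ -!mulrDr -egfD//; last exact: geom_bounded_rho.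
  congr (_ * (_ * egf _ z)); apply/funext => k; rewrite /rho pratioS.
  by field; rewrite gt_eqF// ltr_wpDr// mulr_gt0.
rewrite !E//; apply: powR_expN_egf_incr => //.
- apply: geom_boundedM; first exact: geom_bounded_cst.
  by apply: geom_bounded_shift; exact: geom_bounded_rho.
- case=> [|k].
    rewrite mul0r subr0 addr0; apply: mulr_ge0; first exact: ltW.
    by apply: mulr_ge0 => //; exact/ltW/rho_gt0.
  rewrite /= [rho a k.+2]pratioS -/(rho a).
  rewrite [leRHS](_ : _ = 2 * rho a k.+1 * (a ^+ 2 / (2 * a + k.+1%:R))); last first.
    by field; rewrite gt_eqF// ltr_wpDr// mulr_gt0.
  apply: mulr_ge0; first by rewrite mulr_ge0// ltW// rho_gt0.
  by rewrite divr_ge0 ?sqr_ge0// addr_ge0// mulr_ge0// ltW.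
- by rewrite mulr_gt0// rho_gt0.
Qed.

(** Coefficientwise: the factors k / (2 a + k) of [kummerQ_next] are below 1. *)
Lemma kummerQ_next_lt a x : 0 < a -> 0 < x ->
  kummerQ (a + 1) x / (4 * a + 2) < kummerQ a x.
Proof.
move=> a0 x0; rewrite kummerQ_next// /kummerQ ltr_pM2l ?powR_gt0//.
rewrite ltr_pM2l ?expR_gt0// -subr_gt0 -egfB; last 2 first.
- exact: geom_bounded_rho.
- have := geom_bounded_rho_frac a0 (lexx 0) ler01.
  by under eq_fun do rewrite add0r mul1r.
have -> : (fun k => rho a k - rho a k * (k%:R / (2 * a + k%:R))) =
    (fun k => rho a k * ((2 * a + 0 * k%:R) / (2 * a + k%:R))).
  apply/funext => k; field.
  by rewrite gt_eqF// ltr_wpDr// mulr_gt0.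
have a2 : 0 < 2 * a by rewrite mulr_gt0.
apply: egf_gt0 => [||k|].
- exact: geom_bounded_rho_frac (ltW _) _.
- exact: ltW.
- rewrite mul0r addr0; apply: mulr_ge0; first exact/ltW/rho_gt0.
  by rewrite divr_ge0 ?addr_ge0 ?(ltW a2).
- by rewrite mul0r !addr0 divff ?gt_eqF// mulr1 rho_gt0.
Qed.

(** Level 0 is x^(-a) [kummerQ a x]. Differentiating e^(-x) 1F1(a; c; x) gives -(c - a) / c times
    the same function with c + 1; starting from c = 2 a, these factors multiply up to [rho a n]. *)
Lemma cm_tower_kummer a : 0 < a -> cm_tower (fun n x =>
  rho a n * (expR (- x) * egf (pratio a (2 * a + n%:R)) x)).
Proof.
move=> a0 n x x0; have a2 : 0 < 2 * a + n%:R by rewrite ltr_wpDr// mulr_gt0.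
have gb := geom_bounded_pratio a0 a2; split.
  have := is_derive_scalef (rho a n) (is_derive_expN_egf x gb).
  congr is_derive; rewrite /rho pratioS -/(rho a).
  have -> : (fun k => pratio a (2 * a + n%:R) k.+1 - pratio a (2 * a + n%:R) k) =
     (fun k => - ((a + n%:R) / (2 * a + n%:R)) * pratio a (2 * a + n.+1%:R) k).
    apply/funext => k; rewrite -[n.+1%:R]natr1 addrA pratio_shift// pratioS; field.
    by rewrite (gt_eqF a2)/= gt_eqF// ltr_wpDr.
  rewrite egfZ; last by apply: geom_bounded_pratio; rewrite // ltr_wpDr// mulr_gt0.
  ring.
apply: mulr_ge0; first exact/ltW/rho_gt0.
apply: mulr_ge0; first exact: expR_ge0.
by apply: egf_ge0 => //; [exact: ltW|move=> k; exact/ltW/pratio_gt0].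
Qed.

Lemma egf_le0 h x : geom_bounded h -> 0 <= x -> (forall k, h k <= 0) -> egf h x <= 0.
Proof.
move=> hb x0 h0; rewrite -oppr_ge0 -mulN1r -egfZ//.
by apply: egf_ge0 => // [|k]; [exact: geom_boundedZ|rewrite mulN1r oppr_ge0].
Qed.

Lemma egf_ndecr h x y : geom_bounded h -> (forall k, 0 <= h k.+1) -> 0 <= x ->
  x <= y -> egf h x <= egf h y.
Proof.
move=> hb h0 x0 xy.
apply: (is_derive_ndecr xy (fun z (_ : x <= z <= y) => is_derive_egf z hb)).
move=> z /andP[xz _]; apply: egf_ge0 => //; first exact: geom_bounded_shift.
exact: le_trans xz.
Qed.

Lemma egf_le_first h x : geom_bounded h -> 0 <= x -> (forall k, h k.+1 <= 0) ->
  egf h x <= h 0%N.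
Proof.
move=> hb x0 h0; rewrite -(egf0 h).
apply: (is_derive_nincr x0 (fun z (_ : 0 <= z <= x) => is_derive_egf z hb)).
by move=> z /andP[z0 _]; apply: egf_le0 => //; exact: geom_bounded_shift.
Qed.

Lemma kummerQ_small a : 0 < a -> exists2 C, 0 <= C &
  forall x, 0 < x -> x <= 1 -> kummerQ a x <= C * x `^ a.
Proof.
move=> a0; have rb := geom_bounded_rho a0.
pose K := egf (rho a) 1.
exists K; first by apply: egf_ge0 => // k; exact/ltW/rho_gt0.
move=> x x0 x1; rewrite /kummerQ mulrC ler_wpM2r ?powR_ge0//.
rewrite -[leRHS]mul1r; apply: ler_pM; rewrite ?expR_ge0//.
- by apply: egf_ge0 => //; [exact: ltW|move=> k; exact/ltW/rho_gt0].
- by rewrite -expR0 ler_expR oppr_le0 ltW.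
by apply: egf_ndecr => //; [move=> k; exact/ltW/rho_gt0|exact: ltW].
Qed.

(* For a <= 1 the derivative of kummerQ a is at most a x^(a-1) e^(-x). *)
Lemma kummerQ_bounded a : 0 < a -> a <= 1 ->
  exists C, forall x, 1 <= x -> kummerQ a x <= C.
Proof.
move=> a0 a1; have rb := geom_bounded_rho a0; have eb := geom_bounded_euler a rb.
exists (kummerQ a 1 + 1) => x x1.
  pose F y := kummerQ a y - - a * expR (- y).
  have : F x <= F 1.
    have dF y : 1 <= y <= x -> is_derive y 1 F (y `^ (a - 1) * (expR (- y) *
        egf (fun k => (a + k%:R) * rho a k - k%:R * rho a k.-1) y) -
        (- a) * (- expR (- y))).
      move=> /andP[y1 _]; have y0 : 0 < y by rewrite (lt_le_trans ltr01).
      apply: is_derive_subf; first exact: is_derive_powR_expN_egf.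
      by apply: is_derive_scalef; exact: is_derive_expRN.
    apply: (is_derive_nincr x1 dF) => y /andP[y1 _].
    have y0 : 0 < y by rewrite (lt_le_trans ltr01).
    rewrite mulrNN subr_le0 mulrCA [leRHS]mulrC ler_wpM2l ?expR_ge0//.
    have ea : egf (fun k => (a + k%:R) * rho a k - k%:R * rho a k.-1) y <= a.
      have := @egf_le_first (fun k => (a + k%:R) * rho a k - k%:R * rho a k.-1) y eb (ltW y0).
      rewrite mul0r subr0 addr0 /rho pratio0 mulr1 -/(rho a); apply => k.
      rewrite rho_euler// mulr_ge0_le0 ?(ltW (rho_gt0 _ _))//.
      rewrite mulr_le0_ge0 ?mulr_ge0_le0 ?subr_le0 ?(ltW a0)//.
      by rewrite invr_ge0 addr_ge0// mulr_ge0// ltW.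
    have p1 : y `^ (a - 1) <= 1.
      by have := ler_powR y1 (_ : a - 1 <= 0); rewrite powRr0; apply; rewrite subr_le0.
    have p0 := powR_ge0 y (a - 1).
    apply: (@le_trans _ _ (y `^ (a - 1) * a)); first by rewrite ler_wpM2l.
    by rewrite -[leRHS]mul1r ler_wpM2r// ltW.
  rewrite /F !mulNr !opprK => h.
  have e0 : 0 <= a * expR (- x) by rewrite mulr_ge0 ?expR_ge0// ltW.
  have e1 : a * expR (- 1) <= 1.
    by rewrite -[leRHS]mulr1 ler_pM ?expR_ge0 ?(ltW a0).
  lra.
Qed.

End kummer_function.

(** * Modified Bessel functions and monotonicity in the order *)

Section modified_bessel.
Context {R : realType}.
Implicit Types (mu nu d x y z : R).

Lemma geom_bounded_even (h : nat -> R) : geom_bounded h ->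
  geom_bounded (fun j => if odd j then 0 else h j./2).
Proof.
move=> [A [M [A0 M0 hA]]]; exists A, (1 + M); split=> // [|j]; first by rewrite addr_ge0.
have M1 : 1 <= 1 + M by rewrite lerDl.
case: ifP => _; first by rewrite normr0 mulr_ge0// exprn_ge0// addr_ge0.
apply: (le_trans (hA _)); rewrite ler_wpM2l//.
apply: (@le_trans _ _ ((1 + M) ^+ j./2)).
  by rewrite lerXn2r ?nnegrE ?lerDr ?addr_ge0.
by rewrite ler_weXn2l// -[X in (_ <= X)%N]odd_double_half -addnn addnA leq_addl.
Qed.

(** Since (2p)! = 4^p p! (1/2)_p, the exponential generating function at z is the sum of (z/2)^(2p)
    / (p! (nu+1)_p), that is, Gamma (nu + 1) (z/2)^(-nu) I_nu(z) for z > 0. *)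
Definition bessel_coef nu j : R := if odd j then 0 else pratio (1 / 2) (nu + 1) j./2.

Lemma bessel_coef_even nu p : bessel_coef nu p.*2 = pratio (1 / 2) (nu + 1) p.
Proof. by rewrite /bessel_coef odd_double doubleK. Qed.

Lemma bessel_coef_odd nu p : bessel_coef nu p.*2.+1 = 0.
Proof. by rewrite /bessel_coef /= odd_double. Qed.

Lemma even_or_odd (j : nat) : (exists p, j = p.*2) \/ (exists p, j = p.*2.+1).
Proof.
case: (boolP (odd j)) => h; [right|left]; exists j./2.
  by rewrite -[LHS]odd_double_half h.
by rewrite -[LHS]odd_double_half (negbTE h).
Qed.

Lemma geom_bounded_bessel nu : -1 < nu -> geom_bounded (bessel_coef nu).
Proof.
by move=> nu1; apply: geom_bounded_even; apply: geom_bounded_pratio; lra.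
Qed.

Lemma bessel_coef_ge0 nu j : -1 < nu -> 0 <= bessel_coef nu j.
Proof.
move=> nu1; rewrite /bessel_coef; case: ifP => // _.
by apply/ltW/pratio_gt0; lra.
Qed.

(** Coefficients of the derivative formula that raises the order of I_nu. *)
Lemma bessel_coef_next nu j : -1 < nu ->
  bessel_coef nu j.+1 = (2 * (nu + 1))^-1 * (j%:R * bessel_coef (nu + 1) j.-1).
Proof.
move=> nu1; have [[p ->]|[p ->]] := even_or_odd j.
  rewrite bessel_coef_odd; case: p => [|p]; first by rewrite mul0r mulr0.
  by rewrite doubleS/= bessel_coef_odd !mulr0.
rewrite -doubleS bessel_coef_even/= bessel_coef_even pratioS (@pratio_shift _ _ (nu + 1)); last by lra.
rewrite -[p.*2.+1%:R]natr1 -muln2 natrM.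
have p0 : 0 <= p%:R :> R by [].
by field; pos_neq0.
Qed.

(** Coefficients of the three-term recurrence of I_nu, with two multiplications by z in the last
    summand. *)
Lemma bessel_coef_rec nu k : -1 < nu -> bessel_coef nu k = bessel_coef (nu + 1) k +
  (4 * (nu + 1) * (nu + 2))^-1 * (k%:R * (k.-1%:R * bessel_coef (nu + 2) k.-1.-1)).
Proof.
move=> nu1; have [[p ->]|[p ->]] := even_or_odd k; last first.
  rewrite !bessel_coef_odd add0r /=; case: p => [|p]; first by rewrite mul0r !mulr0.
  by rewrite doubleS/= bessel_coef_odd !mulr0.
rewrite !bessel_coef_even; case: p => [|p].
  by rewrite !pratio0 mul0r mulr0 addr0.
rewrite doubleS/= bessel_coef_even.
have -> : nu + 2 + 1 = (nu + 1 + 1) + 1 by ring.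
rewrite (@pratio_shift _ _ (nu + 1 + 1) p); last by lra.
rewrite (@pratio_shift _ _ (nu + 1) p.+1); last by lra.
rewrite (@pratio_shift _ _ (nu + 1) p); last by lra.
rewrite pratioS -[p.*2.+2%:R]natr1 -[p.*2.+1%:R]natr1 -[p.+1%:R]natr1 -muln2 natrM.
have p0 : 0 <= p%:R :> R by [].
by field; pos_neq0.
Qed.

Lemma bessel_binomial_transform nu k : - (1 / 2) < nu ->
  binomial_conv (bessel_coef nu) (fun=> 1) k = 2 ^+ k * rho (nu + 1 / 2) k.
Proof.
move=> h.
(* The case k + 1 at nu uses k at nu and k - 1 at nu + 1, so two consecutive cases are carried
   along, for all nu. *)
suff : binomial_conv (bessel_coef nu) (fun=> 1) k = 2 ^+ k * rho (nu + 1 / 2) k /\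
  binomial_conv (bessel_coef nu) (fun=> 1) k.+1 = 2 ^+ k.+1 * rho (nu + 1 / 2) k.+1 by case.
have step m nu' : - (1 / 2) < nu' ->
  binomial_conv (bessel_coef nu') (fun=> 1) m = 2 ^+ m * rho (nu' + 1 / 2) m ->
  m%:R * binomial_conv (bessel_coef (nu' + 1)) (fun=> 1) m.-1 =
    m%:R * (2 ^+ m.-1 * rho (nu' + 1 / 2 + 1) m.-1) ->
  binomial_conv (bessel_coef nu') (fun=> 1) m.+1 = 2 ^+ m.+1 * rho (nu' + 1 / 2) m.+1.
  move=> h' e1 e2; rewrite binomial_convS e1.
  have -> : binomial_conv (fun i => bessel_coef nu' i.+1) (fun=> 1) m =
      (2 * (nu' + 1))^-1 * (m%:R * binomial_conv (bessel_coef (nu' + 1)) (fun=> 1) m.-1).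
    rewrite -binomial_conv_mulX /binomial_conv mulr_sumr; apply: eq_bigr => i _.
    by rewrite bessel_coef_next; [ring|lra].
  rewrite e2.
  have a0 : 0 < nu' + 1 / 2 by lra.
  have := rho_next m a0; set a := nu' + 1 / 2 in a0 * => e3.
  have -> : (2 * (nu' + 1))^-1 * (m%:R * (2 ^+ m.-1 * rho (a + 1) m.-1)) =
      2 ^+ m * (m%:R * rho (a + 1) m.-1 / (4 * a + 2)).
    case: (m) => [|n]; first by rewrite !mul0r !mulr0.
    by rewrite exprS/= /a; field; pos_neq0.
  have -> : rho a m.+1 = rho a m * ((a + m%:R) / (2 * a + m%:R)) by rewrite /rho pratioS.
  rewrite e3 exprS.
  have m0 : 0 <= m%:R :> R by [].
  by field; pos_neq0.
have b0 nu' : binomial_conv (bessel_coef nu') (fun=> 1) 0 = 2 ^+ 0 * rho (nu' + 1 / 2) 0.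
  by rewrite /binomial_conv big_ord1 /bessel_coef/= /rho !pratio0 bin0 expr0 !mulr1.
elim: k nu h => [|k IH] nu h.
  split; first exact: b0.
  by apply: step => //; rewrite !mul0r.
have [IH1 IH2] := IH nu h; split=> //; apply: step => //=.
have h1 : - (1 / 2) < nu + 1 by lra.
by rewrite (IH _ h1).1; congr (_ * (_ * rho _ _)); ring.
Qed.

Lemma kummer_second nu z : - (1 / 2) < nu ->
  egf (rho (nu + 1 / 2)) (2 * z) = expR z * egf (bessel_coef nu) z.
Proof.
move=> h; rewrite egf_scale -egf_exp [RHS]mulrC egf_mul; last 2 first.
- by apply: geom_bounded_bessel; lra.
- exact: geom_bounded_cst.
by congr (egf _ z); apply/funext => k; rewrite bessel_binomial_transform.
Qed.

(* This is I_nu(2 y). *)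
Definition besselI2 nu y := y `^ nu / Gamma (nu + 1) * egf (bessel_coef nu) (2 * y).

Lemma besselI2_gt0 nu y : -1 < nu -> 0 < y -> 0 < besselI2 nu y.
Proof.
move=> nu1 y0; rewrite mulr_gt0//.
  by rewrite divr_gt0 ?powR_gt0// Gamma_gt0//; lra.
apply: egf_gt0; [exact: geom_bounded_bessel|lra|by move=> j; exact: bessel_coef_ge0|].
by rewrite /bessel_coef/= pratio0.
Qed.

Lemma is_derive_egf2 (h : nat -> R) y : geom_bounded h ->
  is_derive y 1 (fun y => egf h (2 * y)) (2 * egf (fun k => h k.+1) (2 * y)).
Proof.
move=> hb; have d2 : is_derive y 1 (fun y : R => 2 * y) (2 * 1).
  by apply: is_derive_scalef.
have := is_derive1_comp (is_derive_egf (2 * y) hb) d2.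
by rewrite mulr1 mulrC.
Qed.

Lemma is_derive_besselI2 nu y : -1 < nu -> 0 < y ->
  is_derive y 1 (besselI2 nu) (nu / y * besselI2 nu y + 2 * besselI2 (nu + 1) y).
Proof.
move=> nu1 y0; have gb := geom_bounded_bessel nu1.
have nu2 : -1 < nu + 1 by lra.
have gb1 := geom_bounded_bessel nu2.
have := is_derive_scalef (Gamma (nu + 1))^-1
  (is_derive_mulf (powR_is_derive nu y0) (is_derive_egf2 y gb)).
congr is_derive; first by apply/funext => x; rewrite /besselI2; ring.
have e : egf (fun k => bessel_coef nu k.+1) (2 * y) =
    (2 * (nu + 1))^-1 * (2 * y * egf (bessel_coef (nu + 1)) (2 * y)).
  rewrite -egf_mulX// -egfZ; last exact: geom_bounded_pred.
  by congr (egf _ _); apply/funext => k; exact: bessel_coef_next.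
rewrite e /besselI2 (@GammaS _ (nu + 1)); last by lra.
have G0 : Gamma (nu + 1) != 0 by rewrite gt_eqF// Gamma_gt0//; lra.
rewrite -(powR_mulr1 nu y0).
have -> : y `^ nu = y `^ (nu - 1) * y by rewrite powR_mulr1// subrK.
have y0' : y != 0 by rewrite gt_eqF.
have n0 : nu + 1 != 0 by apply: lt0r_neq0; lra.
by field; rewrite ?G0 ?y0' ?n0.
Qed.

Lemma besselI2_rec nu y : -1 < nu -> 0 < y ->
  besselI2 nu y = besselI2 (nu + 2) y + (nu + 1) / y * besselI2 (nu + 1) y.
Proof.
move=> nu1 y0; have nu2 : -1 < nu + 1 by lra.
have nu3 : -1 < nu + 2 by lra.
have gb1 := geom_bounded_bessel nu2; have gb2 := geom_bounded_bessel nu3.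
have e : egf (bessel_coef nu) (2 * y) = egf (bessel_coef (nu + 1)) (2 * y) +
   (4 * (nu + 1) * (nu + 2))^-1 * (2 * y * (2 * y * egf (bessel_coef (nu + 2)) (2 * y))).
  have gp := geom_bounded_pred gb2.
  rewrite -(egf_mulX _ gb2) -(egf_mulX _ gp).
  have gpp := geom_bounded_pred gp.
  rewrite -(egfZ _ _ gpp) -(egfD _ gb1 (geom_boundedZ _ gpp)).
  by congr (egf _ _); apply/funext => k; exact: bessel_coef_rec.
rewrite /besselI2 e.
have -> : nu + 2 + 1 = (nu + 1 + 1) + 1 by ring.
have -> : nu + 2 = (nu + 1) + 1 by ring.
have p1 : 0 < nu + 1 by lra.
have p2 : 0 < nu + 1 + 1 by lra.
rewrite (GammaS p2) (GammaS p1) -!powR_mulr1//.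
have G0 : Gamma (nu + 1) != 0 by rewrite gt_eqF// Gamma_gt0.
have y0' : y != 0 by rewrite gt_eqF.
have n1 := lt0r_neq0 p1; have n2 := lt0r_neq0 p2.
by field; rewrite ?G0 ?y0' ?n1 ?n2.
Qed.

(** The derivative formula that lowers the order. Used at nu + 1 beside the raising one at nu, it
    keeps the derivative of [bessel_wronskian] free of the order nu + 2. *)
Lemma is_derive_besselI2_next nu y : -1 < nu -> 0 < y ->
  is_derive y 1 (besselI2 (nu + 1)) (2 * besselI2 nu y - (nu + 1) / y * besselI2 (nu + 1) y).
Proof.
move=> nu1 y0; have nu2 : -1 < nu + 1 by lra.
have := is_derive_besselI2 nu2 y0; congr is_derive.
rewrite (besselI2_rec nu1 y0) (_ : nu + 1 + 1 = nu + 2); last by ring.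
ring.
Qed.

Definition weberQ nu x := 4 `^ (- nu) / Gamma (nu + 1) * kummerQ (nu + 1 / 2) x.

(** The prefactor does not depend on nu, so monotonicity of the transform in the order is
    monotonicity of I_nu at a fixed argument. *)
Lemma weberQ_besselI2 nu y : - (1 / 2) < nu -> 0 < y ->
  weberQ nu (4 * y) = (4 * y) `^ (1 / 2) * expR (- (2 * y)) * besselI2 nu y.
Proof.
move=> h y0; rewrite /weberQ /kummerQ /besselI2.
have -> : egf (rho (nu + 1 / 2)) (4 * y) =
    expR (2 * y) * egf (bessel_coef nu) (2 * y).
  by rewrite -kummer_second//; congr egf; ring.
have -> : expR (- (4 * y)) = expR (- (2 * y)) * expR (- (2 * y)).
  by rewrite -expRD; congr expR; ring.
have -> : (4 * y) `^ (nu + 1 / 2) = 4 `^ nu * y `^ nu * (4 * y) `^ (1 / 2).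
  rewrite -powRM ?(ltW y0)// -powRD//.
  by rewrite (_ : (4 * y == 0) = false) ?implybT// gt_eqF// mulr_gt0.
have e1 : expR (- (2 * y)) * expR (2 * y) = 1 by rewrite -expRD addrC subrr expR0.
have e2 : 4 `^ (- nu) * 4 `^ nu = 1 :> R.
  by rewrite -powRD ?addNr ?powRr0//; apply/implyP => _; rewrite pnatr_eq0.
transitivity (4 `^ (- nu) * 4 `^ nu * (expR (- (2 * y)) * expR (2 * y)) *
  ((4 * y) `^ (1 / 2) * expR (- (2 * y)) * (y `^ nu / Gamma (nu + 1) *
   egf (bessel_coef nu) (2 * y)))); first by ring.
by rewrite e1 e2 !mul1r.
Qed.

Lemma weberQ_next nu x : - (1 / 2) < nu -> weberQ (nu + 1) x =
  4 `^ (- nu) / Gamma (nu + 1) * (kummerQ (nu + 1 / 2 + 1) x / (4 * (nu + 1 / 2) + 2)).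
Proof.
move=> h; rewrite /weberQ GammaS; last by lra.
have -> : nu + 1 + 1 / 2 = nu + 1 / 2 + 1 by ring.
have -> : 4 `^ (- (nu + 1)) = 4 `^ (- nu) / 4 :> R.
  have := @powR_mulr1 R 4 (- (nu + 1)) ltac:(lra).
  have -> : - (nu + 1) + 1 = - nu by ring.
  by move=> <-; rewrite mulfK// pnatr_eq0.
have G0 : Gamma (nu + 1) != 0 by rewrite gt_eqF// Gamma_gt0//; lra.
by field; rewrite G0/=; pos_neq0.
Qed.

Lemma weber_const_gt0 nu : - (1 / 2) < nu -> 0 < 4 `^ (- nu) / Gamma (nu + 1).
Proof. by move=> h; rewrite divr_gt0 ?powR_gt0// Gamma_gt0//; lra. Qed.

Lemma weberQ_next_lt nu x : - (1 / 2) < nu -> 0 < x -> weberQ (nu + 1) x < weberQ nu x.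
Proof.
move=> h x0; rewrite weberQ_next// /weberQ ltr_pM2l ?weber_const_gt0//.
by rewrite kummerQ_next_lt//; lra.
Qed.

Lemma besselI2_next_lt nu y : - (1 / 2) < nu -> 0 < y -> besselI2 (nu + 1) y < besselI2 nu y.
Proof.
move=> h y0; have y4 : 0 < 4 * y by rewrite mulr_gt0.
have := weberQ_next_lt h y4; rewrite !weberQ_besselI2//; last by lra.
by rewrite ltr_pM2l// mulr_gt0 ?expR_gt0// powR_gt0.
Qed.

Lemma powR_weighted_mean (u w d : R) : 0 <= u -> 0 < w -> 0 < d < 1 ->
  u `^ d * w `^ (1 - d) <= (1 - d) * w + d * u.
Proof.
move=> u0 w0 d01; have := powR_young (divr_ge0 u0 (ltW w0)) d01.
rewrite powRM ?invr_ge0 ?(ltW w0)//.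
have -> : w^-1 `^ d = (w `^ d)^-1 by rewrite -powRN -(powR_inv1 (ltW w0)) -powRrM mulN1r.
have -> : w `^ (1 - d) = w / w `^ d.
  by rewrite powRB ?powRr1 ?(ltW w0)// (gt_eqF w0) implybT.
move=> /(ler_wpM2r (ltW w0)).
rewrite [leRHS](_ : _ = (1 - d) * w + d * u); last by field; rewrite gt_eqF.
by apply: le_trans; rewrite mulrAC mulrA.
Qed.

Lemma egf_comb_le (A B C : R) (f g h : nat -> R) x : geom_bounded f ->
  geom_bounded g -> geom_bounded h -> 0 <= x ->
  (forall k, C * h k <= A * f k + B * g k) ->
  C * egf h x <= A * egf f x + B * egf g x.
Proof.
move=> fb gb hb x0 H.
rewrite -(egfZ C _ hb) -(egfZ A _ fb) -(egfZ B _ gb).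
rewrite -(egfD _ (geom_boundedZ A fb) (geom_boundedZ B gb)).
apply: egf_le => //; first exact: geom_boundedZ.
by apply: geom_boundedD; exact: geom_boundedZ.
Qed.

Lemma comb_le_eq (A B C f g h a b c : R) : C * h = c -> A * f = a -> B * g = b ->
  c <= a + b -> C * h <= A * f + B * g.
Proof. by move=> -> -> ->. Qed.

(** One coefficient of [besselI2_interpolation], with Y = y^mu, yd = y^d, z = mu + 1 + m, w = (z +
    d)^(1-d), P = (1/2)_m, G = Gamma z and Gd = Gamma (z + d). The last two hypotheses are Wendel's
    inequality and the weighted mean inequality. *)
Lemma interpolation_ineq (Y yd w P G Gd z d y : R) : 0 <= Y -> 0 <= yd -> 0 < P ->
  0 < G -> 0 < Gd -> 0 < z -> 0 < y ->
  z * G <= w * Gd -> yd * w <= (1 - d) * (z + d) + d * y ->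
  Y * yd * P / Gd <=
    (1 - d) * Y * P / G + (d + d * (1 - d) / y) * (Y * y) * P / (z * G).
Proof.
move=> Y0 yd0 P0 G0 Gd0 z0 y0 W M.
rewrite [leRHS](_ : _ = Y * P / (z * G) * ((1 - d) * (z + d) + d * y)); last first.
  by field; rewrite !gt_eqF.
have zG := mulr_ge0 (ltW z0) (ltW G0).
have c0 : 0 <= Y * P / (z * G) := divr_ge0 (mulr_ge0 Y0 (ltW P0)) zG.
apply: (le_trans _ (ler_wpM2l c0 M)).
have c1 : 0 <= Y * P * yd / (z * G) / Gd :=
  divr_ge0 (divr_ge0 (mulr_ge0 (mulr_ge0 Y0 (ltW P0)) yd0) zG) (ltW Gd0).
have := ler_wpM2l c1 W.
rewrite [leLHS](_ : _ = Y * yd * P / Gd); last by field; rewrite !gt_eqF.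
rewrite [leRHS](_ : _ = Y * P / (z * G) * (yd * w))//.
by field; rewrite !gt_eqF.
Qed.

(* Wendel's inequality and the weighted mean inequality, term by term. *)
Lemma besselI2_interpolation mu d y : -1 < mu -> 0 < d < 1 -> 0 < y ->
  besselI2 (mu + d) y <= (1 - d) * besselI2 mu y +
    (d + d * (1 - d) / y) * besselI2 (mu + 1) y.
Proof.
move=> mu1 d01 y0; have /andP[d0 d1] := d01.
have n2 : -1 < mu + 1 by lra.
have n3 : -1 < mu + d by lra.
rewrite /besselI2 !mulrA; apply: egf_comb_le.
- exact: geom_bounded_bessel.
- exact: geom_bounded_bessel.
- exact: geom_bounded_bessel.
- by rewrite mulr_ge0// ltW.
move=> k; have [[m ->]|[m ->]] := even_or_odd k; last first.
  have z0 (c : R) nu : c * bessel_coef nu m.*2.+1 = 0 by rewrite bessel_coef_odd mulr0.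
  apply: (comb_le_eq (z0 _ _) (z0 _ _) (z0 _ _)).
  by rewrite addr0.
have Gp (x : R) : 0 < x -> Gamma (x + m%:R) = Gamma x * poch x m.
  move=> x0; elim: (m) => [|n IH]; first by rewrite addr0 poch0 mulr1.
  rewrite pochS -natr1 addrA GammaS ?ltr_wpDr// IH; ring.
have E nu (c c' g : R) : 0 < nu + 1 -> c = c' -> Gamma (nu + 1 + m%:R) = g ->
    c / Gamma (nu + 1) * bessel_coef nu m.*2 = c' * poch (1 / 2) m / g.
  move=> x0 -> <-; rewrite bessel_coef_even Gp// /pratio; field.
  by rewrite (gt_eqF (Gamma_gt0 x0)) (gt_eqF (poch_gt0 m x0)).
have m0 : 0 <= m%:R :> R by [].
have e1 : 0 < mu + 1 by lra.
have e2 : 0 < mu + 1 + 1 by lra.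
have e3 : 0 < mu + d + 1 by lra.
have [z ze] : exists z, z = mu + 1 + m%:R by exists (mu + 1 + m%:R).
have z0 : 0 < z by rewrite ze ltr_wpDr.
have zd0 : 0 < z + d by rewrite addr_gt0.
have g1 : Gamma (mu + 1 + m%:R) = Gamma z by rewrite ze.
have g2 : Gamma (mu + 1 + 1 + m%:R) = z * Gamma z.
  by rewrite -(GammaS z0) ze; congr Gamma; ring.
have g3 : Gamma (mu + d + 1 + m%:R) = Gamma (z + d) by rewrite ze; congr Gamma; ring.
have c3 : y `^ (mu + d) = y `^ mu * y `^ d by rewrite powRD// (gt_eqF y0) implybT.
have c2 : (d + d * (1 - d) / y) * y `^ (mu + 1) = (d + d * (1 - d) / y) * (y `^ mu * y).
  by rewrite powR_mulr1.
apply: (comb_le_eq (E _ _ _ _ e3 c3 g3) (E _ _ _ _ e1 erefl g1) (E _ _ _ _ e2 c2 g2)).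
have W : z * Gamma z <= (z + d) `^ (1 - d) * Gamma (z + d).
  have d1' : 0 < 1 - d < 1 by rewrite subr_gt0 d1 gtrBl.
  rewrite -(GammaS z0); apply: le_trans (Gamma_wendel zd0 d1').
  by rewrite le_eqVlt; apply/orP; left; apply/eqP; congr Gamma; ring.
have P0 : 0 < poch (1 / 2 : R) m by rewrite poch_gt0// divr_gt0.
apply: (interpolation_ineq (powR_ge0 _ _) (powR_ge0 _ _) P0 (Gamma_gt0 z0)
  (Gamma_gt0 zd0) z0 y0 W).
exact: powR_weighted_mean (ltW y0) zd0 d01.
Qed.

(** This is y times the Wronskian of I_mu(2 y) and I_nu(2 y), with the derivatives eliminated; its
    sign is that of the derivative of I_nu / I_mu. *)
Definition bessel_wronskian mu nu y :=
  (nu - mu) * (besselI2 mu y * besselI2 nu y) +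
  2 * (y * (besselI2 mu y * besselI2 (nu + 1) y - besselI2 nu y * besselI2 (mu + 1) y)).

Lemma is_derive_wronskian mu nu y : -1 < mu -> -1 < nu -> 0 < y ->
  is_derive y 1 (bessel_wronskian mu nu)
    ((nu ^+ 2 - mu ^+ 2) / y * (besselI2 mu y * besselI2 nu y)).
Proof.
move=> mu1 nu1 y0.
have dm := is_derive_besselI2 mu1 y0; have dn := is_derive_besselI2 nu1 y0.
have dm1 := is_derive_besselI2_next mu1 y0; have dn1 := is_derive_besselI2_next nu1 y0.
have := is_derive_addf (is_derive_scalef (nu - mu) (is_derive_mulf dm dn))
  (is_derive_scalef 2 (is_derive_mulf (is_derive_id y 1)
    (is_derive_subf (is_derive_mulf dm dn1) (is_derive_mulf dn dm1)))).
by congr is_derive; field; rewrite gt_eqF.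
Qed.

(** Once y^(mu + nu), which may blow up at 0, is factored out, a continuous function v remains with
    v(0) = (nu - mu) / (Gamma (mu + 1) Gamma (nu + 1)) > 0. *)
Lemma wronskian_gt0_near0 mu nu : -1 < mu -> mu < nu ->
  exists2 y1, 0 < y1 & forall y, 0 < y -> y <= y1 -> 0 < bessel_wronskian mu nu y.
Proof.
move=> mu1 munu; have nu1 : -1 < nu by lra.
pose A nu y := egf (bessel_coef nu) (2 * y) / Gamma (nu + 1).
pose v y := (nu - mu) * (A mu y * A nu y) +
  2 * (y * (y * (A mu y * A (nu + 1) y - A nu y * A (mu + 1) y))).
have cA nu' : -1 < nu' -> {for 0, continuous (A nu')}.
  move=> h; apply: cvgM; last exact: cvg_cst.
  have /is_derive_continuous := @is_derive_egf2 _ 0 (geom_bounded_bessel h).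
  by [].
have cv : {for 0, continuous v}.
  have c0 : {for 0, continuous (fun y : R => y)} by exact: cvg_id.
  apply: cvgD; apply: cvgM; [exact: cvg_cst|by apply: cvgM; exact: cA|exact: cvg_cst|].
  apply: cvgM => //; apply: cvgM => //; apply: cvgB.
    by apply: cvgM; apply: cA; lra.
  by apply: cvgM; apply: cA; lra.
have v0 : 0 < v 0.
  rewrite /v !mul0r mulr0 addr0 mulr_gt0 ?subr_gt0// /A mulr0 !egf0.
  rewrite /bessel_coef/= !pratio0 !mul1r mulr_gt0// invr_gt0 Gamma_gt0//; lra.
have : \forall y \near (0 : R), 0 < v y by exact: cvgr_gt cv _ v0.
move=> /nbhs_ballP[e /= e0 He].
exists (e / 2); first by rewrite divr_gt0.
move=> y y0 ye.
have vy : 0 < v y.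
  by apply: He; rewrite /ball/= sub0r normrN gtr0_norm//; lra.
have -> : bessel_wronskian mu nu y = y `^ mu * y `^ nu * v y.
  have I1 nu' : besselI2 nu' y = y `^ nu' * A nu' y by rewrite /besselI2 /A mulrAC mulrA.
  have I2 nu' : besselI2 (nu' + 1) y = y `^ nu' * (y * A (nu' + 1) y).
    by rewrite I1 -powR_mulr1// -mulrA.
  rewrite /bessel_wronskian /v (I1 mu) (I1 nu) (I2 mu) (I2 nu).
  move: (A mu y) (A nu y) (A (mu + 1) y) (A (nu + 1) y) (y `^ mu) (y `^ nu).
  by move=> *; ring.
by rewrite mulr_gt0// mulr_gt0 ?powR_gt0.
Qed.

(** Positivity near 0 propagates to the right because the derivative has the sign of nu^2 - mu^2;
    here mu + nu >= 0 is used, with equality allowed. *)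
Lemma wronskian_gt0 mu nu y : -1 < mu -> mu < nu -> 0 <= mu + nu -> 0 < y ->
  0 < bessel_wronskian mu nu y.
Proof.
move=> mu1 munu s0 y0; have nu1 : -1 < nu by lra.
have [y1 y10 H] := wronskian_gt0_near0 mu1 munu.
have [|/ltW y1y] := leP y y1; first exact: H.
apply: (lt_le_trans (H y1 y10 (lexx _))).
apply: (is_derive_ndecr y1y (fun z (zI : y1 <= z <= y) =>
  is_derive_wronskian mu1 nu1 (lt_le_trans y10 (proj1 (andP zI))))).
move=> z /andP[y1z _]; have z0 := lt_le_trans y10 y1z.
rewrite mulr_ge0//; last by rewrite mulr_ge0// ltW// besselI2_gt0.
apply: divr_ge0 (ltW z0); rewrite subr_sqr; apply: mulr_ge0.
  by rewrite subr_ge0 ltW.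
by rewrite addrC.
Qed.

Lemma besselI2_ratio_incr mu nu x y : -1 < mu -> mu < nu -> 0 <= mu + nu ->
  0 < x -> x < y ->
  besselI2 nu x / besselI2 mu x < besselI2 nu y / besselI2 mu y.
Proof.
move=> mu1 munu s0 x0 xy; have nu1 : -1 < nu by lra.
have d z (zI : x <= z <= y) : is_derive z 1 (fun z => besselI2 nu z * (besselI2 mu z)^-1)
    (bessel_wronskian mu nu z / (z * besselI2 mu z ^+ 2)).
  have z0 : 0 < z by case/andP: zI => xz _; exact: lt_le_trans xz.
  have I0 : besselI2 mu z != 0 by rewrite gt_eqF// besselI2_gt0.
  have dV := @is_deriveV _ _ z _ 1 I0 (is_derive_besselI2 mu1 z0).
  have := is_derive_mulf (is_derive_besselI2 nu1 z0) dV.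
  congr is_derive; rewrite /bessel_wronskian /GRing.scale/=; field.
  by rewrite I0 gt_eqF.
apply: (is_derive_incr xy d) => z /andP[xz _]; have z0 := lt_le_trans x0 xz.
by rewrite divr_gt0 ?wronskian_gt0// mulr_gt0// exprn_gt0// besselI2_gt0.
Qed.

(** If the increasing ratio of I_(mu+d) to I_mu reached 1 at y, it would exceed some q > 1 from y +
    1 on. Interpolation and I_(mu+1) < I_mu bound it at z by 1 + d (1 - d) / z, which is a
    contradiction for large z. *)
Lemma besselI2_lt_near mu d y : - (1 / 2) < mu -> 0 < d < 1 -> 0 <= mu + (mu + d) ->
  0 < y -> besselI2 (mu + d) y < besselI2 mu y.
Proof.
move=> h d01 s0 y0; have /andP[d0 d1] := d01; have mu1 : -1 < mu by lra.
have I0 z : 0 < z -> 0 < besselI2 mu z by exact: besselI2_gt0.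
rewrite -[ltRHS]mul1r -ltr_pdivrMr ?I0// ltNge; apply/negP => ge1.
have munu : mu < mu + d by lra.
have y1 : y < y + 1 by lra.
have := besselI2_ratio_incr mu1 munu s0 y0 y1.
move=> /(le_lt_trans ge1); set q := (X in 1 < X) => q1.
(* Large enough that d (1 - d) / z is at most (q - 1) / 2. *)
pose z := Num.max (y + 2) (2 * (d * (1 - d)) / (q - 1)).
have yz : y + 1 < z by rewrite /z lt_max; apply/orP; left; lra.
have z0 : 0 < z by lra.
have y10 : 0 < y + 1 by lra.
have := besselI2_ratio_incr mu1 munu s0 y10 yz; rewrite -/q.
rewrite ltr_pdivlMr ?I0// => lt1.
have := besselI2_interpolation mu1 d01 z0 => le2.
have le3 := ltW (besselI2_next_lt h z0).
have c0 : 0 < d * (1 - d) by rewrite mulr_gt0// subr_gt0.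
have cz : d * (1 - d) / z <= (q - 1) / 2.
  have : 2 * (d * (1 - d)) / (q - 1) <= z by rewrite /z le_max lexx orbT.
  have q0 : 0 < q - 1 by rewrite subr_gt0.
  rewrite ler_pdivrMr// ler_pdivrMr// => hz.
  by move: hz; move: (d * (1 - d)) z0 q0 => e; clear; nra.
have e0 : 0 <= d * (1 - d) / z := divr_ge0 (ltW c0) (ltW z0).
have cz0 : 0 <= d + d * (1 - d) / z := addr_ge0 (ltW d0) e0.
have le4 := ler_wpM2l cz0 le3.
have le5 := ler_wpM2r (ltW (I0 z z0)) cz.
have le6 : 0 < (q - 1) * besselI2 mu z by rewrite mulr_gt0 ?subr_gt0// I0.
move: lt1 le2 le4 le5 le6; clear.
move: (besselI2 (mu + d) z) (besselI2 mu z) (besselI2 (mu + 1) z) (d * (1 - d) / z).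
by move=> a b c e; clear; lra.
Qed.

Lemma weberQ_lt_near mu d x : - (1 / 2) < mu -> 0 < d < 1 -> 0 <= mu + (mu + d) ->
  0 < x -> weberQ (mu + d) x < weberQ mu x.
Proof.
move=> h d01 s0 x0; have /andP[d0 d1] := d01.
have -> : x = 4 * (x / 4) by field.
have y0 : 0 < x / 4 by lra.
rewrite !weberQ_besselI2//; last by lra.
rewrite ltr_pM2l ?besselI2_lt_near// mulr_gt0 ?expR_gt0// powR_gt0//; lra.
Qed.

(** Unit steps by [weberQ_next_lt] bring nu within distance 1 of mu, where [weberQ_lt_near]
    applies. *)
Lemma weberQ_lt mu nu x : 0 <= mu -> mu < nu -> 0 < x -> weberQ nu x < weberQ mu x.
Proof.
move=> mu0 munu x0.
have [n nun] : exists n : nat, nu <= mu + n.+1%:R.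
  exists (Num.bound nu); have nu0 : 0 <= nu by lra.
  by have := archi_boundP nu0; rewrite -natr1; lra.
elim: n nu munu nun => [|n IH] nu munu nun.
  have [->|ne] := eqVneq nu (mu + 1); first by apply: weberQ_next_lt => //; lra.
  have nu1 : nu < mu + 1 by rewrite lt_neqAle ne.
  have -> : nu = mu + (nu - mu) by ring.
  by apply: weberQ_lt_near => //; lra.
have [|nu1] := leP nu (mu + n.+1%:R); first exact: IH.
have n1 : 1 <= n.+1%:R :> R by rewrite ler1n.
have := @weberQ_next_lt (nu - 1) x; rewrite subrK => /(_ _ x0) h.
apply: lt_trans (h _) _; first by lra.
apply: IH; first lra.
by move: nun; rewrite -[n.+2%:R]natr1; lra.
Qed.

(** Near 0 the factor x^(nu + 1/2) governs. Boundedness for x >= 1 is known for nu <= 1/2 from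
    [kummerQ_bounded] and is carried to larger nu by [weberQ_next_lt]. *)
Lemma weberQ_bounded nu : - (1 / 2) < nu -> exists2 C, 0 <= C &
  forall x, 0 < x -> weberQ nu x <= C * Num.min (x `^ (nu + 1 / 2)) 1.
Proof.
move=> h; have a0 : 0 < nu + 1 / 2 by lra.
have c0 nu' : - (1 / 2) < nu' -> 0 <= 4 `^ (- nu') / Gamma (nu' + 1).
  by move=> h'; exact/ltW/weber_const_gt0.
have [D HD] : exists D, forall x, 1 <= x -> weberQ nu x <= D.
  have [n nun] : exists n : nat, nu <= 1 / 2 + n%:R.
    exists (Num.bound (nu + 1)); have nu0 : 0 <= nu + 1 by lra.
    by have := archi_boundP nu0; lra.
  elim: n nu h nun {a0} => [|n IH] nu h nun.
    have a1 : 0 < nu + 1 / 2 by lra.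
    have a2 : nu + 1 / 2 <= 1 by lra.
    have [C HC] := kummerQ_bounded a1 a2.
    exists (4 `^ (- nu) / Gamma (nu + 1) * C) => x x1.
    by rewrite /weberQ; apply: ler_wpM2l; [exact: c0|exact: HC].
  have [nu1|nu1] := leP nu (1 / 2 + n%:R); first exact: IH.
  have n0 : 0 <= n%:R :> R by [].
  have h1 : - (1 / 2) < nu - 1 by lra.
  have h2 : nu - 1 <= 1 / 2 + n%:R by move: nun; rewrite -natr1; lra.
  have [D HD] := IH _ h1 h2; exists D => x x1; apply: le_trans (HD x x1).
  have := @weberQ_next_lt (nu - 1) x h1; rewrite subrK => w.
  by apply/ltW/w; exact: lt_le_trans x1.
have [K K0 HK] := kummerQ_small a0.
pose E := 4 `^ (- nu) / Gamma (nu + 1) * K.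
have E0 : 0 <= E by rewrite mulr_ge0 ?c0.
have one : (1 : R) `^ (nu + 1 / 2) = 1 by rewrite powR1.
exists (`|D| + E); first by rewrite addr_ge0.
move=> x x0; have [x1|/ltW x1] := leP x 1.
  have xa1 : x `^ (nu + 1 / 2) <= 1.
    by rewrite -[leRHS]one; apply: ge0_ler_powR; rewrite ?nnegrE// ltW.
  rewrite min_l//; apply: (@le_trans _ _ (E * x `^ (nu + 1 / 2))).
    by rewrite /weberQ /E -[leRHS]mulrA; apply: ler_wpM2l; [exact: c0|exact: HK].
  by apply: ler_wpM2r; [exact: powR_ge0|rewrite lerDr].
have xa1 : 1 <= x `^ (nu + 1 / 2).
  by rewrite -[leLHS]one; apply: ge0_ler_powR; rewrite ?nnegrE// ltW.
rewrite min_r// mulr1; apply: (le_trans (HD x x1)).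
by apply: (le_trans (ler_norm D)); rewrite lerDl.
Qed.

End modified_bessel.

(** * Termwise integration of signed series *)

Section signed_series.
Context {R : realType}.
Notation mu := (@lebesgue_measure R).
Notation pos := (`]0%R, +oo[%classic : set R).

Lemma posint_integrable (f : R -> R) : measurable_fun pos f ->
  (forall t : R, 0 < t -> 0 <= f t) -> (posint f < +oo)%E ->
  mu.-integrable pos (EFin \o f).
Proof.
move=> mf f0 fi; apply/integrableP; split; first exact/measurable_EFinP.
suff -> : (\int[mu]_(x in pos) `|(EFin \o f) x| = posint f)%E by [].
apply: eq_integral => x; rewrite inE posP => x0 /=.
by rewrite ger0_norm// f0.
Qed.

(** Dominated convergence; the majorant of all partial sums is the sum of the [p k], whose integral
    is the finite sum of the [m k]. *)
Lemma posint_signed_series (p : nat -> R -> R) (m sg : nat -> R) (f : R -> R) :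
  (forall k, measurable_fun pos (p k)) ->
  (forall k (r : R), 0 < r -> 0 <= p k r) ->
  (forall k, posint (p k) = (m k)%:E) ->
  cvgn (series m) -> (forall k, `|sg k| <= 1) ->
  (forall r : R, 0 < r -> series (fun k => sg k * p k r) n @[n --> \oo] --> f r) ->
  posint f = (limn (series (fun k => sg k * m k)))%:E.
Proof.
move=> mp p0 pm cm sg1 pf.
have m0 k : 0 <= m k by rewrite -lee_fin -pm; apply: posint_ge0; exact: p0.
have mP := @measurable_pos R.
pose g (r : R) : \bar R := (\big[+%E/0%R]_(0 <= k <oo) (p k r)%:E)%E.
have pE0 k r : pos r -> (0%R <= (p k r)%:E)%E by rewrite posP lee_fin; exact: p0.
have mpE k : measurable_fun pos (fun r => (p k r)%:E) by exact/measurable_EFinP.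
have gint : (\int[mu]_(r in pos) g r = (limn (series m))%:E)%E.
  rewrite /g integral_nneseries// -EFin_lim//.
  congr (limn _); apply/funext => n /=; rewrite /series/= -sumEFin.
  by apply: eq_bigr => k _; rewrite -pm.
have g0 r : pos r -> (0%R <= g r)%E by move=> rp; apply: nneseries_ge0 => k _ _; exact: pE0.
have mg : measurable_fun pos g by apply: ge0_emeasurable_sum => // k r rp _; exact: pE0.
have gi : mu.-integrable pos g.
  apply/integrableP; split => //.
  have -> : (\int[mu]_(x in pos) `|g x| = \int[mu]_(x in pos) g x)%E.
    by apply: eq_integral => x; rewrite inE => xp; rewrite gee0_abs// g0.
  by rewrite gint ltry.
pose f_ n (r : R) : \bar R := (series (fun k => sg k * p k r) n)%:E.
have pint k : mu.-integrable pos (EFin \o p k).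
  by apply: posint_integrable => //; rewrite ?pm ?ltry//; exact: p0.
have mf_ n : measurable_fun pos (f_ n).
  apply/measurable_EFinP; rewrite /series/=.
  apply: measurable_sum => k; exact: measurable_funM.
have f_f r : pos r -> f_ n r @[n --> \oo] --> (f r)%:E.
  rewrite posP => r0; apply: cvg_EFin; [by near=> n|exact: pf].
have mf : measurable_fun pos (fun r => (f r)%:E).
  exact: (emeasurable_fun_cvg f_ _ mf_ f_f).
have h1 : {ae mu, forall r, pos r -> f_ n r @[n --> \oo] --> (f r)%:E}.
  by apply: aeW => r; exact: f_f.
have h2 : {ae mu, forall r n, pos r -> (`|f_ n r| <= g r)%E}.
  apply: aeW => r n rp; rewrite /f_ abse_EFin /series/=.
  apply: (@le_trans _ _ (\sum_(0 <= k < n) (p k r)%:E)%E).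
    rewrite sumEFin lee_fin (le_trans (ler_norm_sum _ _ _))//.
    apply: ler_sum => k _; rewrite normrM -[leRHS]mul1r ler_pM//.
    by rewrite ger0_norm// p0//; move: rp; rewrite posP.
  by apply: nneseries_lim_ge => k _ _; exact: pE0.
have [_ _ lim] := @dominated_convergence _ _ R mu pos mP f_ _ g mf_ mf h1 gi h2.
apply: cvg_unique lim _ => //.
have cs : cvgn (series (fun k => sg k * m k)).
  apply: normed_cvg.
  apply: (@series_le_cvg _ _ m) => // k; first exact: normr_ge0.
  by rewrite /= normrM (ger0_norm (m0 k)) -[leRHS]mul1r ler_wpM2r.
have If n : (\int[mu]_(r in pos) f_ n r = (series (fun k => sg k * m k) n)%:E)%E.
  transitivity (\int[mu]_(r in pos) (\sum_(0 <= k < n) (sg k)%:E * (p k r)%:E))%E.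
    by apply: eq_integral => r _; rewrite /f_ /series/= -sumEFin.
  have pint2 k := @integrableZl _ _ R mu pos mP (sg k) _ (pint k).
  rewrite (@integral_sum _ _ R mu pos mP _ _ pint2).
  rewrite /series/= -sumEFin; apply: eq_bigr => k _.
  rewrite (@integralZl _ _ R mu pos mP _ (pint k) (sg k)) EFinM.
  congr (_ * _)%E; exact: pm.
have lim2 : (series (fun k => sg k * m k) n)%:E @[n --> \oo] -->
    (limn (series (fun k => sg k * m k)))%:E.
  by apply: cvg_EFin; [near=> n|exact: cs].
suff : (fun n => \int[mu]_(r in pos) f_ n r)%E @ \oo -->
    (limn (series (fun k => sg k * m k)))%:E by [].
by rewrite (_ : (fun n => _) = (fun n => (series (fun k => sg k * m k) n)%:E)) //;
  apply/funext => n; exact: If.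
Unshelve. all: by end_near. Qed.

End signed_series.

(** * The square of J_nu and Weber's integral *)

Section weber.
Context {R : realType}.
Implicit Types (nu s t r x : R).
Notation pos := (`]0%R, +oo[%classic : set R).

Definition bessel_kernel nu s r := r * s * besselJ nu (r * s) ^+ 2.

Definition inv_gamma_seq nu k : R := (Gamma (nu + k%:R + 1))^-1.

Lemma Gamma_poch (x : R) k : 0 < x -> Gamma (x + k%:R) = Gamma x * poch x k.
Proof.
move=> x0; elim: k => [|n IH]; first by rewrite addr0 poch0 mulr1.
by rewrite pochS -natr1 addrA (@GammaS _ (x + n%:R)) ?ltr_wpDr// IH; ring.
Qed.

Lemma inv_gamma_seqE nu k : -1 < nu ->
  inv_gamma_seq nu k = (Gamma (nu + 1) * poch (nu + 1) k)^-1.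
Proof.
move=> h; have n0 : 0 < nu + 1 by lra.
by rewrite /inv_gamma_seq -(Gamma_poch k n0) addrAC.
Qed.

Lemma geom_bounded_inv_gamma nu : -1 < nu -> geom_bounded (inv_gamma_seq nu).
Proof.
move=> h; have n0 : 0 < nu + 1 by lra.
have G0 := Gamma_gt0 n0.
exists (Gamma (nu + 1))^-1, (nu + 1)^-1; split; [by rewrite invr_ge0 ltW|by rewrite invr_ge0 ltW|].
move=> k; rewrite inv_gamma_seqE//.
have P0 := poch_gt0 k n0.
rewrite gtr0_norm; last by rewrite invr_gt0 mulr_gt0.
rewrite invfM ler_wpM2l ?invr_ge0 ?(ltW G0)//.
rewrite exprVn lef_pV2 ?posrE ?exprn_gt0//.
elim: {P0} k => [|k IH]; first by rewrite poch0 expr0.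
rewrite pochS exprSr ler_pM ?exprn_ge0 ?(ltW n0)//.
by rewrite lerDl.
Qed.

Lemma besselJE nu x : -1 < nu -> 0 < x ->
  besselJ nu x = (x / 2) `^ nu * egf (inv_gamma_seq nu) (- (x / 2) ^+ 2).
Proof.
move=> h x0; have x2 : 0 < x / 2 by rewrite divr_gt0.
apply/cvg_lim => //.
have lim : (x / 2) `^ nu * series (egf_term (inv_gamma_seq nu) (- (x / 2) ^+ 2)) n
   @[n --> \oo] --> (x / 2) `^ nu * egf (inv_gamma_seq nu) (- (x / 2) ^+ 2).
  by apply: cvgM; [exact: cvg_cst|exact: egf_cvg (geom_bounded_inv_gamma h)].
apply: (cvg_ext _ lim) => n; rewrite /series/= mulr_sumr; apply: eq_bigr => k _.
rewrite /egf_term /inv_gamma_seq addrC powRD ?(gt_eqF x2) ?implybT//.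
have -> : (x / 2) `^ (2 * k%:R) = ((x / 2) ^+ 2) ^+ k.
  by rewrite -natrM powR_mulrn ?(ltW x2)// exprM.
rewrite [(- (x / 2) ^+ 2) ^+ k]exprNn invfM.
move: (((x / 2) ^+ 2) ^+ k) (_ `^ nu) (Gamma _)^-1 => *; ring.
Qed.

Definition bessel_sq_coef nu := binomial_conv (inv_gamma_seq nu) (inv_gamma_seq nu).

Lemma bessel_kernelE nu s r : -1 < nu -> 0 < s -> 0 < r -> bessel_kernel nu s r =
  r * s * (r * s / 2) `^ (2 * nu) * egf (bessel_sq_coef nu) (- (r * s / 2) ^+ 2).
Proof.
move=> h s0 r0; have gb := geom_bounded_inv_gamma h.
have x0 : 0 < r * s by rewrite mulr_gt0.
rewrite /bessel_kernel besselJE// /bessel_sq_coef -egf_mul//.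
have -> : (r * s / 2) `^ (2 * nu) = (r * s / 2) `^ nu * (r * s / 2) `^ nu.
  by rewrite -powRD ?(gt_eqF (divr_gt0 x0 _)) ?implybT//; congr (_ `^ _); ring.
ring.
Qed.

Lemma bessel_kernel_ge0 nu s r : 0 < s -> 0 < r -> 0 <= bessel_kernel nu s r.
Proof. by move=> s0 r0; rewrite mulr_ge0 ?sqr_ge0// mulr_ge0// ltW. Qed.

(** Over the common denominator Gamma (nu + k + 1)^2 the convolution is a Vandermonde sum. Its value
    is the rising factorial (2 a + k)_k with a = nu + 1/2, which the duplication formula turns into
    [rho a k]. *)
Lemma bessel_sq_coef_Gamma nu k : - (1 / 2) < nu -> bessel_sq_coef nu k =
  4 ^+ k * rho (nu + 1 / 2) k / (Gamma (nu + 1) * Gamma (nu + 1 + k%:R)).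
Proof.
move=> h; have n0 : 0 < nu + 1 by lra.
have a0 : 0 < nu + 1 / 2 by lra.
have G0 := lt0r_neq0 (Gamma_gt0 n0).
have P0 := lt0r_neq0 (poch_gt0 k n0).
have ff i : (i <= k)%N -> inv_gamma_seq nu i =
    ffall (nu + k%:R) (k - i) / Gamma (nu + 1 + k%:R).
  move=> ik; have ni : 0 < nu + i%:R + 1 by rewrite addrAC ltr_wpDr.
  rewrite /inv_gamma_seq.
  have -> : nu + k%:R = nu + i%:R + (k - i)%:R by rewrite -addrA -natrD subnKC.
  rewrite ffall_poch.
  have -> : nu + 1 + k%:R = nu + i%:R + 1 + (k - i)%:R.
    by rewrite -{1}(subnKC ik) natrD; ring.
  rewrite (Gamma_poch _ ni).
  have Q0 := lt0r_neq0 (poch_gt0 (k - i) ni).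
  have H0 := lt0r_neq0 (Gamma_gt0 ni).
  by field; rewrite Q0 H0.
have -> : bessel_sq_coef nu k =
    ffall (nu + k%:R + (nu + k%:R)) k / Gamma (nu + 1 + k%:R) ^+ 2.
  rewrite -vandermonde_ffall /bessel_sq_coef /binomial_conv mulr_suml.
  apply: eq_bigr => i _; have ik : (i <= k)%N by rewrite -ltnS.
  rewrite (ff i ik) (ff (k - i)%N (leq_subr _ _)) subKn//.
  by rewrite -exprVn; ring.
have -> : nu + k%:R + (nu + k%:R) = 2 * (nu + 1 / 2) - 1 + k%:R + k%:R by field.
rewrite ffall_poch.
have -> : 2 * (nu + 1 / 2) - 1 + k%:R + 1 = 2 * (nu + 1 / 2) + k%:R by ring.
have a2 : 0 < 2 * (nu + 1 / 2) by lra.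
have D0 := lt0r_neq0 (poch_gt0 k a2).
have -> : poch (2 * (nu + 1 / 2) + k%:R) k =
    4 ^+ k * poch (nu + 1 / 2) k * poch (nu + 1) k / poch (2 * (nu + 1 / 2)) k.
  rewrite (_ : nu + 1 = nu + 1 / 2 + 1 / 2); last by field.
  by rewrite -poch_duplication pochD mulrAC divff// [RHS]mul1r.
rewrite Gamma_poch// /rho /pratio; field.
by rewrite D0 P0 G0.
Qed.

Lemma bessel_kernel_continuous nu s r : -1 < nu -> 0 < s -> 0 < r ->
  {for r, continuous (bessel_kernel nu s)}.
Proof.
move=> h s0 r0.
pose F r := r * s * (r * s / 2) `^ (2 * nu) *
  egf (bessel_sq_coef nu) (- (r * s / 2) ^+ 2).
have gb : geom_bounded (bessel_sq_coef nu).
  by apply: geom_bounded_conv; exact: geom_bounded_inv_gamma.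
have cl (c : R) : {for r, continuous (fun r => r * c)}.
  by apply: cvgM; [exact: cvg_id|exact: cvg_cst].
have c1 : {for r, continuous (fun r => r * s / 2)} by apply: cvgM; [exact: cl|exact: cvg_cst].
have cF : {for r, continuous F}.
  apply: cvgM.
    apply: cvgM; first exact: cl.
    apply: (@continuous_comp _ _ _ (fun r => r * s / 2) (fun x : R => x `^ (2 * nu))) => //.
    by apply: powR_continuous; rewrite divr_gt0// mulr_gt0.
  apply: (@continuous_comp _ _ _ (fun r => - (r * s / 2) ^+ 2) (egf (bessel_sq_coef nu))).
    apply: cvgN; apply: (@continuous_comp _ _ _ (fun r => r * s / 2) (fun x : R => x ^+ 2)) => //.
    exact: exprn_continuous.
  exact: egf_continuous.
have FE : \forall y \near r, F y = bessel_kernel nu s y.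
  near=> y; have y0 : 0 < y by near: y; exact: lt_nbhsr.
  by rewrite bessel_kernelE.
have H : F y @[y --> r] --> bessel_kernel nu s r.
  by have e := nbhs_singleton FE; rewrite -e; exact: cF.
have H' : bessel_kernel nu s y @[y --> r] --> bessel_kernel nu s r.
  by apply: cvg_trans H; exact: near_eq_cvg.
exact: H'.
Unshelve. all: by end_near. Qed.

Lemma bessel_kernel_measurable nu s : -1 < nu -> 0 < s ->
  measurable_fun pos (bessel_kernel nu s).
Proof.
by move=> h s0; apply: continuous_pos_measurable => r; exact: bessel_kernel_continuous.
Qed.

Definition gauss t r := expR (- (t * r ^+ 2)).

Lemma gauss_continuous t r : {for r, continuous (gauss t)}.
Proof.
apply: (@continuous_comp _ _ _ (fun r : R => t * r ^+ 2) (fun t : R => expR (- t))).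
  by apply: cvgM; [exact: cvg_cst|exact: exprn_continuous].
exact: expRN_continuous.
Qed.

Lemma gauss_gt0 t r : 0 < gauss t r. Proof. exact: expR_gt0. Qed.

(* Weber's second exponential integral, in Kummer's form. *)
Lemma weber_integral nu s t : - (1 / 2) < nu -> 0 < s -> 0 < t ->
  posint (fun r => bessel_kernel nu s r * gauss t r) =
  (weberQ nu (s ^+ 2 / t) / (2 * Num.sqrt t))%:E.
Proof.
move=> h s0 t0; have nu1 : -1 < nu by lra.
have n0 : 0 < nu + 1 by lra.
have a0 : 0 < nu + 1 / 2 by lra.
have G0 := Gamma_gt0 n0.
have gb : geom_bounded (bessel_sq_coef nu).
  by apply: geom_bounded_conv; exact: geom_bounded_inv_gamma.
pose x := s ^+ 2 / t.
pose A := s * (s / 2) `^ (2 * nu) / (2 * t `^ (nu + 1) * Gamma (nu + 1)).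
pose c k := bessel_sq_coef nu k / k`!%:R * (s * (s / 2) `^ (2 * nu) * ((s / 2) ^+ 2) ^+ k).
pose q k r := r `^ (2 * (nu + 1 + k%:R) - 1) * expR (- (t * r ^+ 2)).
have Gk k : 0 < Gamma (nu + 1 + k%:R) by apply: Gamma_gt0; rewrite ltr_wpDr.
have c0 k : 0 <= c k.
  rewrite /c bessel_sq_coef_Gamma//.
  have R0 := rho_gt0 k a0.
  have p4 : 0 <= (4 : R) ^+ k by rewrite exprn_ge0.
  have d0 : 0 <= Gamma (nu + 1) * Gamma (nu + 1 + k%:R) := mulr_ge0 (ltW G0) (ltW (Gk k)).
  apply: mulr_ge0; last first.
    apply: mulr_ge0; first exact: mulr_ge0 (ltW s0) (powR_ge0 _ _).
    by rewrite exprn_ge0// sqr_ge0.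
  by apply: divr_ge0 => //; apply: divr_ge0 => //; exact: mulr_ge0 (ltW R0).
have q0 k r : 0 <= q k r by rewrite mulr_ge0 ?powR_ge0 ?expR_ge0.
have mq k : measurable_fun pos (q k).
  apply: continuous_pos_measurable => r r0.
  by apply: cvgM; [exact: powR_continuous|exact: gauss_continuous].
have qint k : posint (q k) = (Gamma (nu + 1 + k%:R) / (2 * t `^ (nu + 1 + k%:R)))%:E.
  by rewrite /q gaussian_moment// ltr_wpDr.
pose m k := A * (rho (nu + 1 / 2) k * x ^+ k / k`!%:R).
have tk k : t `^ (nu + 1 + k%:R) = t `^ (nu + 1) * t ^+ k.
  by rewrite powRD ?(gt_eqF t0) ?implybT// powR_mulrn// ltW.
have pm k : posint (fun r => c k * q k r) = (m k)%:E.
  rewrite (posintZ (mq k) (fun r _ => q0 k r) (c0 k)) qint.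
  rewrite -EFinM; congr EFin.
  rewrite /c /m /A /x bessel_sq_coef_Gamma// tk.
  have g1 := lt0r_neq0 (Gk k); have g2 := lt0r_neq0 G0.
  have f0 : k`!%:R != 0 :> R by rewrite pnatr_eq0 -lt0n fact_gt0.
  have t1 : t `^ (nu + 1) != 0 by rewrite gt_eqF// powR_gt0.
  have t2 : t ^+ k != 0 by rewrite expf_neq0// gt_eqF.
  rewrite expr_div_n [(s ^+ 2 / t) ^+ k]expr_div_n expr_div_n.
  have -> : (4 : R) ^+ k = (2 ^+ 2) ^+ k by rewrite (_ : (2 : R) ^+ 2 = 4)// -natrX.
  have p2 : ((2 : R) ^+ 2) ^+ k != 0 by rewrite !expf_neq0// pnatr_eq0.
  move: (Gamma _) (Gamma _) (t `^ _) (t ^+ k) (rho _ _) ((2 ^+ 2) ^+ k) ((s ^+ 2) ^+ k)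
    (k`!%:R) ((s / 2) `^ _) g1 g2 t1 t2 p2 f0 => *.
  by field; do ?[apply/andP; split].
have cm : cvgn (series m).
  have lim : A * series (egf_term (rho (nu + 1 / 2)) x) n @[n --> \oo] -->
      A * egf (rho (nu + 1 / 2)) x.
    by apply: cvgM; [exact: cvg_cst|exact: egf_cvg (geom_bounded_rho a0)].
  apply: cvgP; apply: (cvg_ext _ lim) => n; rewrite /series/= mulr_sumr.
  by apply: eq_bigr => k _.
have pf r : 0 < r -> series (fun k => (-1) ^+ k * (c k * q k r)) n @[n --> \oo] -->
    bessel_kernel nu s r * gauss t r.
  move=> r0; have rs0 : 0 < r * s by rewrite mulr_gt0.
  pose z := - (r * s / 2) ^+ 2.
  have lim : r * s * (r * s / 2) `^ (2 * nu) * gauss t r *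
      series (egf_term (bessel_sq_coef nu) z) n @[n --> \oo] -->
      r * s * (r * s / 2) `^ (2 * nu) * gauss t r * egf (bessel_sq_coef nu) z.
    by apply: cvgM; [exact: cvg_cst|exact: egf_cvg].
  rewrite bessel_kernelE// mulrAC; apply: (cvg_ext _ lim) => n.
  rewrite /series/= mulr_sumr; apply: eq_bigr => k _.
  rewrite /c /q /gauss /egf_term /z [(- (r * s / 2) ^+ 2) ^+ k]exprNn.
  have -> : r `^ (2 * (nu + 1 + k%:R) - 1) = r * r `^ (2 * nu) * (r ^+ 2) ^+ k.
    have -> : 2 * (nu + 1 + k%:R) - 1 = (2 * nu + 2 * k%:R) + 1 by ring.
    rewrite -powR_mulr1// powRD ?(gt_eqF r0) ?implybT//.
    by rewrite -natrM powR_mulrn ?(ltW r0)// exprM; ring.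
  have -> : (r * s / 2) `^ (2 * nu) = r `^ (2 * nu) * (s / 2) `^ (2 * nu).
    by rewrite -mulrA powRM ?(ltW r0) ?divr_ge0 ?(ltW s0).
  have -> : ((r * s / 2) ^+ 2) ^+ k = (r ^+ 2) ^+ k * ((s / 2) ^+ 2) ^+ k.
    by rewrite -mulrA [(r * (s / 2)) ^+ 2]exprMn exprMn.
  move: (bessel_sq_coef nu k) (expR _) (r `^ _) (_ `^ _) ((r ^+ 2) ^+ k) (((s / 2) ^+ 2) ^+ k)
    => *.
  by ring.
have mp k : measurable_fun pos (fun r => c k * q k r) by exact: measurable_funM.
have p0 k r : 0 < r -> 0 <= c k * q k r by move=> _; exact: mulr_ge0.
have sg1 k : `|(-1 : R) ^+ k| <= 1 by rewrite normrX normrN1 expr1n.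
rewrite (posint_signed_series mp p0 pm cm sg1 pf); congr EFin.
have lim : A * series (egf_term (fun k => (-1) ^+ k * rho (nu + 1 / 2) k) x) n @[n --> \oo] -->
    A * egf (fun k => (-1) ^+ k * rho (nu + 1 / 2) k) x.
  apply: cvgM; first exact: cvg_cst.
  by apply: egf_cvg; apply: geom_boundedM; [exact: geom_bounded_pow|exact: geom_bounded_rho].
transitivity (A * egf (fun k => (-1) ^+ k * rho (nu + 1 / 2) k) x).
  apply/cvg_lim => //; apply: (cvg_ext _ lim) => n; rewrite /series/= mulr_sumr.
  by apply: eq_bigr => k _; rewrite /m /egf_term; ring.
(* For c = 2 a the parameter c - a is again a, so Kummer's transformation only removes the signs
   from the coefficients [rho a]. *)
have a2 : nu + 1 / 2 < 2 * (nu + 1 / 2) by lra.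
rewrite /rho kummer_transformation//.
have -> : 2 * (nu + 1 / 2) - (nu + 1 / 2) = nu + 1 / 2 by ring.
rewrite -/(rho (nu + 1 / 2)) /weberQ /kummerQ -/x.
move: (expR (- x) * egf _ x) => E; rewrite /A.
have x0 : 0 < x by rewrite divr_gt0// exprn_gt0.
have -> : x `^ (nu + 1 / 2) = s * s `^ (2 * nu) * Num.sqrt t / t `^ (nu + 1).
  rewrite /x powRM ?sqr_ge0 ?invr_ge0 ?(ltW t0)//.
  have -> : (s ^+ 2) `^ (nu + 1 / 2) = s * s `^ (2 * nu).
    rewrite -powR_mulrn ?(ltW s0)// -powRrM mulrC [RHS]mulrC powR_mulr1//.
    by congr (_ `^ _); field.
  have -> : t^-1 `^ (nu + 1 / 2) = (t `^ (nu + 1 / 2))^-1.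
    by rewrite -powRN -(powR_inv1 (ltW t0)) -powRrM mulN1r.
  have -> : t `^ (nu + 1) = t `^ (nu + 1 / 2) * Num.sqrt t.
    rewrite -powR12_sqrt ?(ltW t0)// -powRD ?(gt_eqF t0) ?implybT//.
    by congr (_ `^ _); field.
  have t1 : t `^ (nu + 1 / 2) != 0 by rewrite gt_eqF// powR_gt0.
  have t2 : Num.sqrt t != 0 by rewrite gt_eqF// sqrtr_gt0.
  by field; rewrite t1 t2.
have -> : (s / 2) `^ (2 * nu) = s `^ (2 * nu) * 4 `^ (- nu).
  rewrite powRM ?invr_ge0 ?(ltW s0)//; congr (_ * _).
  have -> : (2 : R)^-1 = 2 `^ (-1) by rewrite powR_inv1.
  have -> : (4 : R) = 2 `^ 2%:R by rewrite powR_mulrn// -natrX.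
  by rewrite -!powRrM; congr (_ `^ _); ring.
have g2 := lt0r_neq0 G0.
have t1 : t `^ (nu + 1) != 0 by rewrite gt_eqF// powR_gt0.
have t2 : Num.sqrt t != 0 by rewrite gt_eqF// sqrtr_gt0.
move: (Gamma _) (t `^ _) (Num.sqrt t) (s `^ _) (4 `^ _) g2 t1 t2 => *.
by field; do ?[apply/andP; split].
Qed.

End weber.

(** * Approximation by nonnegative combinations of Gaussians *)

Section approximation.
Context {R : realType}.
Implicit Types (t r : R) (k u v f : R -> R).
Notation mu := (@lebesgue_measure R).
Notation pos := (`]0%R, +oo[%classic : set R).

Definition posfun u := measurable_fun pos u /\ forall r, 0 < r -> 0 <= u r.

Definition gauss_kernel k := posfun k /\
  forall t, 0 < t -> (posint (fun r => k r * gauss t r)%R < +oo)%E.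

Lemma posfunM k u : posfun k -> posfun u -> posfun (fun r => k r * u r).
Proof.
move=> [mk k0] [mu_ u0]; split; first exact: measurable_funM.
by move=> r r0; rewrite mulr_ge0 ?k0 ?u0.
Qed.

Lemma posfunD k u : posfun k -> posfun u -> posfun (fun r => k r + u r).
Proof.
move=> [mk k0] [mu_ u0]; split; first exact: measurable_funD.
by move=> r r0; rewrite addr_ge0 ?k0 ?u0.
Qed.

Lemma posfun_scale (c : R) u : 0 <= c -> posfun u -> posfun (fun r => c * u r).
Proof.
move=> c0 [mu_ u0]; split; first exact: measurable_funM.
by move=> r r0; rewrite mulr_ge0 ?u0.
Qed.

Lemma posfun_gauss t : posfun (gauss t).
Proof.
split=> [|r _]; last exact/ltW/gauss_gt0.
by apply: continuous_pos_measurable => r _; exact: gauss_continuous.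
Qed.

Lemma posint_dominated_cvg k (u_ : nat -> R -> R) u v : posfun k ->
  (forall n, posfun (u_ n)) -> posfun u -> posfun v ->
  (forall n r, 0 < r -> u_ n r <= v r) ->
  (forall r, 0 < r -> u_ n r @[n --> \oo] --> u r) ->
  (posint (fun r => k r * v r)%R < +oo)%E ->
  posint (fun r => k r * u_ n r) @[n --> \oo] --> posint (fun r => k r * u r).
Proof.
move=> pk pu_ pu pv uv lim kv.
have mP := @measurable_pos R.
have [mku ku0] := posfunM pk pu; have [mkv kv0] := posfunM pk pv.
pose f_ n r : \bar R := (k r * u_ n r)%:E.
have mf_ n : measurable_fun pos (f_ n).
  by apply/measurable_EFinP; have [] := posfunM pk (pu_ n).
have mf : measurable_fun pos (fun r => (k r * u r)%:E) by exact/measurable_EFinP.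
have gi := posint_integrable mkv kv0 kv.
have h1 : {ae mu, forall r, pos r -> f_ n r @[n --> \oo] --> (k r * u r)%:E}.
  apply: aeW => r; rewrite posP => r0; apply: cvg_EFin; first by near=> n.
  by apply: cvgM; [exact: cvg_cst|exact: lim].
have h2 : {ae mu, forall r n, pos r -> (`|f_ n r| <= (EFin \o (fun r => k r * v r)%R) r)%E}.
  apply: aeW => r n; rewrite posP => r0; rewrite /f_ abse_EFin lee_fin.
  have [_ p0] := posfunM pk (pu_ n); rewrite ger0_norm ?p0//.
  by apply: ler_wpM2l; [exact: pk.2|exact: uv].
by have [_ _] := @dominated_convergence _ _ R mu pos mP f_ _ _ mf_ mf h1 gi h2.
Unshelve. all: by end_near. Qed.

Lemma posint_monotone_cvg k (u_ : nat -> R -> R) u : posfun k ->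
  (forall n, posfun (u_ n)) ->
  (forall r, 0 < r -> {homo (fun n => u_ n r) : n m / (n <= m)%N >-> n <= m}) ->
  (forall r, 0 < r -> u_ n r @[n --> \oo] --> u r) ->
  posint (fun r => k r * u_ n r) @[n --> \oo] --> posint (fun r => k r * u r).
Proof.
move=> pk pu_ nd lim.
have mP := @measurable_pos R.
pose f_ n r : \bar R := (k r * u_ n r)%:E.
have mf_ n : measurable_fun pos (f_ n).
  by apply/measurable_EFinP; have [] := posfunM pk (pu_ n).
have f0 n r : pos r -> (0%R <= f_ n r)%E.
  by rewrite posP lee_fin; have [_] := posfunM pk (pu_ n); apply.
have fnd r : pos r -> {homo f_^~ r : n m / (n <= m)%N >-> (n <= m)%E}.
  rewrite posP => r0 n m nm; rewrite lee_fin; apply: ler_wpM2l; first exact: pk.2.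
  exact: nd.
have := @cvg_monotone_convergence _ _ R mu pos mP _ mf_ f0 fnd.
suff -> : (\int[mu]_(r in pos) limn (f_^~ r))%E = posint (fun r => k r * u r) by [].
apply: eq_integral => r; rewrite inE posP => r0.
apply/cvg_lim => //; apply: cvg_EFin; first by near=> n.
by apply: cvgM; [exact: cvg_cst|exact: lim].
Unshelve. all: by end_near. Qed.

Definition gauss_comb (w tau : nat -> R) N r := \sum_(i < N) w i * gauss (tau i) r.

Lemma posint_gauss_comb k (w tau D : nat -> R) N : gauss_kernel k ->
  (forall i, 0 <= w i) -> (forall i, 0 < tau i) ->
  (forall i, posint (fun r => k r * gauss (tau i) r) = (D i)%:E) ->
  posint (fun r => k r * gauss_comb w tau N r) = (\sum_(i < N) w i * D i)%:E.
Proof.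
move=> [pk _] w0 tau0 kD.
have pc i : posfun (fun r => w i * (k r * gauss (tau i) r)).
  by apply: posfun_scale => //; apply: posfunM => //; exact: posfun_gauss.
have pS n : posfun (fun r => \sum_(i < n) w i * (k r * gauss (tau i) r)).
  elim: n => [|n IH].
    split=> [|r _]; last by rewrite big_ord0.
    rewrite (_ : (fun r => _) = (fun=> 0)); first exact: measurable_cst.
    by apply/funext => r; rewrite big_ord0.
  by under eq_fun do rewrite big_ord_recr/=; exact: posfunD.
rewrite (@eq_posint _ _ (fun r => \sum_(i < N) w i * (k r * gauss (tau i) r))); last first.
  by move=> r _; rewrite /gauss_comb mulr_sumr; apply: eq_bigr => i _; rewrite mulrCA.
elim: N => [|n IH].
  rewrite (@eq_posint _ _ (fun=> 0)); last by move=> r _; rewrite big_ord0.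
  rewrite big_ord0 /posint; under eq_integral do rewrite -[X in X%:E]/(0 : R).
  exact: integral0.
rewrite (@eq_posint _ _ (fun r => \sum_(i < n) w i * (k r * gauss (tau i) r) +
    w n * (k r * gauss (tau n) r))); last by move=> r _; rewrite big_ord_recr.
have [m1 s1] := pS n; have [m2 s2] := pc n.
have [m3 s3] := posfunM pk (posfun_gauss (tau n)).
rewrite (posintD m1 m2 s1 s2) IH (posintZ m3 s3 (w0 n)) kD -EFinM -EFinD.
by rewrite big_ord_recr.
Qed.

Variables (f : R -> R) (G : nat -> R -> R).
Hypothesis GG : cm_tower G.
Hypothesis fG : forall r, 0 < r -> f r = G 0%N (r ^+ 2).

(** Carried by every function of the approximation so that its integral against a Bessel kernel is
    finite, see [tame_bessel_lty]; the second alternative serves f and the functions increasing to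
    it. *)
Definition tame u := posfun u /\
  ((exists C eps : R, [/\ 0 <= C, 0 < eps & forall r, 0 < r -> u r <= C * gauss eps r]) \/
   (forall r, 0 < r -> u r <= f r)).

Lemma cm_tower_continuous n (x : R) : 0 < x -> {for x, continuous (G n)}.
Proof. by move=> x0; have [d _] := GG n x0; exact: is_derive_continuous. Qed.

Lemma posfun_cm : posfun f.
Proof.
split; last by move=> r r0; rewrite fG//; have [] := GG 0 (exprn_gt0 2 r0).
have mG : measurable_fun pos (fun r => G 0%N (r ^+ 2)).
  apply: continuous_pos_measurable => r r0.
  apply: (@continuous_comp _ _ _ (fun r : R => r ^+ 2) (G 0%N)).
    exact: exprn_continuous.
  by apply: cm_tower_continuous; exact: exprn_gt0.
by apply: eq_measurable_fun mG => r; rewrite inE posP => r0; rewrite fG.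
Qed.

Let step (n : nat) : R := n.+1%:R^-1.
Let step_gt0 n : 0 < step n. Proof. by rewrite invr_gt0. Qed.

(* The point delta + a (1 - e^(- l / a)) with a = n + 1, delta = 1 / (m + 1),
   which increases to delta + l. *)
Let node m n (l : R) := step m + (1 - expR (- (l * step n))) / step n.

(** Combinations of Gaussians increase to [u2], [u2] tends to [u3] in n, and [u3] increases to f in
    m. The factor [gauss (step m)] supplies a Gaussian majorant for the first two limits. *)
Let u2 m n r := gauss (step m) r * G 0%N (node m n (r ^+ 2)).
Let u3 m r := gauss (step m) r * G 0%N (step m + r ^+ 2).

(** With a = 1 / [step n], the distance from the center to the node at l = r^2 is a e^(-l / a). Its
    powers are exponentials in r^2, so Taylor sums about the center are combinations of Gaussians
    with these weights and rates. *)
Let center m n := step m + (step n)^-1.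
Let weight m n i := G i (center m n) * (step n)^-1 ^+ i / i`!%:R.
Let rate m n i := step m + i%:R * step n.

Let node_ge m n r : step m <= node m n (r ^+ 2).
Proof.
rewrite lerDl divr_ge0 ?(ltW (step_gt0 n))// subr_ge0 -expR0 ler_expR oppr_le0.
by rewrite mulr_ge0 ?sqr_ge0// ltW.
Qed.

Let node_lt m n l : node m n l < center m n.
Proof.
rewrite ltrD2l ltr_pdivrMr ?step_gt0// mulVf ?gt_eqF//.
by rewrite ltrBlDr ltrDl expR_gt0.
Qed.

Let node_gt0 m n r : 0 < node m n (r ^+ 2).
Proof. exact: lt_le_trans (step_gt0 m) (node_ge m n r). Qed.

Let combE m n N r : gauss_comb (weight m n) (rate m n) N r =
  gauss (step m) r * \sum_(i < N) G i (center m n) *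
    (center m n - node m n (r ^+ 2)) ^+ i / i`!%:R.
Proof.
rewrite /gauss_comb mulr_sumr; apply: eq_bigr => i _.
have -> : center m n - node m n (r ^+ 2) = (step n)^-1 * expR (- (r ^+ 2 * step n)).
  by rewrite /center /node; field; rewrite gt_eqF.
have -> : gauss (rate m n i) r = gauss (step m) r * expR (- (r ^+ 2 * step n)) ^+ i.
  rewrite /gauss -expRM_natl -expRD; congr expR; rewrite /rate; ring.
by rewrite /weight exprMn; ring.
Qed.

Let comb_cvg m n r : 0 < r ->
  gauss_comb (weight m n) (rate m n) N r @[N --> \oo] --> u2 m n r.
Proof.
move=> r0; have lim := cm_tower_taylor GG (node_gt0 m n r) (node_lt m n (r ^+ 2)).
have lim2 : gauss (step m) r * (\sum_(i < N) G i (center m n) *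
    (center m n - node m n (r ^+ 2)) ^+ i / i`!%:R) @[N --> \oo] --> u2 m n r.
  by apply: cvgM; [exact: cvg_cst|exact: lim].
by apply: (cvg_ext _ lim2) => N; rewrite combE.
Qed.

Let center_gt0 m n : 0 < center m n.
Proof. by rewrite addr_gt0 ?invr_gt0. Qed.

Let weight_ge0 m n i : 0 <= weight m n i.
Proof.
have [_ g] := GG i (center_gt0 m n).
by rewrite divr_ge0// mulr_ge0// exprn_ge0// invr_ge0 ltW.
Qed.

Let rate_gt0 m n i : 0 < rate m n i.
Proof. by rewrite ltr_wpDr// mulr_ge0// ltW. Qed.

Let posfun_comb m n N : posfun (gauss_comb (weight m n) (rate m n) N).
Proof.
rewrite /gauss_comb; elim: N => [|N IH].
  split=> [|r _]; last by rewrite big_ord0.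
  rewrite (_ : (fun r => _) = (fun=> 0)); first exact: measurable_cst.
  by apply/funext => r; rewrite big_ord0.
under eq_fun do rewrite big_ord_recr/=; apply: posfunD => //.
by apply: posfun_scale => //; exact: posfun_gauss.
Qed.

Let comb_nd m n r : 0 < r ->
  {homo (fun N => gauss_comb (weight m n) (rate m n) N r) : N M / (N <= M)%N >-> N <= M}.
Proof.
move=> r0; apply/nondecreasing_seqP => N.
by rewrite /gauss_comb big_ord_recr/= lerDl mulr_ge0// ltW// gauss_gt0.
Qed.

Let posfun_u2 m n : posfun (u2 m n).
Proof.
split; last first.
  move=> r r0; rewrite mulr_ge0 ?(ltW (gauss_gt0 _ _))//.
  by have [] := GG 0 (node_gt0 m n r).
apply: continuous_pos_measurable => r r0; apply: cvgM; first exact: gauss_continuous.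
apply: (@continuous_comp _ _ _ (fun r : R => node m n (r ^+ 2)) (G 0%N)); last first.
  by apply: cm_tower_continuous; exact: node_gt0.
apply: cvgD; first exact: cvg_cst.
apply: cvgM; last exact: cvg_cst.
apply: cvgB; first exact: cvg_cst.
apply: (@continuous_comp _ _ _ (fun r : R => r ^+ 2 * step n) (fun t => expR (- t))).
  by apply: cvgM; [exact: exprn_continuous|exact: cvg_cst].
exact: expRN_continuous.
Qed.

Let u2_le m n r : 0 < r -> u2 m n r <= G 0%N (step m) * gauss (step m) r.
Proof.
move=> r0; rewrite /u2 mulrC ler_wpM2r ?(ltW (gauss_gt0 _ _))//.
exact: cm_tower_nincr GG (step_gt0 m) (node_ge m n r).
Qed.

Let posfun_u3 m : posfun (u3 m).
Proof.
have s0 r : 0 < step m + r ^+ 2 by rewrite ltr_wpDr ?sqr_ge0.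
split; last first.
  move=> r r0; rewrite mulr_ge0 ?(ltW (gauss_gt0 _ _))//.
  by have [] := GG 0 (s0 r).
apply: continuous_pos_measurable => r r0; apply: cvgM; first exact: gauss_continuous.
apply: (@continuous_comp _ _ _ (fun r : R => step m + r ^+ 2) (G 0%N)); last first.
  exact: cm_tower_continuous.
by apply: cvgD; [exact: cvg_cst|exact: exprn_continuous].
Qed.

Let posfun_major m : posfun (fun r => G 0%N (step m) * gauss (step m) r).
Proof.
apply: posfun_scale; last exact: posfun_gauss.
by have [] := GG 0 (step_gt0 m).
Qed.

Let cvg_step : step n @[n --> \oo] --> (0 : R).
Proof. exact: cvg_invS. Qed.

Let node_cvg m (l : R) : 0 <= l -> node m n l @[n --> \oo] --> step m + l.
Proof.
move=> l0; apply: cvgD; first exact: cvg_cst.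
(* With h = [step n], the inequality e^x >= 1 + x at x = l h and x = - l h puts (1 - e^(-l h)) / h
   between l / (1 + l h) and l. *)
have lim : l / (1 + l * step n) @[n --> \oo] --> l / (1 + l * 0).
  apply: cvgM; first exact: cvg_cst.
  apply: cvgV; first by rewrite mulr0 addr0 oner_neq0.
  apply: cvgD; first exact: cvg_cst.
  by apply: cvgM; [exact: cvg_cst|exact: cvg_step].
rewrite mulr0 addr0 divr1 in lim.
apply: (@squeeze_cvgr _ _ _ _ (fun n => l / (1 + l * step n)) (fun=> l));
  [|exact: lim|exact: cvg_cst].
near=> n; have h0 := step_gt0 n; set h := step n in h0 *.
have d0 : 0 < 1 + l * h by rewrite ltr_pwDl// mulr_ge0// ltW.
have e1 := expR_ge1Dx (l * h).
have e2 := expR_ge1Dx (- (l * h)).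
apply/andP; split; last by rewrite ler_pdivrMr//; lra.
have e3 : expR (- (l * h)) <= (1 + l * h)^-1.
  by rewrite expRN lef_pV2 ?posrE// (lt_le_trans d0).
rewrite ler_pdivlMr//.
have -> : l / (1 + l * h) * h = 1 - (1 + l * h)^-1 by field; rewrite gt_eqF.
by rewrite lerB.
Unshelve. all: by end_near. Qed.

Let u2_cvg m r : 0 < r -> u2 m n r @[n --> \oo] --> u3 m r.
Proof.
move=> r0; apply: cvgM; first exact: cvg_cst.
have s0 : 0 < step m + r ^+ 2 by rewrite ltr_wpDr ?sqr_ge0.
have l := @node_cvg m (r ^+ 2) (sqr_ge0 r).
exact: (cvg_comp _ _ l (cm_tower_continuous (n := 0%N) s0)).
Qed.

Let u3_cvg r : 0 < r -> u3 m r @[m --> \oo] --> f r.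
Proof.
move=> r0; rewrite fG// -[X in _ --> X]mul1r; apply: cvgM.
  have e : expR (- (0 * r ^+ 2)) = 1 :> R by rewrite mul0r oppr0 expR0.
  rewrite -e.
  have c : {for 0, continuous (fun t => expR (- (t * r ^+ 2)))}.
    apply: (@continuous_comp _ _ _ (fun t => t * r ^+ 2) (fun t => expR (- t))).
      by apply: cvgM; [exact: cvg_id|exact: cvg_cst].
    exact: expRN_continuous.
  exact: (cvg_comp _ _ cvg_step c).
have lim : step m + r ^+ 2 @[m --> \oo] --> 0 + r ^+ 2.
  by apply: cvgD; [exact: cvg_step|exact: cvg_cst].
rewrite add0r in lim; apply: (cvg_comp _ _ lim).
by apply: cm_tower_continuous; exact: exprn_gt0.
Qed.

Let step_le n m : (n <= m)%N -> step m <= step n.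
Proof. by move=> nm; rewrite lef_pV2 ?posrE// ler_nat ltnS. Qed.

Let gauss_le s t r : s <= t -> gauss t r <= gauss s r.
Proof. by move=> st; rewrite ler_expR lerN2 ler_wpM2r ?sqr_ge0. Qed.

Let u3_nd r : 0 < r -> {homo (fun m => u3 m r) : n m / (n <= m)%N >-> n <= m}.
Proof.
move=> r0 n m nm; have s0 (i : nat) : 0 < step i + r ^+ 2 by rewrite ltr_wpDr ?sqr_ge0.
apply: ler_pM; first exact/ltW/gauss_gt0.
- by have [] := GG 0 (s0 n).
- by apply: gauss_le; exact: step_le.
- by apply: cm_tower_nincr GG (s0 m) _; rewrite lerD2r step_le.
Qed.

Let u3_le m r : 0 < r -> u3 m r <= f r.
Proof.
move=> r0; rewrite fG// -[leRHS]mul1r; apply: ler_pM.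
- exact/ltW/gauss_gt0.
- by have s0 : 0 < step m + r ^+ 2; [rewrite ltr_wpDr ?sqr_ge0|have [] := GG 0 s0].
- by rewrite -expR0 ler_expR oppr_le0 mulr_ge0 ?sqr_ge0// ltW.
- by apply: cm_tower_nincr GG (exprn_gt0 2 r0) _; rewrite lerDr ltW.
Qed.

(* This replaces Bernstein's theorem: whatever holds for nonnegative
   combinations of Gaussians and is stable under these limits holds for f. *)
Lemma cm_induction (P : (R -> R) -> Prop) :
  (forall w tau N, (forall i, 0 <= w i) -> (forall i, 0 < tau i) ->
    P (gauss_comb w tau N)) ->
  (forall (u_ : nat -> R -> R) u, (forall n, P (u_ n)) -> (forall n, tame (u_ n)) -> tame u ->
    (forall r, 0 < r -> u_ n r @[n --> \oo] --> u r) ->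
    (forall k, gauss_kernel k ->
      posint (fun r => k r * u_ n r) @[n --> \oo] --> posint (fun r => k r * u r)) ->
    P u) ->
  P f.
Proof.
move=> Pcomb Plim.
have tame2 m n : tame (u2 m n).
  split; first exact: posfun_u2.
  left; exists (G 0%N (step m)), (step m); split => //.
    by have [] := GG 0 (step_gt0 m).
  by move=> r; exact: u2_le.
have tame3 m : tame (u3 m) by split; [exact: posfun_u3|right => r; exact: u3_le].
have comb_le m n N r : 0 < r -> gauss_comb (weight m n) (rate m n) N r <= u2 m n r.
  move=> r0; have lim := @comb_cvg m n r r0.
  have := nondecreasing_cvgn_le (@comb_nd m n r r0) (cvgP _ lim) N.
  by rewrite (cvg_lim (@Rhausdorff R) lim).
have tame1 m n N : tame (gauss_comb (weight m n) (rate m n) N).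
  split; first exact: posfun_comb.
  left; exists (G 0%N (step m)), (step m); split => //.
    by have [] := GG 0 (step_gt0 m).
  by move=> r r0; apply: le_trans (comb_le _ _ _ _ r0) _; exact: u2_le.
have fin k m : gauss_kernel k ->
    (posint (fun r => k r * (G 0%N (step m) * gauss (step m) r))%R < +oo)%E.
  move=> [pk kf]; have [mkg kg0] := posfunM pk (posfun_gauss (step m)).
  have c0 : 0 <= G 0%N (step m) by have [] := GG 0 (step_gt0 m).
  rewrite (@eq_posint _ _ (fun r => G 0%N (step m) * (k r * gauss (step m) r))); last first.
    by move=> r _; rewrite mulrCA.
  rewrite (posintZ mkg kg0 c0) lte_mul_pinfty// ?lee_fin//; exact: kf.
have P2 m n : P (u2 m n).
  apply: (Plim (fun N => gauss_comb (weight m n) (rate m n) N)) => //.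
  - by move=> N; exact: Pcomb.
  - by move=> r; exact: comb_cvg.
  - by move=> k [pk _]; apply: posint_monotone_cvg => //; [exact: comb_nd|exact: comb_cvg].
have P3 m : P (u3 m).
  apply: (Plim (fun n => u2 m n)) => //.
  - by move=> r; exact: u2_cvg.
  - move=> k gk; apply: (@posint_dominated_cvg k (u2 m) (u3 m)
      (fun r => G 0%N (step m) * gauss (step m) r)) => //.
    + exact: gk.1.
    + by move=> n r; exact: u2_le.
    + by move=> r; exact: u2_cvg.
    + exact: fin.
(* The last limit is monotone rather than dominated, since the integral of f against a general
   kernel may be infinite. *)
apply: (Plim u3) => //.
- by split; [exact: posfun_cm|right].
- by move=> k [pk _]; apply: posint_monotone_cvg.
Qed.

End approximation.

(** * From inequalities between transforms to inequalities between integrals of f *)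

Section comparison.
Context {R : realType}.
Implicit Types (t r s x : R) (k u v f : R -> R) (D : R -> R).

Definition gauss_transform k D := posfun k /\
  forall t, 0 < t -> posint (fun r => k r * gauss t r) = (D t)%:E.

Lemma gauss_transform_kernel k D : gauss_transform k D -> gauss_kernel k.
Proof. by move=> [pk kD]; split=> // t /kD ->; rewrite ltry. Qed.

Lemma posint_mulZ (c : R) k u : 0 <= c -> posfun k -> posfun u ->
  posint (fun r => k r * (c * u r)) = (c%:E * posint (fun r => k r * u r)%R)%E.
Proof.
move=> c0 pk pu; have [m p] := posfunM pk pu; rewrite -posintZ//.
by apply: eq_posint => r _; rewrite mulrCA.
Qed.

Lemma gauss_transformZ (c : R) k D : 0 <= c -> gauss_transform k D ->
  gauss_transform (fun r => c * k r) (fun t => c * D t).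
Proof.
move=> c0 [pk kD]; split=> [|t t0]; first exact: posfun_scale.
have [m p] := posfunM pk (posfun_gauss t).
rewrite EFinM -kD// -posintZ//.
by apply: eq_posint => r _; rewrite mulrA.
Qed.

Lemma gauss_transformD k1 k2 D1 D2 : gauss_transform k1 D1 -> gauss_transform k2 D2 ->
  gauss_transform (fun r => k1 r + k2 r) (fun t => D1 t + D2 t).
Proof.
move=> [p1 h1] [p2 h2]; split=> [|t t0]; first exact: posfunD.
have [m1 q1] := posfunM p1 (posfun_gauss t).
have [m2 q2] := posfunM p2 (posfun_gauss t).
rewrite EFinD -h1// -h2// -posintD//.
by apply: eq_posint => r _; rewrite mulrDl.
Qed.

Lemma powR_le_expR (e z : R) : 0 <= e -> 0 < z -> z `^ e <= expR (e * z).
Proof.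
move=> e0 z0; rewrite /powR gt_eqF// ler_expR ler_wpM2l//.
exact: ltW (ln_sublinear z0).
Qed.

Variables (f : R -> R) (G : nat -> R -> R).
Hypothesis GG : cm_tower G.
Hypothesis fG : forall r, 0 < r -> f r = G 0%N (r ^+ 2).

(** Both sides are linear on combinations of Gaussians and continuous under the limits of
    [cm_induction]. Point values are finite, so the sums make sense even when an integral is
    infinite. *)
Lemma posint_compare k1 k2 D1 D2 (c d1 d2 p p1 p2 : R) :
  gauss_transform k1 D1 -> gauss_transform k2 D2 -> 0 < p -> 0 < p1 -> 0 < p2 ->
  (forall t, 0 < t -> D1 t + c * gauss t p <=
    D2 t + (d1 * gauss t p1 + d2 * gauss t p2)) ->
  (posint (fun r => k1 r * f r)%R + (c * f p)%:E <=
   posint (fun r => k2 r * f r)%R + (d1 * f p1 + d2 * f p2)%:E)%E.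
Proof.
move=> g1 g2 p0 p10 p20 H.
have [gk1 gk2] := (gauss_transform_kernel g1, gauss_transform_kernel g2).
have [pk1 h1] := g1; have [pk2 h2] := g2.
apply: (@cm_induction _ f G GG fG (fun u =>
  posint (fun r => k1 r * u r)%R + (c * u p)%:E <=
   posint (fun r => k2 r * u r)%R + (d1 * u p1 + d2 * u p2)%:E)%E).
- move=> w tau N w0 tau0.
  rewrite (@posint_gauss_comb _ k1 w tau (fun i => D1 (tau i)))//; last first.
    by move=> i; exact: h1.
  rewrite (@posint_gauss_comb _ k2 w tau (fun i => D2 (tau i)))//; last first.
    by move=> i; exact: h2.
  rewrite -!EFinD lee_fin /gauss_comb !mulr_sumr -!big_split/=.
  apply: ler_sum => i _; have := ler_wpM2l (w0 i) (H _ (tau0 i)).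
  move: (gauss _ _) (gauss _ _) (gauss _ _) (D1 _) (D2 _) => *; lra.
- move=> u_ u Pu tu_ tu lim klim.
  have c1 : (posint (fun r => k1 r * u_ n r)%R + (c * u_ n p)%:E)%E @[n --> \oo] -->
      (posint (fun r => k1 r * u r)%R + (c * u p)%:E)%E.
    apply: cvgeD; [exact: fin_num_adde_defl|exact: klim|].
    apply: cvg_EFin; first by near=> n.
    by apply: cvgM; [exact: cvg_cst|exact: lim].
  have c2 : (posint (fun r => k2 r * u_ n r)%R + (d1 * u_ n p1 + d2 * u_ n p2)%:E)%E
      @[n --> \oo] --> (posint (fun r => k2 r * u r)%R + (d1 * u p1 + d2 * u p2)%:E)%E.
    apply: cvgeD; [exact: fin_num_adde_defl|exact: klim|].
    apply: cvg_EFin; first by near=> n.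
    by apply: cvgD; apply: cvgM; [exact: cvg_cst|exact: lim|exact: cvg_cst|exact: lim].
  by apply: (lee_cvg_to c1 c2); exact: nearW.
Unshelve. all: by end_near. Qed.

Lemma posint_transform_le k1 k2 D1 D2 : gauss_transform k1 D1 -> gauss_transform k2 D2 ->
  (forall t, 0 < t -> D1 t <= D2 t) ->
  (posint (fun r => k1 r * f r)%R <= posint (fun r => k2 r * f r)%R)%E.
Proof.
move=> g1 g2 D12.
have := @posint_compare _ _ _ _ 0 0 0 1 1 1 g1 g2 ltr01 ltr01 ltr01.
rewrite !mul0r !addr0; apply=> t t0.
by rewrite !mul0r !addr0 D12.
Qed.

Lemma cm_sqr_nincr x y : 0 < x -> x <= y -> f y <= f x.
Proof.
move=> x0 xy; rewrite !fG ?(lt_le_trans x0)//.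
apply: cm_tower_nincr GG (exprn_gt0 2 x0) _.
by rewrite lerXn2r ?nnegrE ?(ltW (lt_le_trans x0 xy))// ltW.
Qed.

(* On Gaussians, gauss t p - 2 gauss t q - B gauss t (p / 2) is negative for t
   near 0 (first correction) and for t near oo (second one), so a small multiple
   c of it fits below D2 - D1, which has a positive minimum in between; on f the
   same combination of values is positive, and posint_compare gives the gap. *)
Lemma posint_transform_lt k1 k2 D1 D2 p : gauss_transform k1 D1 -> gauss_transform k2 D2 ->
  (forall t, 0 < t -> {for t, continuous D1}) ->
  (forall t, 0 < t -> {for t, continuous D2}) ->
  (forall t, 0 < t -> D1 t < D2 t) ->
  0 < p -> 0 < f p -> (forall eta : R, 0 < eta -> exists2 q : R, 0 < q & f q < eta) ->
  (posint (fun r => k1 r * f r)%R < +oo)%E ->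
  (posint (fun r => k1 r * f r)%R < posint (fun r => k2 r * f r)%R)%E.
Proof.
move=> g1 g2 c1 c2 D12 p0 fp0 small fin.
have fp4 : 0 < f p / 4 by lra.
have [q q0 fq] := small _ fp4.
have p20 : 0 < p / 2 by lra.
have fp2 : f p <= f (p / 2) by apply: cm_sqr_nincr => //; lra.
have f20 : 0 < f (p / 2) by exact: lt_le_trans fp2.
(* With f q < f p / 4, this makes f p - 2 f q - B f(p / 2) larger than f p / 4. *)
pose B := f p / 4 / f (p / 2).
have B0 : 0 < B by rewrite divr_gt0.
have BE : B * f (p / 2) = f p / 4 by rewrite /B divfK// gt_eqF.
(* For t <= t1 one has e^(- t q^2) >= 1/2, so twice that Gaussian already outweighs the first
   term. *)
pose t1 := (2 * q ^+ 2)^-1.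
have t10 : 0 < t1 by rewrite invr_gt0 mulr_gt0// exprn_gt0.
(* The values of [gauss t] at p / 2 and at p have the ratio e^z with z = 3 t p^2 / 4, and B z >= 1
   beyond the second entry. *)
pose t2 := Num.max t1 (4 / (3 * p ^+ 2 * B)).
have t12 : t1 <= t2 by rewrite le_max lexx.
have dc : {within `[t1, t2], continuous (fun t => D2 t - D1 t)}.
  apply: continuous_in_subspaceT => t; rewrite inE/= in_itv/= => /andP[h _].
  have t0 : 0 < t by exact: lt_le_trans h.
  by apply: cvgB; [exact: c2|exact: c1].
have [t3 t3I t3min] := EVT_min t12 dc.
have t30 : 0 < t3 by move: t3I; rewrite in_itv/= => /andP[h _]; exact: lt_le_trans h.
pose c := D2 t3 - D1 t3.
have c0 : 0 < c by rewrite subr_gt0 D12.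
have key t : 0 < t ->
    c * (gauss t p - 2 * gauss t q - B * gauss t (p / 2)) <= D2 t - D1 t.
  move=> t0.
  have gq := gauss_gt0 t q; have gp2 := gauss_gt0 t (p / 2).
  have Bg : 0 < B * gauss t (p / 2) by rewrite mulr_gt0.
  have gp1 : gauss t p <= 1.
    by rewrite -expR0 ler_expR oppr_le0 mulr_ge0 ?sqr_ge0// ltW.
  have d0 := D12 _ t0.
  have neg : gauss t p - 2 * gauss t q - B * gauss t (p / 2) <= 0 ->
      c * (gauss t p - 2 * gauss t q - B * gauss t (p / 2)) <= D2 t - D1 t.
    move=> e0; apply: (@le_trans _ _ 0); last by rewrite subr_ge0 ltW.
    by rewrite mulr_ge0_le0// ltW.
  have [tt1|/ltW tt1] := leP t t1.
    apply: neg; have e1 : 1 + - (t * q ^+ 2) <= gauss t q by exact: expR_ge1Dx.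
    have e2 : t * q ^+ 2 <= 1 / 2.
      have := ler_wpM2r (sqr_ge0 q) tt1.
      suff -> : t1 * q ^+ 2 = 1 / 2 by [].
      by rewrite /t1; field; rewrite gt_eqF.
    lra.
  have [tt2|tt2] := leP t t2.
    have h : D2 t3 - D1 t3 <= D2 t - D1 t by apply: t3min; rewrite in_itv/= tt1.
    apply: le_trans h; rewrite -[leRHS]mulr1 ler_wpM2l ?(ltW c0)//; lra.
  apply: neg.
  have h : gauss t p <= B * gauss t (p / 2).
    have pB : 0 < 3 * p ^+ 2 * B by rewrite mulr_gt0// mulr_gt0 ?exprn_gt0.
    have : 4 / (3 * p ^+ 2 * B) <= t.
      by apply: ltW; apply: le_lt_trans tt2; rewrite le_max lexx orbT.
    rewrite ler_pdivrMr// => h4.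
    set z := 3 * t * p ^+ 2 / 4.
    have Bz : 1 <= B * z by rewrite /z; lra.
    have z0 : 0 < z by rewrite /z divr_gt0// mulr_gt0 ?exprn_gt0// mulr_gt0.
    have -> : gauss t (p / 2) = gauss t p * expR z.
      by rewrite /gauss -expRD; congr expR; rewrite /z; field.
    rewrite mulrCA -[leLHS]mulr1 ler_wpM2l ?(ltW (gauss_gt0 _ _))//.
    apply: le_trans Bz _; rewrite ler_wpM2l ?(ltW B0)//.
    by apply: le_trans (expR_ge1Dx z); rewrite lerDr.
  lra.
have := @posint_compare k1 k2 D1 D2 c (2 * c) (c * B) p q (p / 2) g1 g2 p0 q0 p20.
have hyp t : 0 < t -> D1 t + c * gauss t p <=
    D2 t + (2 * c * gauss t q + c * B * gauss t (p / 2)).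
  move=> /key; move: (gauss _ _) (gauss _ _) (gauss _ _) => x y z; lra.
move=> /(_ hyp) {hyp}.
have [pk1 _] := g1.
have := posint_ge0 (posfunM pk1 (posfun_cm GG fG)).2.
case: (posint (fun r => k1 r * f r)) fin => [L _|//|//]; rewrite lee_fin => L0.
case: (posint (fun r => k2 r * f r)) => [M|_|//]; last by rewrite ltry.
rewrite -!EFinD lee_fin lte_fin -[c * B * _]mulrA BE => h.
have h2 : c * f q < c * (f p / 4) by rewrite ltr_pM2l.
have h3 : 0 < c * f p by rewrite mulr_gt0.
clearbody c; lra.
Qed.

End comparison.

(** * The weight of the space against the Bessel kernels *)

Section weighted_kernels.
Context {R : realType}.
Implicit Types (t r s x nu : R) (k u v f : R -> R).

Definition weber_transform nu s t := weberQ nu (s ^+ 2 / t) / (2 * Num.sqrt t).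

Lemma bessel_kernel_transform nu s : - (1 / 2) < nu -> 0 < s ->
  gauss_transform (bessel_kernel nu s) (weber_transform nu s).
Proof.
move=> nu0 s0; split=> [|t t0]; last exact: weber_integral.
split; first by apply: bessel_kernel_measurable => //; lra.
by move=> r; exact: bessel_kernel_ge0.
Qed.

Lemma weberQ_continuous nu x : - (1 / 2) < nu -> 0 < x -> {for x, continuous (weberQ nu)}.
Proof.
move=> nu0 x0; apply: cvgM; first exact: cvg_cst.
by apply: kummerQ_continuous => //; lra.
Qed.

Lemma weber_transform_continuous nu s t : - (1 / 2) < nu -> 0 < s -> 0 < t ->
  {for t, continuous (weber_transform nu s)}.
Proof.
move=> nu0 s0 t0; have x0 : 0 < s ^+ 2 / t by rewrite divr_gt0// exprn_gt0.
apply: cvgM.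
  apply: (@continuous_comp _ _ _ (fun t => s ^+ 2 / t) (weberQ nu)).
    by apply: cvgM; [exact: cvg_cst|apply: cvgV; [rewrite gt_eqF|exact: cvg_id]].
  exact: weberQ_continuous.
apply: cvgV; first by rewrite mulf_neq0// gt_eqF// sqrtr_gt0.
by apply: cvgM; [exact: cvg_cst|exact: sqrt_continuous].
Qed.

(** For e = nu0 + 1/2 this is r^(2 nu0 + 1) on (0, 1] and 1 beyond, the weight in the hypothesis on
    f. *)
Definition l1_weight (e r : R) := Num.min (r `^ (2 * e)) 1.

Lemma powR_sqr (e r : R) : 0 < r -> (r ^+ 2) `^ e = r `^ (2 * e).
Proof. by move=> r0; rewrite -powR_mulrn ?(ltW r0)// -powRrM. Qed.

Lemma posfun_l1_weight e : posfun (l1_weight e).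
Proof.
split; last by move=> r _; rewrite le_min powR_ge0 ler01.
apply: measurable_minr; last exact: measurable_cst.
by apply: continuous_pos_measurable => r; exact: powR_continuous.
Qed.

(** Since (t r^2)^e <= e^(e t r^2), the weight is at least min(t^(-e), 1) (t r^2)^e e^(- e t r^2);
    against [gauss t] this leaves a Gaussian moment with rate (1 + e) t. *)
Lemma l1_weight_transform e : 0 < e -> exists2 W : R -> R,
  gauss_transform (l1_weight e) W & exists2 K, 0 < K &
  forall t, 0 < t -> K * (Num.min (t `^ (- e)) 1 / Num.sqrt t) <= W t.
Proof.
move=> e0; pose c := e + 1 / 2; have c0 : 0 < c by rewrite /c; lra.
have pw := posfun_l1_weight e.
have E : 2 * c - 1 = 2 * e by rewrite /c; field.
have pm t : posfun (fun r => r `^ (2 * c - 1) * gauss t r).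
  apply: posfunM; last exact: posfun_gauss.
  split=> [|r _]; last exact: powR_ge0.
  by apply: continuous_pos_measurable => r; exact: powR_continuous.
have fin t : 0 < t -> (posint (fun r => l1_weight e r * gauss t r)%R < +oo)%E.
  move=> t0; have [m1 p1] := posfunM pw (posfun_gauss t).
  apply: (@le_lt_trans _ _ (posint (fun r => r `^ (2 * c - 1) * gauss t r)%R)).
    apply: (le_posint m1 (pm t).1 p1) => r r0.
    by rewrite ler_wpM2r ?(ltW (gauss_gt0 _ _))// E ge_min lexx.
  by rewrite gaussian_moment// ltry.
exists (fun t => fine (posint (fun r => l1_weight e r * gauss t r)%R)).
  split=> // t t0; rewrite fineK// ge0_fin_numE ?fin//.
  by have [_ p1] := posfunM pw (posfun_gauss t); exact: posint_ge0.
exists (Gamma c / (2 * (1 + e) `^ c)).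
  by rewrite divr_gt0 ?Gamma_gt0// mulr_gt0// powR_gt0; lra.
move=> t t0; set m := Num.min _ _.
have m0 : 0 <= m by rewrite le_min powR_ge0 ler01.
have [m1 p1] := posfunM pw (posfun_gauss t).
have e1t : 0 < (1 + e) * t by rewrite mulr_gt0//; lra.
have mt0 : 0 <= m * t `^ e by rewrite mulr_ge0// powR_ge0.
have : (posint (fun r => m * t `^ e * (r `^ (2 * c - 1) * gauss ((1 + e) * t) r))%R <=
    posint (fun r => l1_weight e r * gauss t r)%R)%E.
  have [m2 p2] := posfun_scale mt0 (pm ((1 + e) * t)).
  apply: (le_posint m2 m1 p2) => r r0.
  pose X := expR (- (e * (t * r ^+ 2))).
  have -> : gauss ((1 + e) * t) r = X * gauss t r.
    by rewrite /gauss -expRD; congr expR; ring.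
  rewrite E; set rp := r `^ (2 * e).
  have -> : m * t `^ e * (rp * (X * gauss t r)) = m * t `^ e * rp * X * gauss t r by ring.
  rewrite ler_wpM2r ?(ltW (gauss_gt0 _ _))//.
  have rp0 : 0 <= rp by exact: powR_ge0.
  have tr0 : 0 < t * r ^+ 2 by rewrite mulr_gt0// exprn_gt0.
  have x1 : X <= 1.
    by rewrite -expR0 ler_expR oppr_le0 mulr_ge0 ?ltW.
  have x0 : 0 < X by exact: expR_gt0.
  rewrite le_min; apply/andP; split.
    have mt1 : m * t `^ e <= 1.
      have : m <= t `^ (- e) by rewrite ge_min lexx.
      by rewrite powRN -ler_pdivlMr ?powR_gt0// mul1r.
    have -> : m * t `^ e * rp * X = m * t `^ e * X * rp by ring.
    rewrite -[leRHS]mul1r ler_wpM2r// -[leRHS]mulr1.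
    by apply: ler_pM => //; exact: ltW.
  have m1' : m <= 1 by rewrite ge_min lexx orbT.
  have h : (t * r ^+ 2) `^ e * X <= 1.
    by rewrite /X expRN ler_pdivrMr ?expR_gt0// mul1r powR_le_expR ?(ltW e0).
  rewrite powRM ?(ltW t0) ?sqr_ge0// powR_sqr// in h.
  have -> : m * t `^ e * rp * X = m * (t `^ e * rp * X) by ring.
  rewrite -[leRHS]mulr1; apply: ler_pM => //.
  by apply: mulr_ge0; [apply: mulr_ge0 => //; exact: powR_ge0|exact: ltW].
have [m3 p3] := pm ((1 + e) * t).
rewrite (posintZ m3 p3 mt0) gaussian_moment// -EFinM -[leRHS]fineK; last first.
  by rewrite ge0_fin_numE ?fin//; exact: posint_ge0.
rewrite lee_fin; apply: le_trans; rewrite le_eqVlt; apply/orP; left; apply/eqP.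
have tc : t `^ c = t `^ e * Num.sqrt t.
  by rewrite /c powRD ?(gt_eqF t0) ?implybT// div1r powR12_sqrt// ltW.
rewrite powRM ?(ltW t0)//; last by lra.
rewrite tc; have te := powR_gt0 e t0; have st : 0 < Num.sqrt t by rewrite sqrtr_gt0.
have ec : 0 < (1 + e) `^ c by rewrite powR_gt0//; lra.
move: (Gamma c) (t `^ e) (Num.sqrt t) ((1 + e) `^ c) te st ec => g x y z x0 y0 z0.
by field; rewrite !gt_eqF.
Qed.

(** An upper bound of the same shape as the lower bound of [l1_weight_transform], so the two
    transforms can be compared. *)
Lemma weber_transform_le nu e s : 0 < e -> e <= nu + 1 / 2 -> 0 < s ->
  exists2 C, 0 <= C & forall t, 0 < t ->
    weber_transform nu s t <= C * (Num.min (t `^ (- e)) 1 / Num.sqrt t).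
Proof.
move=> e0 ea s0; have nu0 : - (1 / 2) < nu by lra.
have [C C0 HC] := weberQ_bounded nu0.
pose M := Num.max ((s ^+ 2) `^ e) 1.
have M0 : 0 <= M by rewrite le_max ler01 orbT.
exists (C * M / 2) => [|t t0]; first by rewrite divr_ge0// mulr_ge0.
rewrite /weber_transform; set x := s ^+ 2 / t.
have x0 : 0 < x by rewrite divr_gt0// exprn_gt0.
have st : 0 < Num.sqrt t by rewrite sqrtr_gt0.
have h : Num.min (x `^ (nu + 1 / 2)) 1 <= M * Num.min (t `^ (- e)) 1.
  apply: (@le_trans _ _ (Num.min (x `^ e) 1)).
    rewrite le_min; apply/andP; split; last by rewrite ge_min lexx orbT.
    have [x1|/ltW x1] := leP x 1.
      have x01 : 0 < x <= 1 by rewrite x0.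
      by rewrite ge_min; apply/orP; left; exact: ger_powR.
    rewrite ge_min; apply/orP; right.
    by rewrite -[leLHS](powRr0 x) ler_powR// ltW.
  have E : x `^ e = (s ^+ 2) `^ e * t `^ (- e).
    rewrite /x powRM ?sqr_ge0 ?invr_ge0 ?(ltW t0)//; congr (_ * _).
    by rewrite -powR_inv1 ?(ltW t0)// -powRrM mulN1r.
  have te := powR_ge0 t (- e).
  have [h|h] := leP (t `^ (- e)) 1.
    rewrite ge_min E; apply/orP; left; rewrite ler_wpM2r// le_max lexx//.
  by rewrite mulr1 ge_min; apply/orP; right; rewrite le_max lexx orbT.
have Q := HC _ x0.
have -> : weberQ nu x / (2 * Num.sqrt t) = weberQ nu x / 2 / Num.sqrt t.
  by field; rewrite gt_eqF.
rewrite [leRHS]mulrA ler_wpM2r ?invr_ge0 ?(ltW st)//.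
have := ler_wpM2l C0 h; lra.
Qed.
End weighted_kernels.

(** * Scaling, dilation and sums of towers *)

Section tower_operations.
Context {R : realType}.
Implicit Types (G : nat -> R -> R).

Lemma cm_tower_scale G (c : R) : 0 <= c -> cm_tower G -> cm_tower (fun n x => c * G n x).
Proof.
move=> c0 GG n x x0; have [d p] := GG n x x0; split; last exact: mulr_ge0.
by rewrite -mulrN; exact: is_derive_scalef.
Qed.

Lemma cm_tower_comp G (c : R) : 0 < c -> cm_tower G ->
  cm_tower (fun n x => c ^+ n * G n (c * x)).
Proof.
move=> c0 GG n x x0; have [d p] := GG n (c * x) (mulr_gt0 c0 x0).
split; last by rewrite mulr_ge0// exprn_ge0// ltW.
have dl : is_derive x 1 (fun x => c * x) c.
  by have := is_derive_scalef c (is_derive_id x 1); rewrite mulr1.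
have := is_derive_scalef (c ^+ n) (@is_derive1_comp R (G n) (fun x => c * x) x _ _ d dl).
by rewrite exprSr -mulrN -mulrA (mulrC c (- _)).
Qed.

Lemma cm_tower_sum (G : nat -> nat -> R -> R) N : (forall i, cm_tower (G i)) ->
  cm_tower (fun n x => \sum_(i < N) G i n x).
Proof.
move=> GG n x x0; split; last by apply: sumr_ge0 => i _; have [] := GG i n x x0.
rewrite -sumrN; apply: (@is_derive_sumf _ N (fun i => G i n) (fun i => - G i n.+1 x)) => i.
by have [] := GG i n x x0.
Qed.

End tower_operations.

Lemma order_gtN_half {R : realFieldType} (e nu : R) : 0 < e -> e <= nu + 1 / 2 -> - (1 / 2) < nu.
Proof. by move=> e0 ea; lra. Qed.

Lemma posint_fin_num {R : realType} (h : R -> R) : (forall r, 0 < r -> 0 <= h r) ->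
  (posint h < +oo)%E -> posint h \is a fin_num.
Proof. by move=> h0 fin; rewrite ge0_fin_numE// posint_ge0. Qed.

Lemma ltr_eq_eq {R : realType} (a b c d : R) : a = c -> b = d -> c < d -> a < b.
Proof. by move=> -> ->. Qed.

(** * Finiteness, strict comparison and complete monotonicity of the transform of f *)

Section weighted_cm.
Context {R : realType}.
Implicit Types (t r s x nu : R) (k u v : R -> R).
Notation pos := (`]0%R, +oo[%classic : set R).

Lemma in_L1_weight (e : R) (f : R -> R) : 0 < e -> posfun f -> in_L1 (2 * e) 0 f ->
  (posint (fun r => l1_weight e r * f r)%R < +oo)%E.
Proof.
move=> e0 pf [_ fin].
have [m p] := posfunM (posfun_l1_weight e) pf.
apply: le_lt_trans fin; rewrite /posint.
have -> : pos = `]0%R, 1%R] `|` `]1%R, +oo[.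
  by rewrite -itv_bndbnd_setU ?bnd_simp.
rewrite ge0_integral_setU//=; first last.
- by apply/disj_setPLR => x /=; rewrite !in_itv/= andbT => /andP[_ h]; apply/negP; rewrite -leNgt.
- move=> x h; rewrite lee_fin p//; case: h; rewrite in_itv/= => /andP[]//.
  by move=> x1 _; exact: lt_trans x1.
- by rewrite -itv_bndbnd_setU ?bnd_simp//; exact/measurable_EFinP.
rewrite le_eqVlt; apply/orP; left; apply/eqP; congr (_ + _)%E; apply: eq_integral => x;
  rewrite inE/= in_itv/= ?andbT.
- move=> /andP[x0 x1]; congr EFin; rewrite mulrC ger0_norm; last exact: pf.2.
  congr (_ * _); apply/min_idPl.
  by rewrite -[leRHS](powRr0 x) ger_powR ?x0// ?mulr_ge0// ltW.
- move=> x1; congr EFin; have x0 : 0 < x by exact: lt_trans x1.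
  rewrite mulrC ger0_norm; last exact: pf.2.
  rewrite powRr0 mulr1 -[RHS]mulr1; congr (_ * _); apply/min_idPr.
  by rewrite -[leLHS](powRr0 x) ler_powR ?mulr_ge0// ltW.
Qed.

Variables (e : R) (f : R -> R) (G : nat -> R -> R).
Hypothesis e0 : 0 < e.
Hypothesis GG : cm_tower G.
Hypothesis fG : forall r, 0 < r -> f r = G 0%N (r ^+ 2).
Hypothesis L1f : in_L1 (2 * e) 0 f.

Let pf : posfun f. Proof. exact: posfun_cm GG fG. Qed.

(** The transform of the kernel is at most C / K times that of the weight; [posint_transform_le]
    carries this to f, with no pointwise comparison of kernel and weight. *)
Lemma bessel_integral_lty nu s : e <= nu + 1 / 2 -> 0 < s ->
  (posint (fun r => bessel_kernel nu s r * f r)%R < +oo)%E.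
Proof.
move=> ea s0; have nu0 := order_gtN_half e0 ea.
have [W gW [K K0 HK]] := l1_weight_transform e0.
have [C C0 HC] := weber_transform_le e0 ea s0.
have gB := bessel_kernel_transform nu0 s0.
have CK : 0 <= C / K by rewrite divr_ge0// ltW.
apply: (le_lt_trans (posint_transform_le GG fG gB (gauss_transformZ CK gW) _)).
  move=> t t0; apply: le_trans (HC t t0) _.
  have := ler_wpM2l CK (HK t t0); apply: le_trans; rewrite le_eqVlt; apply/orP; left.
  by apply/eqP; field; rewrite !gt_eqF// sqrtr_gt0.
have [m p] := posfunM (posfun_l1_weight e) pf.
rewrite (@eq_posint _ _ (fun r => C / K * (l1_weight e r * f r))); last first.
  by move=> r _; rewrite mulrA.
rewrite (posintZ m p CK) lte_mul_pinfty// ?lee_fin//.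
exact: in_L1_weight.
Qed.

(** If f >= eta throughout, the weighted integral L of f bounds eta W(t) for all t, while W(t) >= K
    / sqrt t for t <= 1. The contradiction is drawn at t = z^2 with z small. *)
Lemma cm_L1_small (eta : R) : 0 < eta -> exists2 q : R, 0 < q & f q < eta.
Proof.
move=> eta0; apply: contrapT => H.
have fe r : 0 < r -> eta <= f r.
  by move=> r0; rewrite leNgt; apply/negP => h; apply: H; exists r.
have [W [pw gW] [K K0 HK]] := l1_weight_transform e0.
have := in_L1_weight e0 pf L1f.
have [m p] := posfunM (posfun_l1_weight e) pf.
have I0 := posint_ge0 p.
case E : (posint (fun r => l1_weight e r * f r)) I0 => [L|//|//]; rewrite lee_fin => L0 _.
have WL t : 0 < t -> eta * W t <= L.
  move=> t0; rewrite -lee_fin -E EFinM -gW//.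
  have [m1 p1] := posfunM pw (posfun_gauss t).
  rewrite -(posintZ m1 p1 (ltW eta0)); apply: le_posint => //.
  - exact: measurable_funM.
  - by move=> r r0; rewrite mulr_ge0 ?p1// ltW.
  - move=> r r0; rewrite mulrCA ler_wpM2l ?pw.2//.
    apply: le_trans (fe _ r0); rewrite -[leRHS]mulr1 ler_wpM2l ?(ltW eta0)//.
    by rewrite -expR0 ler_expR oppr_le0 mulr_ge0 ?sqr_ge0// ltW.
pose z := Num.min 1 (eta * K / (L + 1)).
have z0 : 0 < z by rewrite lt_min ltr01 divr_gt0 ?mulr_gt0//; lra.
have z1 : z <= 1 by rewrite ge_min lexx.
have zL : z * (L + 1) <= eta * K.
  by rewrite -ler_pdivlMr; [rewrite ge_min lexx orbT|lra].
have t0 : 0 < z ^+ 2 by rewrite exprn_gt0.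
have := HK _ t0; rewrite sqrtr_sqr (gtr0_norm z0).
have -> : Num.min ((z ^+ 2) `^ (- e)) 1 = 1.
  apply/min_idPr; rewrite powRN -[leLHS]invr1 lef_pV2 ?posrE ?powR_gt0//.
  rewrite powR_sqr// -[leRHS](powRr0 z) ger_powR ?z0//.
  by rewrite mulr_ge0// ltW.
have := WL _ t0; rewrite div1r => h1 h2.
have h3 : eta * K <= L * z.
  rewrite -ler_pdivrMr//; apply: le_trans h1.
  by rewrite -mulrA ler_wpM2l// ltW.
lra.
Qed.

Lemma tame_bessel_lty nu s u : e <= nu + 1 / 2 -> 0 < s -> tame f u ->
  (posint (fun r => bessel_kernel nu s r * u r)%R < +oo)%E.
Proof.
move=> ea s0 [pu Hu]; have nu0 := order_gtN_half e0 ea.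
have gB := bessel_kernel_transform nu0 s0.
have [pB hB] := gB.
have [m p] := posfunM pB pu.
case: Hu => [[C [d [C0 d0 uC]]]|uf].
  have [m1 p1] := posfunM pB (posfun_scale C0 (posfun_gauss d)).
  apply: (@le_lt_trans _ _ (posint (fun r => bessel_kernel nu s r * (C * gauss d r))%R)).
    by apply: (le_posint m m1 p) => r r0; rewrite ler_wpM2l ?uC// pB.2.
  by rewrite posint_mulZ// ?hB// -?EFinM ?ltry//; exact: posfun_gauss.
have [m1 p1] := posfunM pB pf.
apply: le_lt_trans (bessel_integral_lty ea s0).
by apply: (le_posint m m1 p) => r r0; rewrite ler_wpM2l ?uf// pB.2.
Qed.

(** Convertible to [T nu u s]. *)
Definition bessel_transform nu u s :=
  pi * fine (posint (fun r => bessel_kernel nu s r * u r)).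

(** Order and argument may both change, so monotonicity in s, monotonicity in nu and the comparison
    of -nu with nu are all instances. *)
Lemma bessel_transform_lt nu nu' s s' : e <= nu + 1 / 2 -> e <= nu' + 1 / 2 ->
  0 < s -> 0 < s' -> (exists2 p, 0 < p & 0 < f p) ->
  (forall t, 0 < t -> weber_transform nu s t < weber_transform nu' s' t) ->
  bessel_transform nu f s < bessel_transform nu' f s'.
Proof.
move=> ea ea' s0 s'0 [p p0 fp0] H.
have nu0 := order_gtN_half e0 ea.
have nu'0 := order_gtN_half e0 ea'.
have g1 := bessel_kernel_transform nu0 s0.
have g2 := bessel_kernel_transform nu'0 s'0.
have fin1 := bessel_integral_lty ea s0; have fin2 := bessel_integral_lty ea' s'0.
have c1 t (t0 : 0 < t) := weber_transform_continuous nu0 s0 t0.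
have c2 t (t0 : 0 < t) := weber_transform_continuous nu'0 s'0 t0.
rewrite ltr_pM2l ?pi_gt0//; apply: fine_lt.
- exact: posint_fin_num (posfunM g1.1 pf).2 fin1.
- exact: posint_fin_num (posfunM g2.1 pf).2 fin2.
- exact: (posint_transform_lt GG fG g1 g2 c1 c2 H p0 fp0 cm_L1_small fin1).
Qed.

Lemma bessel_transform_add_lt nu s s' : e <= nu + 1 / 2 ->
  0 < s -> 0 < s' -> (exists2 p, 0 < p & 0 < f p) ->
  (forall t, 0 < t -> weber_transform nu s t + weber_transform (nu + 1) s t <
    weber_transform nu s' t + weber_transform (nu + 1) s' t) ->
  bessel_transform nu f s + bessel_transform (nu + 1) f s <
  bessel_transform nu f s' + bessel_transform (nu + 1) f s'.
Proof.
move=> ea s0 s'0 [p p0 fp0] H.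
have ea' : e <= nu + 1 + 1 / 2 by lra.
have nu0 := order_gtN_half e0 ea.
have nu'0 := order_gtN_half e0 ea'.
have sumE x : 0 < x -> bessel_transform nu f x + bessel_transform (nu + 1) f x =
    pi * fine (posint (fun r => (bessel_kernel nu x r + bessel_kernel (nu + 1) x r) * f r)) /\
    (posint (fun r => (bessel_kernel nu x r + bessel_kernel (nu + 1) x r) * f r)%R < +oo)%E.
  move=> x0.
  have [p1 _] := bessel_kernel_transform nu0 x0.
  have [p2 _] := bessel_kernel_transform nu'0 x0.
  have [m1 q1] := posfunM p1 pf; have [m2 q2] := posfunM p2 pf.
  have fin1 := bessel_integral_lty ea x0; have fin2 := bessel_integral_lty ea' x0.
  rewrite (@eq_posint _ _ (fun r => bessel_kernel nu x r * f r +
    bessel_kernel (nu + 1) x r * f r)); last by move=> r _; rewrite mulrDl.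
  rewrite (posintD m1 m2 q1 q2) (fineD (posint_fin_num q1 fin1) (posint_fin_num q2 fin2)).
  by split; [rewrite mulrDr|exact: lte_add_pinfty fin1 fin2].
have [E1 fin1] := sumE _ s0; have [E2 fin2] := sumE _ s'0.
apply: (ltr_eq_eq E1 E2); clear E1 E2.
have g1 := gauss_transformD (bessel_kernel_transform nu0 s0) (bessel_kernel_transform nu'0 s0).
have g2 := gauss_transformD (bessel_kernel_transform nu0 s'0) (bessel_kernel_transform nu'0 s'0).
have c x t (x0 : 0 < x) (t0 : 0 < t) : {for t, continuous (fun t =>
    weber_transform nu x t + weber_transform (nu + 1) x t)}.
  exact: (cvgD (weber_transform_continuous nu0 x0 t0) (weber_transform_continuous nu'0 x0 t0)).
have c1 t (t0 : 0 < t) := c s t s0 t0; have c2 t (t0 : 0 < t) := c s' t s'0 t0.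
rewrite ltr_pM2l ?pi_gt0//; apply: fine_lt.
- exact: posint_fin_num (posfunM g1.1 pf).2 fin1.
- exact: posint_fin_num (posfunM g2.1 pf).2 fin2.
- exact: (posint_transform_lt GG fG g1 g2 c1 c2 H p0 fp0 cm_L1_small fin1).
Qed.

(** For a Gaussian of rate tau, the power of s cancels the factor x^a of [kummerQ] at x = s / tau,
    and a dilation of [cm_tower_kummer] remains. Limits are handled by [cm_tower_lim]. *)
Lemma bessel_transform_cm nu : e <= nu + 1 / 2 ->
  completely_monotone (fun s => s `^ (- nu - 1 / 2) * bessel_transform nu f (Num.sqrt s)).
Proof.
move=> ea; have nu0 := order_gtN_half e0 ea.
have a0 : 0 < nu + 1 / 2 by lra.
have gB s (s0 : 0 < s) := bessel_kernel_transform nu0 s0.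
apply: (@cm_induction _ f G GG fG (fun u =>
  completely_monotone (fun s => s `^ (- nu - 1 / 2) * bessel_transform nu u (Num.sqrt s)))).
- move=> w tau N w0 tau0.
  pose c i := pi * (w i * (4 `^ (- nu) / Gamma (nu + 1) *
    (tau i `^ (- (nu + 1 / 2)) / (2 * Num.sqrt (tau i))))).
  have c0 i : 0 <= c i.
    rewrite mulr_ge0 ?pi_ge0// mulr_ge0// mulr_ge0 ?(ltW (weber_const_gt0 nu0))//.
    by rewrite divr_ge0 ?powR_ge0// mulr_ge0// sqrtr_ge0.
  have tv i : 0 < (tau i)^-1 by rewrite invr_gt0.
  apply: (tower_completely_monotone (cm_tower_sum N (fun i =>
    cm_tower_scale (c0 i) (cm_tower_comp (tv i) (cm_tower_kummer a0))))).
  move=> x x0 /=; have sx0 : 0 < Num.sqrt x by rewrite sqrtr_gt0.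
  rewrite /bessel_transform (@posint_gauss_comb _ _ w tau
    (fun i => weber_transform nu (Num.sqrt x) (tau i)))//; last first.
  + by move=> i; exact: (gB _ sx0).2.
  + exact: gauss_transform_kernel (gB _ sx0).
  rewrite /= mulr_sumr mulr_sumr; apply: eq_bigr => i _.
  have ti := tau0 i; have e1 : ((tau i)^-1) `^ (nu + 1 / 2) = tau i `^ (- (nu + 1 / 2)).
    by rewrite -(powR_inv1 (ltW ti)) -powRrM mulN1r.
  have e2 : x `^ (- nu - 1 / 2) = (x `^ (nu + 1 / 2))^-1 by rewrite -powRN opprD.
  have xa := powR_gt0 (nu + 1 / 2) x0; have st : 0 < Num.sqrt (tau i) by rewrite sqrtr_gt0.
  rewrite expr0 mul1r /rho pratio0 mul1r addr0 /weber_transform sqr_sqrtr ?(ltW x0)//.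
  rewrite /weberQ /kummerQ [x / tau i]mulrC powRM ?(ltW x0) ?invr_ge0 ?(ltW ti)// e1 e2 /c /rho.
  move: (expR _ * _) (x `^ _) (Num.sqrt _) (_ `^ (- _)) (4 `^ _ / _) xa st => A B C D E B0 C0.
  by field; rewrite !gt_eqF.
- move=> u_ u Pu tu_ tu lim klim.
  apply: (cm_tower_lim (fun n => completely_monotone_tower (Pu n))) => x x0 /=.
  have sx0 : 0 < Num.sqrt x by rewrite sqrtr_gt0.
  have gk := gauss_transform_kernel (gB _ sx0).
  have fin := tame_bessel_lty ea sx0 tu.
  have := klim _ gk; rewrite -(fineK (posint_fin_num (posfunM (gB _ sx0).1 tu.1).2 fin)).
  move=> /fine_cvg cv.
  have lim2 : x `^ (- nu - 1 / 2) * bessel_transform nu (u_ n) (Num.sqrt x) @[n --> \oo] -->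
      x `^ (- nu - 1 / 2) * bessel_transform nu u (Num.sqrt x).
    by apply: cvgM; [exact: cvg_cst|apply: cvgM; [exact: cvg_cst|exact: cv]].
  by apply: (cvg_ext _ lim2) => n; rewrite expr0 mul1r.
Qed.

End weighted_cm.

Theorem theorem1p6 (R : realType) (nu0 : R) (f : R -> R)
  (hnu0 : - (1 / 2) < nu0)
  (hf : in_L1 (2 * nu0 + 1) 0 f)
  (hcm : completely_monotone (fun r => f (Num.sqrt r)))
  (hnz : exists r : R, 0 < r /\ f (Num.sqrt r) <> 0) :
  (forall nu : R, nu0 <= nu ->
     completely_monotone (fun s => s `^ (- nu - 1 / 2) * T nu f (Num.sqrt s)))
  /\
  (forall nu : R, 1 / 2 <= nu -> nu0 <= nu ->
     forall s t : R, 0 < s -> s < t -> T nu f s < T nu f t)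
  /\
  (forall nu : R, - (1 / 2) < nu -> nu0 <= nu ->
     forall s t : R, 0 < s -> s < t ->
       T nu f s + T (nu + 1) f s < T nu f t + T (nu + 1) f t)
  /\
  (forall s : R, 0 < s ->
     forall mu nu : R, 0 <= mu -> nu0 <= mu -> mu < nu ->
       T nu f s < T mu f s)
  /\
  (forall nu s : R, - (1 / 2) < nu -> nu < 0 -> nu0 <= nu -> 0 < s ->
     T (- nu) f s < T nu f s).
Proof.
pose e := nu0 + 1 / 2; have e0 : 0 < e by rewrite /e; lra.
have GG := completely_monotone_tower hcm; set G := (fun n x => _) in GG.
have fG (r : R) : 0 < r -> f r = G 0%N (r ^+ 2).
  by move=> r0; rewrite /G expr0 mul1r /= sqrtr_sqr gtr0_norm.
have L1f : in_L1 (2 * e) 0 f.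
  by rewrite (_ : 2 * e = 2 * nu0 + 1)//; rewrite /e; field.
have ea (nu : R) : nu0 <= nu -> e <= nu + 1 / 2 by move=> h; rewrite /e; lra.
have fp : exists2 p, 0 < p & 0 < f p.
  have [r [r0 fr]] := hnz; have s0 : 0 < Num.sqrt r by rewrite sqrtr_gt0.
  exists (Num.sqrt r) => //; rewrite lt_neqAle eq_sym; apply/andP; split; first exact/eqP.
  by rewrite fG//; have [] := GG 0%N (Num.sqrt r ^+ 2) (exprn_gt0 2 s0).
have st (t : R) : 0 < t -> 0 < (2 * Num.sqrt t)^-1.
  by move=> t0; rewrite invr_gt0 mulr_gt0// sqrtr_gt0.
have xst (s t u : R) : 0 < s -> s < t -> 0 < u -> 0 < s ^+ 2 / u /\ s ^+ 2 / u < t ^+ 2 / u.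
  move=> s0 lt_st u0; split; first by rewrite divr_gt0// exprn_gt0.
  by rewrite ltr_pM2r ?invr_gt0// ltrXn2r// ltW.
split; first by move=> nu h; exact: (bessel_transform_cm e0 GG fG L1f (ea _ h)).
split.
  move=> nu h1 h s t s0 lt_st.
  apply: (bessel_transform_lt e0 GG fG L1f (ea _ h) (ea _ h) s0 (lt_trans s0 lt_st) fp) => u u0.
  have [x0 xy] := xst _ _ _ s0 lt_st u0.
  rewrite ltr_pM2r ?st// ltr_pM2l; last by apply: weber_const_gt0; lra.
  (* The assumption nu >= 1/2 is a >= 1. *)
  by apply: kummerQ_incr => //; lra.
split.
  move=> nu h1 h s t s0 lt_st.
  apply: (bessel_transform_add_lt e0 GG fG L1f (ea _ h) s0 (lt_trans s0 lt_st) fp) => u u0.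
  have [x0 xy] := xst _ _ _ s0 lt_st u0.
  rewrite /weber_transform -!mulrDl ltr_pM2r ?st// !weberQ_next// /weberQ -!mulrDr.
  rewrite ltr_pM2l; last exact: weber_const_gt0.
  by apply: kummerQ_add_next_incr => //; lra.
split.
  move=> s s0 mu nu mu0 h munu.
  have h' : nu0 <= nu by rewrite (le_trans h)// ltW.
  apply: (bessel_transform_lt e0 GG fG L1f (ea _ h') (ea _ h) s0 s0 fp) => u u0.
  rewrite ltr_pM2r ?st//; apply: weberQ_lt => //.
  by rewrite divr_gt0// exprn_gt0.
move=> nu s h1 h2 h s0.
have h' : nu0 <= - nu by lra.
apply: (bessel_transform_lt e0 GG fG L1f (ea _ h') (ea _ h) s0 s0 fp) => u u0.
(* The increment d = - 2 nu lies in (0, 1), and the two orders have sum 0, the borderline case of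
   the Wronskian argument. *)
rewrite ltr_pM2r ?st// (_ : - nu = nu + (- 2 * nu)); last by ring.
apply: weberQ_lt_near => //; last by rewrite divr_gt0// exprn_gt0.
- by lra.
- by lra.
Qed.
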